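(* Let $0<\alpha<1$ and let $\{B(t): t\in[0,1]\}$ be a fractional Brownian motion of Hurst index $\alpha$. Let $D\subset[0,1]$ with $\dim_H D\le\alpha$ and define the random family of sets $\Gamma_D=\{E\subset B(D): \dim_H E=\dim_P E\}$. Then $$\mathbb{P}\big(\dim_H(B^{-1}(E)\cap D)=\alpha\dim_H E \text{ for all } E\in\Gamma_D\big)=1.$$ In particular, almost surely, all level sets of $B|_D$ (that is, the sets $\{t\in D: B(t)=y\}$ for $y\in B(D)$) have Hausdorff dimension zero.
   Context: Fractional Brownian motion of Hurst index $\alpha\in(0,1)$: a Gaussian process $B$ with stationary increments such that $B(0)=0$, $t^{-\alpha}B(t)$ is standard normal for every $t>0$, and almost surely $t\mapsto B(t)$ is continuous; it is real-valued, with covariance $\mathbb{E}(B(t)B(s))=\frac12(|t|^{2\alpha}+|s|^{2\alpha}-|t-s|^{2\alpha})$. $B(D)=\{B(t):t\in D\}$ and $B^{-1}(E)=\{t\in[0,1]:B(t)\in E\}$. A statement $\mathbb{P}(\cdots)=1$ means that the property in parentheses holds almost surely. $\dim_H$ is Hausdorff dimension and $\dim_P$ is packing dimension, $\dim_P X=\inf\{\sup_i\overline{\dim}_M X_i: X=\bigcup_{i=1}^\infty X_i\}$, where $\overline{\dim}_M$ is the upper Minkowski dimension. *)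

(* Defs.v *)
From HB Require Import structures.
From mathcomp Require Import all_boot all_order all_algebra.
From mathcomp Require Import all_classical all_reals all_analysis.

Set Implicit Arguments.
Unset Strict Implicit.
Unset Printing Implicit Defensive.

Import Order.TTheory GRing.Theory Num.Theory.
Import numFieldNormedType.Exports.

Local Open Scope classical_set_scope.
Local Open Scope ring_scope.
Local Open Scope ereal_scope.

Section dimensions.
Context {R : realType}.
Implicit Types (A X : set R).

Definition diameter A : \bar R :=
  ereal_sup [set (`|x - y|%R)%:E | x in A & y in A].

(* [diam A ^ s], with [0 ^ 0 = 1]; the empty set has weight 0, also for
   [s = 0]. *)
Definition hausdorff_weight (s : R) A : \bar R :=
  if A == set0 then 0 else diameter A `^ s.

Definition hausdorff_premeasure (s delta : R) A : \bar R :=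
  ereal_inf [set \sum_(0 <= i <oo) hausdorff_weight s (U i) |
    U in [set U : nat -> set R |
      A `<=` \bigcup_i U i /\ forall i, diameter (U i) <= delta%:E]].

Definition hausdorff_measure (s : R) A : \bar R :=
  ereal_sup [set hausdorff_premeasure s delta A |
    delta in [set delta : R | (0 < delta)%R]].

Definition hausdorff_dim A : \bar R :=
  ereal_inf [set s%:E |
    s in [set s : R | (0 <= s)%R /\ hausdorff_measure s A = 0]].

(* At least one ball is always used, so that the empty set, like a point, has
   covering number 1 and hence upper Minkowski dimension 0.  The value is
   +oo when [X] is unbounded. *)
Definition covering_number X (r : R) : \bar R :=
  ereal_inf [set (n.+1%:R)%:E |
    n in [set n : nat | exists c : 'I_n.+1 -> R,
      X `<=` \bigcup_i closed_ball (c i) r]].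

Definition upper_minkowski_dim X : \bar R :=
  limf_esup (fun r : R => lne (covering_number X r) / (ln r^-1)%:E) 0^'+.

Definition packing_dim X : \bar R :=
  ereal_inf [set ereal_sup (range (fun i => upper_minkowski_dim (U i))) |
    U in [set U : nat -> set R | X = \bigcup_i U i]].

End dimensions.

Section processes.
Context d (T : measurableType d) (R : realType) (P : probability T R).
Local Open Scope ring_scope.

(* The degenerate case is treated apart because [normal_prob m 0] is not the
   Dirac measure at [m]. *)
Definition gaussian_variable (X : T -> R) : Prop :=
  (exists m s : R, s != 0 /\
    forall A : set R, measurable A -> pushforward P X A = normal_prob m s A) \/
  (exists m : R,
    forall A : set R, measurable A -> pushforward P X A = \d_m A).

Definition gaussian_process (I : set R) (B : R -> T -> R) : Prop :=
  forall (n : nat) (t c : 'I_n -> R), (forall i, I (t i)) ->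
    gaussian_variable (fun w => \sum_(i < n) c i * B (t i) w).

Definition stationary_increments (I : set R) (B : R -> T -> R) : Prop :=
  forall (n : nat) (u h : R) (t : 'I_n -> R),
    I u -> I (u + h) -> (forall i, I (t i)) -> (forall i, I (t i + h)) ->
  forall A : set (n.-tuple R), measurable A ->
    pushforward P (fun w => [tuple B (t i + h) w - B (u + h) w | i < n]) A =
    pushforward P (fun w => [tuple B (t i) w - B u w | i < n]) A.

(* The process is indexed by [0, 1]; the values of [B] at other times are
   irrelevant. *)
Record fractional_brownian_motion (alpha : R) (B : R -> {RV P >-> R}) : Prop :=
  FractionalBrownianMotion {
    fbm_gaussian : gaussian_process `[0, 1] B;
    fbm_stationary : stationary_increments `[0, 1] B;
    fbm_start : {ae P, forall w, B 0 w = 0};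
    fbm_scaling : forall t : R, 0 < t <= 1 ->
      forall A : set R, measurable A ->
        pushforward P (fun w => t `^ (- alpha) * B t w) A = normal_prob 0 1 A;
    fbm_continuous :
      {ae P, forall w, {within `[0, 1], continuous (fun t : R => B t w)}};
    fbm_covariance : forall s t : R, 0 <= s <= 1 -> 0 <= t <= 1 ->
      ('E_P[(fun w => B t w * B s w)%R] =
        (2^-1 * (`|t| `^ (2 * alpha) + `|s| `^ (2 * alpha)
                 - `|t - s| `^ (2 * alpha)))%R%:E)%E
  }.

End processes.

(* Main.v *)
From HB Require Import structures.
Require Import Defs.
From mathcomp Require Import all_boot all_order all_algebra.
From mathcomp Require Import all_classical all_reals all_analysis.
From mathcomp Require Import measurable_realfun ring lra zify.

Set Implicit Arguments.
Unset Strict Implicit.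
Unset Printing Implicit Defensive.

Import Order.TTheory GRing.Theory Num.Theory.
Import numFieldNormedType.Exports.

Local Open Scope classical_set_scope.
Local Open Scope ring_scope.

(** Let [A] be the set of the times in [D] that [B] maps into [E]; then
    [E = B(A)], because [E] lies in [B(D)].

    The lower bound [alpha * dim_H E <= dim_H A] comes from the regularity of
    the paths: by Gaussian tails and chaining along dyadic times they are
    Hoelder of every exponent [g < alpha] ([fbm_hoelder]), and such a map
    multiplies Hausdorff dimensions by at most [1 / g]
    ([hausdorff_null_hoelder]).

    For the upper bound [dim_H A <= alpha * dim_P E], packing dimension reduces
    the question to the preimages of sets [F] of upper Minkowski dimension less
    than [u], and a single event of probability 1 has to serve all [F].  Fix a
    small [e].  Since [dim_H D < alpha + e], the set [D] has a balanced family
    of dyadic cells ([balanced_family]): each point of [D] lies in chosen cells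
    of arbitrarily high level, and a cell of level [m] contains at most
    [(n + 1) * 2 ^ ((n - m) * (alpha + e))] chosen cells of level [n].  The
    heart of the proof is that almost surely, for all large [n], no interval of
    length of order [2 ^ (- n * (alpha - e))] contains the values of [B] at more
    than a constant times [2 ^ (4 * n * e)] of the chosen times of level [n]
    ([fbm_spread]).  As [F] is covered by [2 ^ (n * (alpha - e) * u)] such
    intervals, the chosen cells of level [n] that meet its preimage number at
    most a constant times [2 ^ (n * ((alpha - e) * u + 4 * e))], which bounds
    the dimension of the preimage ([preimage_null]).  A point has packing
    dimension 0, so this bound alone yields the assertion on level sets.

    The spreading estimate is a computation of moments.  The number of chosen
    times [t_k] whose value is near that of [t_k1] is at most a constant times
    [G], the sum over [k] of [expR (- X_k ^ 2 / 2)] with [X_k] the rescaled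
    increment between [t_k1] and [t_k].  The expectation of a product of such
    factors is, up to a power of [2 * pi], the value at 0 of the joint density
    of the [X_k] blurred by independent standard normal errors, and it factors
    into conditional densities ([expectation_cos_bump], [density_at0]).  By
    strong local nondeterminism the conditional variance of [X_k] is bounded
    below in terms of the distance of [t_k] to the nearest time already used.
    Hence summing over one more index costs a factor [M] per time already
    used, where [M] bounds a discrete Riesz energy of order [alpha] of the
    chosen times; it is of order [2 ^ (3 * n * e)] by balance
    ([balanced_energy]).  So the moment of order [p] of [G] is at most
    [(M * p) ^ p] ([cluster_moment]), and Markov's inequality for a large [p]
    and the Borel-Cantelli lemma give the estimate.

    Strong local nondeterminism ([strong_local_nondeterminism]) is proved on a
    concrete model of the covariance.  Tents of all scales centred at [t] form
    a function [wavelet t] of scale and position; by scaling, the weighted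
    square distance of [wavelet t] and [wavelet u] is a constant times
    [`|t - u| `^ (2 * alpha)].  So the variance of a combination of increments
    is a constant times the integral of the square of a combination of such
    functions, and at the scales that are small compared with the distance
    from an isolated time to the others its tent meets no other one. *)

(** * Affine substitution in Lebesgue integrals *)

Section affine_substitution.
Context {R : realType}.
Local Notation mu := (@lebesgue_measure R).

Lemma measurable_affine (a b : R) : measurable_fun setT (fun x : R => a * x + b).
Proof.
by apply: measurable_funD => //; apply: measurable_funM.
Qed.

Lemma lebesgue_measure_affine (a b : R) (A : set R) : 0 < a -> measurable A ->
  mu ((fun x => a * x + b) @^-1` A) = (a^-1%:E * mu A)%E.
Proof.
move=> a0 mA.
have ma : @measurable_fun _ _ (measurableTypeR R) (measurableTypeR R) setT
    (fun x : R => a * x + b) := measurable_affine a b.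
pose pf : {measure set (measurableTypeR R) -> \bar R} :=
  measure_function_pushforward__canonical__measure_function_Measure mu ma.
have a_ge0 : 0 <= a by exact: ltW.
pose k : {nonneg R} := NngNum a_ge0.
pose nu : {measure set (measurableTypeR R) -> \bar R} :=
  mscale k pf.
have nuE X : nu X = (a%:E * mu ((fun x => (a * x + b)%R) @^-1` X))%E by [].
have -> : mu A = nu A.
  apply: lebesgue_measure_unique => // _ [[u v] _ <-]; rewrite nuE /=.
  have -> : (fun x => a * x + b) @^-1` `]u, v] = `](u - b) / a, (v - b) / a]%classic.
    apply/seteqP; split => x /=; rewrite !in_itv/= ltr_pdivrMr// ler_pdivlMr//.
      by rewrite ltrBlDr lerBrDr (mulrC x).
    by rewrite ltrBlDr lerBrDr (mulrC x).
  rewrite !lebesgue_measure_itv/= !lte_fin ltr_pM2r ?invr_gt0// ltrD2r.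
  case: ifPn => _; last by rewrite mule0.
  rewrite -!EFinB -EFinM; congr EFin; field; lra.
rewrite nuE muleA -EFinM mulVf ?mul1e//; lra.
Qed.

Lemma ge0_integral_affine (a b : R) (f : R -> \bar R) : 0 < a ->
  measurable_fun setT f -> (forall x, 0 <= f x)%E ->
  (\int[mu]_x f (a * x + b)%R = a^-1%:E * \int[mu]_x f x)%E.
Proof.
move=> a0 mf f0.
have ia_ge0 : 0 <= a^-1 by rewrite invr_ge0 ltW.
pose k : {nonneg R} := NngNum ia_ge0.
have ma := measurable_affine a b.
rewrite -[RHS](@ge0_integral_mscale _ _ _ _ _ measurableT k)//.
rewrite -[LHS](@ge0_integral_pushforward _ _ (measurableTypeR R) (measurableTypeR R) R
  (fun x : R => a * x + b) ma mu setT f)//.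
apply: eq_measure_integral => A mA _.
by rewrite /mscale /= /pushforward lebesgue_measure_affine.
Qed.

End affine_substitution.

(** * Tent functions *)

Section tent.
Context {R : realType}.
Local Notation mu := (@lebesgue_measure R).
Implicit Types x y : R.

Lemma ge0_integral_oppr (f : R -> \bar R) :
  measurable_fun setT f -> (forall x, 0 <= f x)%E ->
  (\int[mu]_x f (- x)%R = \int[mu]_x f x)%E.
Proof.
move=> mf f0.
have mo : @measurable_fun _ _ (measurableTypeR R) (measurableTypeR R) setT
    (fun x : R => - x) by exact: oppr_measurable.
rewrite -[LHS](@ge0_integral_pushforward _ _ (measurableTypeR R)
  (measurableTypeR R) R _ mo mu setT f)//.
by apply: eq_measure_integral => A mA _; exact: lebesgue_measureN.
Qed.

Definition tent (x : R) : R := Num.max 0 (1 - `|x|).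

Lemma tent_ge0 x : 0 <= tent x.
Proof. by rewrite /tent le_max lexx. Qed.

Lemma tent_le1 x : tent x <= 1.
Proof. by rewrite /tent ge_max ler01 /= gerBl. Qed.

Lemma tent_out x : 1 <= `|x| -> tent x = 0.
Proof. by move=> x1; apply/max_idPl; rewrite subr_le0. Qed.

Lemma tent_in x : `|x| <= 2^-1 -> 2^-1 <= tent x.
Proof. by move=> x1; rewrite /tent le_max; apply/orP; right; lra. Qed.

Lemma tent_lipschitz x y : `|tent x - tent y| <= `|x - y|.
Proof.
have := ler_dist_dist x y; rewrite /tent.
move: (normr_ge0 (x - y)) => d0.
rewrite !ler_norml => /andP[h1 h2].
by case: (leP 0 (1 - `|x|)) => hx; case: (leP 0 (1 - `|y|)) => hy;
   apply/andP; split; lra.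
Qed.

Lemma measurable_tent : measurable_fun setT tent.
Proof.
apply: measurable_maxr => //; exact: measurable_funB.
Qed.

Definition tent_gap (y : R) : \bar R :=
  \int[mu]_x ((tent x - tent (x - y)) ^+ 2)%:E.

Lemma measurable_tent_diff (y : R) :
  measurable_fun setT (fun x => ((tent x - tent (x - y)) ^+ 2)%:E).
Proof.
apply/measurable_EFinP; apply: measurable_funX; apply: measurable_funB.
  exact: measurable_tent.
by apply: measurableT_comp; [exact: measurable_tent|exact: measurable_funB].
Qed.

Lemma tent_gapN y : tent_gap (- y) = tent_gap y.
Proof.
rewrite /tent_gap -[RHS]mul1e -invr1.
rewrite -(ge0_integral_affine y ltr01); last 2 first.
- exact: measurable_tent_diff.
- by move=> x; rewrite lee_fin sqr_ge0.
by apply: eq_integral => x _; rewrite mul1r addrK opprK; congr EFin; ring.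
Qed.

Lemma tent_gap_ge0 y : (0 <= tent_gap y)%E.
Proof. by apply: integral_ge0 => x _; rewrite lee_fin sqr_ge0. Qed.

Lemma integral_itv_cst (a b k : R) : a <= b -> 0 <= k ->
  (\int[mu]_x (k * \1_`[a, b] x)%:E = (k * (b - a))%:E)%E.
Proof.
move=> ab k0.
under eq_integral do rewrite EFinM.
rewrite ge0_integralZl//; last first.
  by apply/measurable_EFinP; exact: measurable_indic.
rewrite integral_indic//= setIT lebesgue_measure_itv/= lte_fin.
case: ltP => ab'; first by rewrite -EFinB -EFinM.
have -> : a = b by apply/eqP; rewrite eq_le ab ab'.
by rewrite subrr mulr0 mule0.
Qed.

Lemma tent_gap_le4 y : (tent_gap y <= 4%:E)%E.
Proof.
apply: (@le_trans _ _ (\int[mu]_x ((1 * \1_`[-1, 1] x)%:E +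
   (1 * \1_`[y - 1, y + 1] x)%:E))%E); last first.
  rewrite ge0_integralD//; last 2 first.
  - by apply/measurable_EFinP; apply: measurable_funM => //; exact: measurable_indic.
  - by apply/measurable_EFinP; apply: measurable_funM => //; exact: measurable_indic.
  rewrite !integral_itv_cst//; [|lra..].
  by rewrite -EFinD lee_fin; lra.
apply: ge0_le_integral => //.
- by move=> x _; rewrite lee_fin sqr_ge0.
- exact: measurable_tent_diff.
- by apply/measurable_EFinP; apply: measurable_funD; apply: measurable_funM => //;
    exact: measurable_indic.
move=> x _; rewrite -EFinD lee_fin !mul1r.
have key u a : tent u ^+ 2 <= (\1_`[a - 1, a + 1] (u + a) : R).
  have := tent_ge0 u; have := tent_le1 u; rewrite indicE.
  case: (boolP (u + a \in _)) => [_ /= h1 h0|].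
    by rewrite expr2; nra.
  rewrite notin_setE/= in_itv/= => /negP; rewrite negb_and -!ltNge => hu _ _.
  rewrite tent_out ?expr0n//.
  by case/orP: hu => hu; rewrite ler_normr; apply/orP; [right|left]; lra.
have k1 := key x 0; have k2 := key (x - y) y.
rewrite addr0 sub0r add0r in k1; rewrite subrK in k2.
have := tent_ge0 x; have := tent_ge0 (x - y); rewrite !expr2 in k1 k2 *; nra.
Qed.

Lemma tent_gap_le y : `|y| <= 1 -> (tent_gap y <= (4 * y ^+ 2)%:E)%E.
Proof.
move=> y1.
apply: (@le_trans _ _ (\int[mu]_x ((y ^+ 2 * \1_`[-2, 2] x)%:E))%E); last first.
  by rewrite integral_itv_cst ?sqr_ge0//; [rewrite lee_fin; lra|lra].
apply: ge0_le_integral => //.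
- by move=> x _; rewrite lee_fin sqr_ge0.
- exact: measurable_tent_diff.
- by apply/measurable_EFinP; apply: measurable_funM => //; exact: measurable_indic.
move=> x _; rewrite lee_fin indicE.
case: (boolP (x \in _)) => [_ /=|].
  rewrite mulr1 -(real_normK (num_real (_ - _))) -(real_normK (num_real y)).
  rewrite ler_pXn2r ?nnegrE//.
  by apply: (le_trans (tent_lipschitz _ _)); rewrite opprB addrC subrK.
rewrite notin_setE/= in_itv/= => /negP; rewrite negb_and -!ltNge => hx.
rewrite mulr0; move: y1; rewrite ler_norml => /andP[y1 y2].
rewrite !tent_out ?subrr ?expr0n//.
  by case/orP: hx => hx; rewrite ler_normr; apply/orP; [right|left]; lra.
by case/orP: hx => hx; rewrite ler_normr; apply/orP; [right|left]; lra.
Qed.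

Lemma integrable_expR_normN (c : R) : 0 < c ->
  (\int[mu]_x (expR (- c * `|x|))%:E < +oo)%E.
Proof.
move=> c0.
pose f x := (c^-1 * exponential_pdf c x)%:E.
have mf : measurable_fun setT f.
  apply/measurable_EFinP; apply: measurable_funM => //.
  exact: measurable_exponential_pdf.
have f0 x : (0 <= f x)%E.
  by rewrite lee_fin mulr_ge0 ?invr_ge0 ?exponential_pdf_ge0// ltW.
have intf : (\int[mu]_x f x = (c^-1)%:E)%E.
  under eq_integral do rewrite /f EFinM.
  rewrite ge0_integralZl//; last 3 first.
  - by apply/measurable_EFinP; exact: measurable_exponential_pdf.
  - by move=> x _; rewrite lee_fin exponential_pdf_ge0// ltW.
  - by rewrite lee_fin invr_ge0 ltW.
  by rewrite integral_exponential_pdf// mule1.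
apply: (@le_lt_trans _ _ (\int[mu]_x (f x + f (- x)%R))%E).
  apply: ge0_le_integral => //.
  - apply/measurable_EFinP; apply: measurableT_comp => //.
    by apply: measurable_funM => //; exact: measurable_normr.
  - apply: emeasurable_funD => //.
    by apply: measurableT_comp => //; exact: oppr_measurable.
  move=> x _.
  have key y : 0 <= y -> ((expR (- c * y))%:E <= f y)%E.
    move=> y0; rewrite /f lee_fin exponential_pdfE//.
    by rewrite mulrA mulVf ?mul1r// gt_eqF.
  have [x0|x0] := leP 0 x.
    rewrite ger0_norm//; apply: (le_trans (key _ x0)).
    by rewrite leeDl.
  rewrite ltr0_norm//.
  have x1 : 0 <= - x by rewrite oppr_ge0 ltW.
  by apply: (le_trans (key _ x1)); rewrite leeDr.
rewrite ge0_integralD//; last first.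
  by apply: measurableT_comp => //; exact: oppr_measurable.
by rewrite ge0_integral_oppr// intf -EFinD ltry.
Qed.

End tent.

(** * A kernel for the fractional covariance, and strong local nondeterminism *)

Section fractional_kernel.
Context {R : realType} (alpha : R).
Hypothesis alpha01 : 0 < alpha < 1.
Local Notation mu := (@lebesgue_measure R).
Local Notation mu2 := (mu \x mu)%E.
Implicit Types (t u v x y : R).

(** The first coordinate is the logarithm of the inverse of the scale, the
    second one the position. *)
Definition wavelet (t : R) (z : R * R) : R := tent (expR z.1 * (z.2 - t)).

(** The weight is the one for which the total mass of the gap scales like the
    power [2 * alpha] of the distance. *)
Definition wavelet_gap (t u : R) (z : R * R) : R :=
  expR ((1 - 2 * alpha) * z.1) * (wavelet t z - wavelet u z) ^+ 2.

Definition wavelet_energy : \bar R :=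
  \int[mu]_v ((expR (- (2 * alpha) * v))%:E * tent_gap (expR v))%E.

Lemma measurable_wavelet t : measurable_fun setT (wavelet t).
Proof.
apply: measurableT_comp; first exact: measurable_tent.
apply: measurable_funM; first exact: measurableT_comp.
exact: measurable_funB.
Qed.

Lemma measurable_wavelet_section v t :
  measurable_fun setT (fun x : R => wavelet t (v, x)).
Proof.
have -> : (fun x => wavelet t (v, x)) =
    tent \o (fun x => expR v * x + (- expR v * t)).
  by apply/funext => x; rewrite /wavelet /=; congr tent; ring.
by apply: measurableT_comp; [exact: measurable_tent|exact: measurable_affine].
Qed.

Lemma measurable_wavelet_gap t u : measurable_fun setT (wavelet_gap t u).
Proof.
apply: measurable_funM.
  by apply: measurableT_comp => //; exact: measurable_funM.
by apply: measurable_funX; apply: measurable_funB; exact: measurable_wavelet.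
Qed.

Lemma measurable_tent_gap_expR : measurable_fun setT (fun v : R => tent_gap (expR v)).
Proof.
apply: (@measurable_fun_fubini_tonelli_F _ _ _ _ R mu
  (fun z : R * R => ((tent z.2 - tent (z.2 - expR z.1)) ^+ 2)%:E)) => //=; last first.
  by move=> z; rewrite lee_fin sqr_ge0.
apply/measurable_EFinP; apply: measurable_funX; apply: measurable_funB.
  by apply: measurableT_comp; first exact: measurable_tent.
apply: measurableT_comp; first exact: measurable_tent.
by apply: measurable_funB => //; exact: measurableT_comp.
Qed.

Lemma inner_wavelet_gap t u v :
  (\int[mu]_x (wavelet_gap t u (v, x))%:E =
   (expR (- (2 * alpha) * v))%:E * tent_gap (expR v * (u - t)))%E.
Proof.
pose f x := ((tent x - tent (x - expR v * (u - t))) ^+ 2)%:E.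
under eq_integral do rewrite /wavelet_gap /= EFinM.
rewrite ge0_integralZl//; last 2 first.
- apply/measurable_EFinP; apply: measurable_funX; apply: measurable_funB;
    exact: measurable_wavelet_section.
- by move=> x _; rewrite lee_fin sqr_ge0.
rewrite [X in (_ * X)%E](_ : _ = \int[mu]_x f (expR v * x + (- expR v * t))%R)%E; last first.
  apply: eq_integral => x _; rewrite /f /wavelet /=; congr EFin.
  by congr ((tent _ - tent _) ^+ 2); ring.
rewrite ge0_integral_affine ?expR_gt0//; last 2 first.
- exact: measurable_tent_diff.
- by move=> x; rewrite lee_fin sqr_ge0.
rewrite muleA -EFinM /tent_gap -expRN -expRD /=.
by congr (((expR _)%:E) * _)%E; ring.
Qed.

(** Scale invariance: multiplying the distance by a factor amounts to
    translating the logarithm of the scale, and this multiplies the weight. *)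
Lemma integral_wavelet_gap t u :
  (\int[mu2]_z (wavelet_gap t u z)%:E =
   (`|t - u| `^ (2 * alpha))%:E * wavelet_energy)%E.
Proof.
have [a0 a1] := andP alpha01.
rewrite fubini_tonelli1//=; last 2 first.
- by apply/measurable_EFinP; exact: measurable_wavelet_gap.
- by move=> z; rewrite lee_fin mulr_ge0 ?expR_ge0 ?sqr_ge0.
rewrite /fubini_F.
under eq_integral do rewrite inner_wavelet_gap.
have [->|tu] := eqVneq t u.
  rewrite subrr normr0 powR0 ?mul0e; last by apply: lt0r_neq0; lra.
  apply: integral0_eq => v _.
  rewrite mulr0 /tent_gap; under eq_integral do rewrite subr0 subrr expr0n.
  by rewrite integral0 mule0.
have d0 : 0 < `|t - u| by rewrite normr_gt0 subr_eq0.
pose w := ln `|t - u|.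
have ew : expR w = `|t - u| by rewrite /w lnK.
pose g v := ((expR (- (2 * alpha) * v))%:E * tent_gap (expR v))%E.
have mg : measurable_fun setT g.
  apply: emeasurable_funM; last exact: measurable_tent_gap_expR.
  by apply/measurable_EFinP; apply: measurableT_comp.
have g0 v : (0 <= g v)%E by rewrite mule_ge0 ?tent_gap_ge0// lee_fin expR_ge0.
transitivity (\int[mu]_v ((expR (2 * alpha * w))%:E * g (1 * v + w)%R))%E.
  apply: eq_integral => v _; rewrite /g muleA -EFinM -expRD; congr (_ * _)%E.
    by congr ((expR _)%:E); ring.
  rewrite mul1r expRD ew.
  have [h|h] := leP 0 (u - t).
    by rewrite distrC ger0_norm.
  rewrite gtr0_norm; last by rewrite -opprB oppr_gt0.
  by rewrite -tent_gapN -mulrN opprB.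
have mgw : measurable_fun setT (fun v => g (1 * v + w)).
  exact: (measurableT_comp mg (measurable_affine 1 w)).
have e0 : (0 <= (expR (2 * alpha * w))%:E)%E by rewrite lee_fin expR_ge0.
transitivity ((expR (2 * alpha * w))%:E * \int[mu]_v g (1 * v + w)%R)%E.
  exact: (ge0_integralZl mu measurableT mgw (fun v _ => g0 _) e0).
rewrite ge0_integral_affine// invr1 mul1e; congr (_ * _)%E.
by rewrite /powR gt_eqF.
Qed.

(** [tent_gap (expR v)] is bounded, which suffices for positive [v] because
    [0 < alpha]; it is at most [4 * expR (2 * v)] for negative [v], which
    suffices because [alpha < 1]. *)
Lemma wavelet_energy_lty : (wavelet_energy < +oo)%E.
Proof.
have [a0 a1] := andP alpha01.
pose c := 2 * Num.min alpha (1 - alpha).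
have c0 : 0 < c by rewrite mulr_gt0// lt_min a0 subr_gt0.
apply: (@le_lt_trans _ _ (\int[mu]_v ((4%:E * (expR (- c * `|v|))%:E))))%E; last first.
  rewrite ge0_integralZl//; last first.
    apply/measurable_EFinP; apply: measurableT_comp => //.
    by apply: measurable_funM => //; exact: measurable_normr.
  by rewrite lte_mul_pinfty// integrable_expR_normN.
apply: ge0_le_integral => //.
- by move=> v _; rewrite mule_ge0 ?tent_gap_ge0// lee_fin expR_ge0.
- apply: emeasurable_funM; last exact: measurable_tent_gap_expR.
  by apply/measurable_EFinP; apply: measurableT_comp.
- apply: emeasurable_funM => //.
  by apply/measurable_EFinP; apply: measurableT_comp => //; apply: measurable_funM.
move=> v _.
have c1 : c <= 2 * alpha by rewrite ler_pM2l// ge_min lexx.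
have c2 : c <= 2 - 2 * alpha.
  have : Num.min alpha (1 - alpha) <= 1 - alpha by rewrite ge_min lexx orbT.
  by rewrite /c; lra.
have [v0|v0] := leP 0 v.
  rewrite muleC; apply: lee_pmul; rewrite ?tent_gap_ge0 ?tent_gap_le4 ?lee_fin ?expR_ge0//.
  by rewrite ler_expR ger0_norm//; nra.
apply: (@le_trans _ _ ((expR (- (2 * alpha) * v))%:E * (4 * expR v ^+ 2)%:E))%E.
  rewrite lee_wpmul2l// ?lee_fin ?expR_ge0//; apply: tent_gap_le.
  by rewrite ger0_norm ?expR_ge0// -[leRHS]expR0 ler_expR ltW.
rewrite -!EFinM lee_fin mulrCA -expRM_natl -expRD ler_pM2l// ler_expR ltr0_norm//; nra.
Qed.

Lemma integrable_wavelet_gap t u :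
  mu2.-integrable setT (EFin \o wavelet_gap t u).
Proof.
apply/integrableP; split.
  by apply/measurable_EFinP; exact: measurable_wavelet_gap.
rewrite [ltLHS](_ : _ = \int[mu2]_z (wavelet_gap t u z)%:E)%E.
  by rewrite integral_wavelet_gap lte_mul_pinfty ?lee_fin ?powR_ge0// wavelet_energy_lty.
apply: eq_integral => z _ /=; rewrite ger0_norm//.
by rewrite mulr_ge0 ?expR_ge0 ?sqr_ge0.
Qed.

Lemma wavelet_energy_ge0 : (0 <= wavelet_energy)%E.
Proof.
by apply: integral_ge0 => v _; rewrite mule_ge0 ?tent_gap_ge0// lee_fin expR_ge0.
Qed.

(** In the expansion of the squared differences the pure squares cancel,
    because each is multiplied by the sum of the coefficients. *)
Lemma sqr_sum_zero_sum (I : finType) (c a : I -> R) : \sum_i c i = 0 ->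
  (\sum_i c i * a i) ^+ 2 =
  - 2^-1 * \sum_i \sum_j c i * c j * (a i - a j) ^+ 2.
Proof.
move=> c0.
have e i j : c i * c j * (a i - a j) ^+ 2 =
    c i * a i ^+ 2 * c j + c i * (c j * a j ^+ 2) - 2 * ((c i * a i) * (c j * a j)).
  by ring.
under [in RHS]eq_bigr do under eq_bigr do rewrite e.
under [in RHS]eq_bigr do rewrite sumrB big_split/= -!mulr_sumr c0 mulr0 add0r.
rewrite sumrB -mulr_suml c0 mul0r sub0r -mulr_sumr -mulr_suml expr2.
by field.
Qed.

Lemma integral_sqr_wavelet_sum (I : finType) (c t : I -> R) : \sum_i c i = 0 ->
  (\int[mu2]_z (expR ((1 - 2 * alpha) * z.1) *
      (\sum_i c i * wavelet (t i) z) ^+ 2)%:E =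
   (- 2^-1 * \sum_i \sum_j c i * c j * `|t i - t j| `^ (2 * alpha))%:E *
   wavelet_energy)%E.
Proof.
move=> c0.
have fW : wavelet_energy \is a fin_num.
  by rewrite ge0_fin_numE ?wavelet_energy_ge0 ?wavelet_energy_lty.
transitivity (\int[mu2]_z (\sum_i \sum_j
   (- 2^-1 * (c i * c j))%:E * (wavelet_gap (t i) (t j) z)%:E))%E.
  apply: eq_integral => z _; rewrite sqr_sum_zero_sum//.
  rewrite mulrCA mulr_sumr mulr_sumr -sumEFin; apply: eq_bigr => i _.
  rewrite !mulr_sumr -sumEFin; apply: eq_bigr => j _.
  by rewrite -EFinM /wavelet_gap; congr EFin; ring.
have iI i j : mu2.-integrable setT (fun z =>
   (- 2^-1 * (c i * c j))%:E * (wavelet_gap (t i) (t j) z)%:E)%E.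
  by apply: integrableZl => //; exact: integrable_wavelet_gap.
rewrite integral_sum//=; last by move=> i; exact: integrable_sum.
rewrite -(fineK fW) -EFinM -mulrA mulr_suml mulr_sumr -sumEFin.
apply: eq_bigr => i _.
rewrite integral_sum//= mulr_suml mulr_sumr -sumEFin.
apply: eq_bigr => j _.
rewrite integralZl//; last exact: integrable_wavelet_gap.
rewrite integral_wavelet_gap -(fineK fW) -!EFinM; congr EFin; ring.
Qed.

(** Where all the other tents vanish, the energy of the combination is that of
    the isolated tent; on a rectangle of sides [1] and [r / 8] this tent
    is at least 1/2. *)
Lemma isolated_wavelet_energy (I : finType) (c t : I -> R) (i0 : I) (r : R) :
  0 < r -> (forall j, j != i0 -> c j != 0 -> r <= `|t i0 - t j|) ->
  ((expR (- 2) / 64 * r `^ (2 * alpha) * c i0 ^+ 2)%:E <=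
   \int[mu2]_z (expR ((1 - 2 * alpha) * z.1) *
      (\sum_i c i * wavelet (t i) z) ^+ 2)%:E)%E.
Proof.
move=> r0 sep; have [a0 a1] := andP alpha01.
pose l := ln (2 / r).
have el : expR l = 2 / r by rewrite lnK// posrE divr_gt0.
pose Q : set (R * R) := `[l, l + 1] `*` `[t i0 - r / 16, t i0 + r / 16].
have mQ : measurable Q by exact: measurableX.
pose k := expR ((1 - 2 * alpha) * l - 2) * (c i0 ^+ 2 * 4^-1).
have k0 : 0 <= k by rewrite mulr_ge0 ?expR_ge0// mulr_ge0 ?sqr_ge0.
have intQ : (\int[mu2]_z (k * \1_Q z)%:E = (k * (r / 8))%:E)%E.
  under eq_integral do rewrite EFinM.
  rewrite (@ge0_integralZl _ _ _ mu2 _ measurableT (fun z => (\1_Q z)%:E))//.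
  - rewrite integral_indic//= setIT product_measure1E//.
    rewrite /= !lebesgue_measure_itv/= !lte_fin ltrDl ltr01.
    rewrite (_ : (t i0 - r / 16 < t i0 + r / 16) = true); last by apply/idP; lra.
    by rewrite -!EFinB -!EFinM; congr EFin; field.
  - by apply/measurable_EFinP; exact: measurable_indic.
apply: (@le_trans _ _ (k * (r / 8))%:E).
  rewrite lee_fin /k.
  have -> : expR ((1 - 2 * alpha) * l - 2) =
      expR (- 2) * (expR (- (2 * alpha) * ln 2) * (2 / r * r `^ (2 * alpha))).
    rewrite -el /powR gt_eqF// -!expRD /l ln_div ?posrE//; congr expR; ring.
  have h : 4^-1 <= expR (- (2 * alpha) * ln (2 : R)).
    have -> : (4^-1 : R) = expR (- 2 * ln 2).
      by rewrite mulNr expRN expRM_natl lnK ?posrE//; congr (_^-1); ring.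
    by rewrite ler_expR; have := @ln_ge0 R 2; rewrite ler1n => /(_ isT); nra.
  rewrite (_ : _ * (r / 8) = expR (- 2) / 64 * r `^ (2 * alpha) * c i0 ^+ 2 *
     (4 * expR (- (2 * alpha) * ln 2))); last by field; lra.
  apply: ler_peMr; last by lra.
  by rewrite mulr_ge0 ?sqr_ge0// mulr_ge0 ?powR_ge0// divr_ge0 ?expR_ge0.
rewrite -intQ; apply: ge0_le_integral => //.
- by move=> z _; rewrite lee_fin mulr_ge0.
- by apply/measurable_EFinP; apply: measurable_funM => //; exact: measurable_indic.
- apply/measurable_EFinP; apply: measurable_funM.
    by apply: measurableT_comp => //; exact: measurable_funM.
  apply: measurable_funX; apply: measurable_sum => i.
  by apply: measurable_funM => //; exact: measurable_wavelet.
move=> [v x] _ /=; rewrite lee_fin indicE.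
case: (boolP (_ \in _)) => [|_]; last first.
  by rewrite mulr0 mulr_ge0 ?expR_ge0 ?sqr_ge0.
rewrite inE /Q => -[/= + +]; rewrite !in_itv/= => /andP[v1 v2] /andP[x1 x2].
have v3 : 2 / r <= expR v by rewrite -el ler_expR.
have v4 : expR v <= 8 / r.
  apply: (@le_trans _ _ (expR (l + 1))); first by rewrite ler_expR.
  rewrite expRD el (_ : 8 / r = 2 / r * 4); last by field; lra.
  rewrite ler_pM2l ?divr_gt0//.
  have h : 2^-1 <= expR (- 2^-1 : R) by have := @expR_ge1Dx R (- 2^-1); lra.
  have -> : expR 1 = (expR (- 2^-1 : R) ^+ 2)^-1.
    by rewrite -expRM_natl -expRN; congr expR; field.
  rewrite -[leRHS]invrK lef_pV2 ?posrE ?exprn_gt0 ?expR_gt0//.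
  by rewrite expr2; nra.
have out j : j != i0 -> c j * wavelet (t j) (v, x) = 0.
  move=> ji; have [->|cj] := eqVneq (c j) 0; first by rewrite mul0r.
  rewrite /wavelet tent_out ?mulr0//= normrM ger0_norm ?expR_ge0//.
  have h : 15 / 16 * r <= `|x - t j|.
    have := sep _ ji cj; have := ler_distD x (t i0) (t j).
    have : `|t i0 - x| <= r / 16 by rewrite ler_norml; lra.
    lra.
  apply: (@le_trans _ _ (2 / r * (15 / 16 * r))).
    rewrite (_ : 2 / r * (15 / 16 * r) = 15 / 8); last by field; lra.
    lra.
  have r1 : 0 <= r by exact: ltW.
  by apply: ler_pM => //; rewrite ?divr_ge0//; lra.
rewrite (bigD1 i0)//= big1 ?addr0; last by move=> j ji; exact: out.
rewrite mulr1 /k; apply: ler_pM; rewrite ?expR_ge0//.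
- by rewrite mulr_ge0 ?sqr_ge0.
- rewrite ler_expR; nra.
rewrite exprMn ler_wpM2l ?sqr_ge0//.
have : 2^-1 <= wavelet (t i0) (v, x).
  apply: tent_in => /=; rewrite normrM ger0_norm ?expR_ge0//.
  apply: (@le_trans _ _ (8 / r * (r / 16))).
    apply: ler_pM => //; rewrite ?expR_ge0// ler_norml; lra.
  by rewrite (_ : 8 / r * (r / 16) = 2^-1)//; field; lra.
by rewrite expr2; nra.
Qed.

(** For coefficients of zero sum, the right-hand side of the inequality is the
    variance of the sum of the [c i * B (t i)], with [B] a fractional Brownian
    motion. *)
Definition nondeterminism_constant (kappa : R) : Prop :=
  forall (I : finType) (c t : I -> R) (i0 : I) (r : R), 0 < r ->
  \sum_i c i = 0 ->
  (forall j, j != i0 -> c j != 0 -> r <= `|t i0 - t j|) ->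
  kappa * r `^ (2 * alpha) * c i0 ^+ 2 <=
  - 2^-1 * \sum_i \sum_j c i * c j * `|t i - t j| `^ (2 * alpha).

(** Both sides are compared with the energy of the combination of tents: it
    is at least that of the isolated tent, and it is the variance times
    [wavelet_energy].  Two opposite coefficients show that this constant is
    not zero. *)
Lemma strong_local_nondeterminism :
  exists2 kappa : R, 0 < kappa & nondeterminism_constant kappa.
Proof.
have fW : wavelet_energy \is a fin_num.
  by rewrite ge0_fin_numE ?wavelet_energy_ge0 ?wavelet_energy_lty.
pose W := fine wavelet_energy.
have eW : wavelet_energy = W%:E by rewrite fineK.
have key (I : finType) (c t : I -> R) (i0 : I) (r : R) : 0 < r ->
  \sum_i c i = 0 ->
  (forall j, j != i0 -> c j != 0 -> r <= `|t i0 - t j|) ->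
  expR (- 2) / 64 * r `^ (2 * alpha) * c i0 ^+ 2 <=
  (- 2^-1 * \sum_i \sum_j c i * c j * `|t i - t j| `^ (2 * alpha)) * W.
  move=> r0 c0 sep; rewrite -lee_fin [leRHS]EFinM -eW -integral_sqr_wavelet_sum//.
  exact: isolated_wavelet_energy.
have W0 : 0 < W.
  have W1 : 0 <= W by rewrite fine_ge0// wavelet_energy_ge0.
  rewrite lt0r W1 andbT; apply/eqP => W2.
  have := key bool (fun b => if b then 1 else - 1) (fun b => if b then 1 else 0) true 1 ltr01.
  rewrite big_bool /= subrr => /(_ erefl) h.
  have := h _; rewrite W2 mulr0 powR1 expr1n !mulr1 => {}h.
  have : (0 : R) < expR (- 2) / 64 by rewrite divr_gt0 ?expR_gt0.
  by rewrite ltNge h//; case=> //= _ _; rewrite subr0 normr1.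
exists (expR (- 2) / 64 / W); first by rewrite divr_gt0// divr_gt0 ?expR_gt0.
move=> I c t i0 r r0 c0 sep; have := key _ _ _ _ _ r0 c0 sep.
by rewrite -ler_pdivrMr// => h; apply: le_trans h; rewrite !mulrA -!(mulrAC _ W^-1).
Qed.

End fractional_kernel.

(** * Gaussian integrals *)

Section gauss_density.
Context {R : realType}.
Local Notation mu := (@lebesgue_measure R).
Implicit Types (m s x y z h : R) (A : set R).

Lemma integral_normal_prob (m s : R) (f : R -> \bar R) :
  (normal_prob m s).-integrable setT f ->
  (\int[normal_prob m s]_x f x = \int[mu]_x (f x * (normal_pdf m s x)%:E))%E.
Proof.
move=> intf; have mf := measurable_int _ intf.
have dom := normal_prob_dominates m s.
rewrite -(Radon_Nikodym_change_of_variables dom)//=.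
apply: ae_eq_integral => //.
- apply: emeasurable_funM => //; apply: (measurable_int mu).
- apply: emeasurable_funM => //=; apply/measurableT_comp => //=.
  exact: measurable_normal_pdf.
- apply: ae_eqe_mul2l => /=; rewrite Radon_NikodymE//=.
  case: cid => /= h [h1 h2 h3].
  apply: integral_ae_eq => //=.
    by apply/measurableT_comp => //; exact: measurable_normal_pdf.
  by move=> E E01 mE; rewrite -h3.
Qed.

(** The change of density applies to the truncations of [f], which are bounded;
    monotone convergence then yields the integrability of [f] itself. *)
Lemma integrable_normal_prob (m s : R) (f : R -> R) : measurable_fun setT f ->
  mu.-integrable setT (fun x => (f x * normal_pdf m s x)%:E) ->
  (normal_prob m s).-integrable setT (EFin \o f).
Proof.
move=> mf intf; apply/integrableP; split; first exact/measurable_EFinP.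
pose g n x : R := Num.min `|f x| n%:R.
have mg n : measurable_fun setT (g n).
  by apply: measurable_minr => //; exact: measurableT_comp.
have gi n : (normal_prob m s).-integrable setT (EFin \o g n).
  apply: (@le_integrable _ _ _ _ _ measurableT _ (cst n%:R%:E)).
  - by apply/measurable_EFinP; exact: mg.
  - move=> x _ /=; rewrite lee_fin ger0_norm; last by rewrite le_min normr_ge0 ler0n.
    by rewrite ger0_norm ?ge_min ?lexx ?orbT.
  - apply/integrableP; split; first exact: measurable_cst.
    rewrite /= integral_cst//= [X in (_ * X)%E](@probability_setT _ _ _ (normal_prob m s)).
    by rewrite mule1 ltry.
have -> : (\int[normal_prob m s]_x `|(EFin \o f) x| =
    limn (fun n => \int[normal_prob m s]_x (g n x)%:E))%E.
  rewrite -monotone_convergence//.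
  - apply: eq_integral => x _ /=; apply/esym/cvg_lim => //.
    apply: cvg_near_cst; near=> n; rewrite /g; congr EFin; apply/min_idPl.
    by near: n; exact: nbhs_infty_ger.
  - by move=> n; apply/measurable_EFinP; exact: mg.
  - by move=> n x _; rewrite lee_fin le_min normr_ge0 ler0n.
  - move=> x _ n k nk; rewrite lee_fin le_min ge_min lexx/= ge_min.
    by rewrite ler_nat nk orbT.
apply: (@le_lt_trans _ _ (\int[mu]_x `|(f x * normal_pdf m s x)%:E|)%E); last first.
  by have /integrableP[] := intf.
apply: lime_le.
  apply: ereal_nondecreasing_is_cvgn => n k nk; apply: ge0_le_integral => //.
  - by move=> x _; rewrite lee_fin le_min normr_ge0 ler0n.
  - by apply/measurable_EFinP; exact: mg.
  - by apply/measurable_EFinP; exact: mg.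
  - move=> x _; rewrite lee_fin le_min ge_min lexx/= ge_min.
    by rewrite ler_nat nk orbT.
near=> n; rewrite (integral_normal_prob (gi n)); apply: ge0_le_integral => //.
- by move=> x _; rewrite mule_ge0 ?lee_fin ?normal_pdf_ge0// le_min normr_ge0 ler0n.
- apply: emeasurable_funM; first by apply/measurable_EFinP; exact: mg.
  by apply/measurable_EFinP; exact: measurable_normal_pdf.
- by apply: measurableT_comp => //; exact: measurable_int intf.
move=> x _; rewrite /= -EFinM lee_fin normrM (ger0_norm (normal_pdf_ge0 _ _ _)).
by rewrite ler_wpM2r ?normal_pdf_ge0// ge_min lexx.
Unshelve. all: by end_near. Qed.

Lemma integrable_affine (a b : R) (f : R -> R) : 0 < a ->
  mu.-integrable setT (EFin \o f) ->
  mu.-integrable setT (fun x => (f (a * x + b))%:E).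
Proof.
move=> a0 /integrableP[mf ff]; apply/integrableP; split.
  by apply: (measurableT_comp mf); exact: measurable_affine.
have := @ge0_integral_affine R a b (fun x => `|(f x)%:E|%E) a0 (measurableT_comp _ mf).
move=> -> //.
by rewrite lte_mul_pinfty// lee_fin invr_ge0 ltW.
Qed.

Lemma integral_affine (a b : R) (f : R -> R) : 0 < a ->
  mu.-integrable setT (EFin \o f) ->
  (\int[mu]_x (f (a * x + b)%R)%:E = a^-1%:E * \int[mu]_x (f x)%:E)%E.
Proof.
move=> a0 intf; have [mf ff] := integrableP _ _ _ intf.
rewrite integralE [in RHS]integralE muleBr//; last first.
  exact: integrable_add_def.
have [mp mn] := (measurable_funepos mf, measurable_funeneg mf).
have phi_comp (g : R -> \bar R) :
    (fun x => g (a * x + b)) = g \o (fun x => a * x + b) by [].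
rewrite (phi_comp (EFin \o f)) funepos_comp funeneg_comp.
congr (_ - _)%E.
  by rewrite -(ge0_integral_affine b a0 mp)// => x; exact: funepos_ge0.
by rewrite -(ge0_integral_affine b a0 mn)// => x; exact: funeneg_ge0.
Qed.

Definition gauss_pdf : R -> R := normal_pdf 0 1.

Lemma gauss_pdfE z : gauss_pdf z = normal_peak (1 : R) * expR (- (z ^+ 2) / 2).
Proof.
rewrite /gauss_pdf normal_pdfE ?oner_eq0// /normal_fun subr0 expr1n.
by rewrite mulr2n.
Qed.

Lemma gauss_pdf_ge0 z : 0 <= gauss_pdf z.
Proof. exact: normal_pdf_ge0. Qed.

Lemma measurable_gauss_pdf : measurable_fun setT gauss_pdf.
Proof. exact: measurable_normal_pdf. Qed.

Lemma is_derive_gauss_pdf z : is_derive z 1 gauss_pdf (- z * gauss_pdf z).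
Proof.
have -> : gauss_pdf = normal_peak 1 \*: (expR \o (- 2^-1 \*: (@id R ^+ 2))).
  apply/funext => y; rewrite gauss_pdfE /=; congr (_ * expR _).
  by rewrite /GRing.scale /= !fctE; field.
have d2 : is_derive z 1 (- 2^-1 \*: (@id R ^+ 2)) (- z).
  by apply: trigger_derive; rewrite /GRing.scale /= expr1; field.
by apply: trigger_derive; rewrite /GRing.scale /= mulrA mulrC.
Qed.

(** A common integrable bound for the translates by less than 1 of a function of
    quadratic growth times the Gaussian density, as differentiation under the
    integral requires. *)
Definition gauss_majorant (C z : R) : R := C * expR (- (z ^+ 2) / 8).

Lemma integrable_gauss_majorant C :
  mu.-integrable setT (EFin \o gauss_majorant C).
Proof.
rewrite (_ : EFin \o _ = fun z => (C / normal_peak (2 : R))%:E * (normal_pdf 0 2 z)%:E)%E.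
  by apply: integrableZl => //; exact: integrable_normal_pdf.
apply/funext => z /=; rewrite -EFinM; congr EFin.
rewrite normal_pdfE ?pnatr_eq0// /gauss_majorant /normal_fun subr0.
rewrite mulrA divfK ?gt_eqF ?normal_peak_gt0//.
by congr (_ * expR (_ / _)); rewrite expr2 mulr2n; ring.
Qed.

Lemma gauss_pdf_growth C h z u : `|h| < 1 -> 0 <= C ->
  `|u| <= C * (1 + `|z + h| + `|z + h| ^+ 2) ->
  `|u * gauss_pdf (z + h)| <= gauss_majorant (C * 6 * 2 * normal_peak 1) z.
Proof.
move=> h1 C0 uC; rewrite normrM (ger0_norm (gauss_pdf_ge0 _)) gauss_pdfE.
rewrite /gauss_majorant.
have p0 := normal_peak_ge0 (1 : R).
set w := z + h in uC *.
apply: (@le_trans _ _ (C * (6 * expR (w ^+ 2 / 4)) * (normal_peak 1 * expR (- w ^+ 2 / 2)))).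
  apply: ler_wpM2r; first by rewrite mulr_ge0 ?expR_ge0.
  apply: (le_trans uC); apply: ler_wpM2l => //.
  have := expR_ge1Dx (w ^+ 2 / 4); rewrite -[w ^+ 2]real_normK ?num_real//.
  have := normr_ge0 w; rewrite expr2; nra.
rewrite [leLHS](_ : _ = C * 6 * normal_peak 1 * expR (- w ^+ 2 / 4)); last first.
  rewrite (_ : - w ^+ 2 / 2 = - w ^+ 2 / 4 - w ^+ 2 / 4); last by field.
  rewrite expRD mulNr expRN; field.
  by rewrite gt_eqF// expR_gt0.
rewrite -!mulrA ler_wpM2l// ler_wpM2l// [leRHS]mulrCA ler_wpM2l//.
apply: (@le_trans _ _ (expR (1 / 2 - z ^+ 2 / 8))).
  rewrite ler_expR; move: h1; rewrite /w ltr_norml => /andP[h1 h2].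
  have : h ^+ 2 <= 1 by rewrite expr2; nra.
  have := sqr_ge0 (z + h + h); rewrite !expr2; nra.
rewrite expRD mulNr ler_wpM2r ?expR_ge0//.
have h' : 2^-1 <= expR (- (1 / 2) : R) by have := @expR_ge1Dx R (- (1 / 2)); lra.
by rewrite -[expR _]invrK -expRN -[leRHS]invrK lef_pV2 ?posrE ?expR_gt0.
Qed.

Lemma derive1_is_derive (f : R -> R) x df : is_derive x 1 f df -> (f^`()%classic) x = df.
Proof. by move=> fx; rewrite derive1E derive_val. Qed.

Lemma integrable_gauss_growth (C : R) (f : R -> R) : 0 <= C ->
  measurable_fun setT f -> (forall z, `|f z| <= C * (1 + `|z| + `|z| ^+ 2)) ->
  mu.-integrable setT (fun z => (f z * gauss_pdf z)%:E).
Proof.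
move=> C0 mf fC.
apply: (le_integrable measurableT _ _ (integrable_gauss_majorant _)).
  by apply/measurable_EFinP; apply: measurable_funM => //; exact: measurable_gauss_pdf.
move=> z _ /=; rewrite lee_fin.
have := @gauss_pdf_growth C 0 z (f z); rewrite normr0 ltr01 addr0.
move=> /(_ erefl C0 (fC z)) h; apply: (le_trans h); exact: ler_norm.
Qed.

(** Integration by parts against the Gaussian density, obtained by
    differentiating the translation invariance of Lebesgue measure. *)
Lemma gauss_stein (C : R) (g g' : R -> R) : 0 <= C ->
  (forall z : R, is_derive z (1 : R) g (g' z)) ->
  measurable_fun setT g -> measurable_fun setT g' ->
  (forall z, `|g z| <= C * (1 + `|z|)) -> (forall z, `|g' z| <= C) ->
  \int[mu]_z (g' z * gauss_pdf z) = \int[mu]_z (z * g z * gauss_pdf z).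
Proof.
move=> C0 dg mg mg' gC g'C.
pose F z := g z * gauss_pdf z.
pose dF z := (g' z - z * g z) * gauss_pdf z.
have FD z : is_derive z 1 F (dF z).
  have d1 := dg z; have d2 := is_derive_gauss_pdf z.
  rewrite (_ : F = g * gauss_pdf)//.
  by apply: trigger_derive; rewrite /GRing.scale /= /dF; ring.
have gC2 z : `|g z| <= C * (1 + `|z| + `|z| ^+ 2).
  by apply: (le_trans (gC z)); rewrite ler_wpM2l// lerDl sqr_ge0.
have iF : mu.-integrable setT (EFin \o F) by exact: integrable_gauss_growth gC2.
have zgC z : `|z * g z| <= C * (1 + `|z| + `|z| ^+ 2).
  rewrite normrM; have := gC z; have := normr_ge0 z; rewrite expr2; nra.
have g'C2 z : `|g' z| <= C * (1 + `|z| + `|z| ^+ 2).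
  apply: (le_trans (g'C z)); rewrite ler_peMr// -addrA lerDl.
  by rewrite addr_ge0 ?sqr_ge0.
have dFC z : `|g' z - z * g z| <= (2 * C) * (1 + `|z| + `|z| ^+ 2).
  by apply: (le_trans (ler_normB _ _)); have := zgC z; have := g'C2 z; lra.
have C2 : 0 <= 2 * C by rewrite mulr_ge0.
pose f h z := F (z + h).
have df h z : is_derive h 1 (f ^~ z) (dF (z + h)).
  have d1 := FD (z + h).
  have d2 : is_derive h 1 (fun h => z + h) 1.
    rewrite (_ : (fun h => z + h) = cst z + id)//.
    by apply: trigger_derive; rewrite add0r.
  rewrite (_ : f ^~ z = F \o (fun h => z + h))//.
  by apply: trigger_derive; rewrite /GRing.scale /= mulr1.
have I0 : `](-1)%R, 1%R[%classic (0 : R) by rewrite /= in_itv/= ltrN10 ltr01.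
have shift h : \int[mu]_z f h z = \int[mu]_z F z.
  rewrite /Rintegral; apply: (congr1 fine).
  have := integral_affine h ltr01 iF; rewrite invr1 mul1e => <-.
  by apply: eq_integral => z _; rewrite mul1r.
have := @differentiation_under_integral R _ _ mu f setT measurableT 0 (-1) 1 I0 _ _
   (gauss_majorant (2 * C * 6 * 2 * normal_peak 1)) _ _ _.
rewrite (_ : (fun x' => _) = cst (\int[mu]_z F z)); last first.
  by apply/funext => h; exact: shift.
rewrite derive1_cst => H.
have {}H : 0 = \int[mu]_z dF z.
  rewrite H.
  - apply: eq_Rintegral => z _; rewrite /partial1of2 (derive1_is_derive (df 0 z)).
    by rewrite addr0.
  - move=> h _; have := integrable_affine h ltr01 iF.
    by apply: eq_integrable => // z _; rewrite mul1r.
  - by move=> h z _ _; have [] := df h z.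
  - move=> z; rewrite mulr_ge0 ?expR_ge0// mulr_ge0 ?normal_peak_ge0//.
    by rewrite !mulr_ge0.
  - exact: integrable_gauss_majorant.
  - move=> h z; rewrite /= in_itv/= => hI _.
    rewrite /partial1of2 (derive1_is_derive (df h z)).
    apply: gauss_pdf_growth => //; by rewrite ltr_norml.
apply/eqP; rewrite -subr_eq0 -RintegralB//; last 2 first.
- exact: (integrable_gauss_growth C0).
- by apply: (integrable_gauss_growth C0) => //; exact: measurable_funM.
apply/eqP; rewrite [RHS]H; apply: eq_Rintegral => z _.
by rewrite /dF mulrBl.
Qed.

Lemma integrable_gauss_pdf : mu.-integrable setT (EFin \o gauss_pdf).
Proof. exact: integrable_normal_pdf. Qed.

Lemma Rintegral_gauss_pdf : \int[mu]_z gauss_pdf z = 1.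
Proof. by rewrite /Rintegral integral_normal_pdf. Qed.

Lemma gauss_mean : \int[mu]_z (z * gauss_pdf z) = 0.
Proof.
have := @gauss_stein 1 (cst 1) (cst 0) ler01 _ _ _ _ _.
under [X in _ = X]eq_Rintegral do rewrite /= mulr1.
move=> <-.
- under eq_Rintegral do rewrite /= mul0r.
  by rewrite /Rintegral integral0.
- by [].
- by [].
- by move=> z; rewrite /= normr1 mul1r lerDl.
- by move=> z; rewrite /= normr0 ler01.
Qed.

Lemma gauss_second_moment : \int[mu]_z (z ^+ 2 * gauss_pdf z) = 1.
Proof.
have := @gauss_stein 1 id (cst 1) ler01 _ _ _ _ _.
under [X in _ = X]eq_Rintegral do rewrite /= -expr2.
move=> <-.
- under eq_Rintegral do rewrite /= mul1r.
  exact: Rintegral_gauss_pdf.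
- by [].
- by [].
- by move=> z; rewrite /= mul1r lerDr.
- by move=> z; rewrite /= normr1.
Qed.

Lemma is_derive_affine (a u z : R) : is_derive z (1 : R) (fun z => a + u * z) u.
Proof.
have -> : (fun z => a + u * z) = cst a + u \*: id by [].
by apply: trigger_derive; rewrite add0r /GRing.scale /= mulr1.
Qed.

Lemma measurable_cos : measurable_fun setT (@cos R).
Proof. by apply: continuous_measurable_fun; exact: continuous_cos. Qed.

Lemma measurable_sin : measurable_fun setT (@sin R).
Proof. by apply: continuous_measurable_fun; exact: continuous_sin. Qed.

(** The Gaussian density is its own Fourier transform: by integration by
    parts the cosine transform [f] solves [f' y = - y * f y]. *)
Lemma gauss_cos (a y : R) :
  \int[mu]_z (cos (a + y * z) * gauss_pdf z) = cos a * expR (- (y ^+ 2) / 2).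
Proof.
pose f y z := cos (a + y * z) * gauss_pdf z.
pose F y := \int[mu]_z f y z.
have mlin u : measurable_fun setT (fun z : R => a + u * z).
  by apply: measurable_funD => //; exact: measurable_funM.
have iF u : mu.-integrable setT (EFin \o f u).
  apply: (@integrable_gauss_growth 1) => //.
    by apply: measurableT_comp => //; exact: measurable_cos.
  move=> z; rewrite mul1r; apply: (le_trans (cos_max _)).
  by rewrite -addrA lerDl addr_ge0 ?sqr_ge0.
have df (u z : R) : is_derive u 1 (f ^~ z) (- z * sin (a + u * z) * gauss_pdf z).
  have d1 : is_derive u 1 (fun u => a + u * z) z.
    have -> : (fun u => a + u * z) = (fun u => a + z * u).
      by apply/funext => w; rewrite mulrC.
    exact: is_derive_affine.
  rewrite (_ : f ^~ z = gauss_pdf z \*: (cos \o (fun u => a + u * z))).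
    apply: trigger_derive; rewrite /GRing.scale /=.
    by rewrite !mulNr mulrN mulrC [z * _]mulrC.
  by apply/funext => w; exact: mulrC.
have bound (u z : R) : `|(- z * sin (a + u * z)) * gauss_pdf z| <=
     gauss_majorant (1 * 6 * 2 * normal_peak 1) z.
  have := @gauss_pdf_growth 1 0 z (- z * sin (a + u * z)).
  rewrite normr0 addr0; apply => //.
  rewrite mul1r normrM normrN.
  have := sin_max (a + u * z); have := normr_ge0 z; have := sqr_ge0 `|z|.
  have := normr_ge0 (sin (a + u * z)).
  nra.
have maj0 z : 0 <= gauss_majorant (1 * 6 * 2 * normal_peak (1 : R)) z.
  by rewrite mulr_ge0 ?expR_ge0// mulr_ge0 ?normal_peak_ge0// !mulr_ge0.
have dF (u : R) : is_derive u 1 F (- u * F u).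
  have Iu : `](u - 1)%R, (u + 1)%R[%classic u.
    by rewrite /= in_itv/=; apply/andP; split; lra.
  have dfu (w z : R) : derivable (f ^~ z) w 1 by have [] := df w z.
  have bd w z : `|partial1of2 f w z| <= gauss_majorant (1 * 6 * 2 * normal_peak (1 : R)) z.
    by rewrite /partial1of2 (derive1_is_derive (df w z)).
  have H1 := @derivable_under_integral R _ _ mu f setT measurableT u _ _ Iu
    (fun w _ => iF w) (fun w z _ _ => dfu w z) _ maj0
    (integrable_gauss_majorant _) (fun w z _ _ => bd w z).
  have H2 := @differentiation_under_integral R _ _ mu f setT measurableT u _ _ Iu
    (fun w _ => iF w) (fun w z _ _ => dfu w z) _ maj0
    (integrable_gauss_majorant _) (fun w z _ _ => bd w z).
  split => //; rewrite -derive1E H2.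
  transitivity (\int[mu]_z (- 1 * (z * sin (a + u * z) * gauss_pdf z))).
    apply: eq_Rintegral => z _; rewrite /partial1of2 (derive1_is_derive (df u z)).
    by ring.
  have C0 : 0 <= 1 + `|u| by rewrite addr_ge0.
  rewrite RintegralZl//; last first.
    apply: (@integrable_gauss_growth 1) => //.
      apply: measurable_funM => //; apply: measurableT_comp => //.
      exact: measurable_sin.
    move=> z; rewrite mul1r normrM.
    have := sin_max (a + u * z); have := normr_ge0 z; have := sqr_ge0 `|z|.
    have := normr_ge0 (sin (a + u * z)); nra.
  have dS (z : R) : is_derive z 1 (fun z => sin (a + u * z)) (u * cos (a + u * z)).
    have d1 := is_derive_affine a u z.
    have -> : (fun z => sin (a + u * z)) = sin \o (fun z => a + u * z) by [].
    by apply: trigger_derive; rewrite /GRing.scale /= mulrC.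
  have ST : \int[mu]_z (u * cos (a + u * z) * gauss_pdf z) =
            \int[mu]_z (z * sin (a + u * z) * gauss_pdf z).
    apply: (gauss_stein C0 dS).
    - by apply: measurableT_comp => //; exact: measurable_sin.
    - by apply: measurable_funM => //; apply: measurableT_comp => //; exact: measurable_cos.
    - move=> z; apply: (le_trans (sin_max _)).
      by have := normr_ge0 u; have := normr_ge0 z; nra.
    - move=> z; rewrite normrM; have := cos_max (a + u * z); have := normr_ge0 u.
      by have := normr_ge0 (cos (a + u * z)); nra.
  rewrite -ST mulN1r mulNr; congr (- _); rewrite /F -RintegralZl//.
  by apply: eq_Rintegral => z _; rewrite /f mulrA.
pose G := F * (expR \o (2^-1 \*: (@id R ^+ 2))).
have dG (u : R) : is_derive u 1 G 0.
  have d1 := dF u.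
  have d2 : is_derive u 1 (2^-1 \*: (@id R ^+ 2)) u.
    by apply: trigger_derive; rewrite /GRing.scale /= expr1; field.
  by apply: trigger_derive; rewrite /GRing.scale /=; ring.
have GE u : G u = F u * expR (u ^+ 2 / 2).
  by rewrite [u ^+ 2 / 2]mulrC.
have : G y = G 0 by apply: is_derive_0_is_cst.
rewrite !GE expr0n mul0r expR0 mulr1.
have -> : F 0 = cos a.
  transitivity (\int[mu]_z (cos a * gauss_pdf z)).
    by apply: eq_Rintegral => z _; rewrite /f mul0r addr0.
  rewrite RintegralZl//; last exact: integrable_gauss_pdf.
  by rewrite Rintegral_gauss_pdf mulr1.
move=> <-; rewrite -mulrA -expRD mulNr addrN expR0 mulr1.
by [].
Qed.

(** Completing the square gives a multiple of a translated and rescaled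
    Gaussian density. *)
Lemma gauss_expquad (a b c : R) : 0 < 1 + c ->
  (\int[mu]_z (expR (- (a + 2 * b * z + c * z ^+ 2) / 2) * gauss_pdf z)%:E =
   (expR (- (a - b ^+ 2 / (1 + c)) / 2) / Num.sqrt (1 + c))%:E)%E.
Proof.
move=> c0; set s := Num.sqrt (1 + c).
have s0 : 0 < s by rewrite sqrtr_gt0.
have s2 : s ^+ 2 = 1 + c by rewrite sqr_sqrtr// ltW.
pose K := expR (- (a - b ^+ 2 / (1 + c)) / 2).
transitivity (\int[mu]_z (K%:E * (gauss_pdf (s * z + b / s))%:E))%E.
  apply: eq_integral => z _; rewrite -EFinM; congr EFin.
  rewrite !gauss_pdfE /K [LHS]mulrCA [RHS]mulrCA -!expRD; congr (_ * expR _).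
  rewrite sqrrD exprMn s2 expr_div_n s2; field.
  by rewrite !gt_eqF.
rewrite ge0_integralZl//; last 3 first.
- apply/measurable_EFinP; apply: measurableT_comp; first exact: measurable_gauss_pdf.
  exact: measurable_affine.
- by move=> z _; rewrite lee_fin gauss_pdf_ge0.
- by rewrite lee_fin expR_ge0.
rewrite (ge0_integral_affine _ s0 (f := fun z => (gauss_pdf z)%:E)); last 2 first.
- by apply/measurable_EFinP; exact: measurable_gauss_pdf.
- by move=> z; rewrite lee_fin gauss_pdf_ge0.
by rewrite integral_normal_pdf mule1.
Qed.

Lemma integral_normal_standard (m s : R) (f : R -> R) : s != 0 ->
  measurable_fun setT f ->
  mu.-integrable setT (fun z => (f (`|s| * z + m) * gauss_pdf z)%:E) ->
  (normal_prob m s).-integrable setT (EFin \o f) /\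
  (\int[normal_prob m s]_x (f x)%:E =
   \int[mu]_z (f (`|s| * z + m)%R * gauss_pdf z)%:E)%E.
Proof.
move=> s0 mf intf.
have a0 : 0 < `|s| by rewrite normr_gt0.
have ia0 : 0 < `|s|^-1 by rewrite invr_gt0.
have e x : f x * normal_pdf m s x =
   `|s|^-1 * (f (`|s| * (`|s|^-1 * x + (- m / `|s|)) + m) *
   gauss_pdf (`|s|^-1 * x + (- m / `|s|))).
  have -> : `|s| * (`|s|^-1 * x + (- m / `|s|)) + m = x by field; rewrite gt_eqF.
  rewrite mulrCA; congr (_ * _).
  rewrite normal_pdfE// gauss_pdfE /normal_fun /normal_peak mulrA.
  congr (_ * expR _); last first.
    rewrite -[in LHS](real_normK (num_real s)); field; by rewrite gt_eqF.
  rewrite expr1n mul1r -[s ^+ 2 * pi *+ 2]mulrnAr sqrtrM ?sqr_ge0// sqrtr_sqr.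
  by rewrite invfM.
have ig := integrableZl measurableT (`|s|^-1) (integrable_affine (- m / `|s|) ia0 intf).
have intN : mu.-integrable setT (fun x => (f x * normal_pdf m s x)%:E).
  apply: eq_integrable ig => // x _.
  by rewrite e -EFinM.
have iN := integrable_normal_prob mf intN.
split; first exact: iN.
rewrite (integral_normal_prob iN).
transitivity (\int[mu]_x (`|s|^-1%:E * (f (`|s| * (`|s|^-1 * x + (- m / `|s|)) + m) *
   gauss_pdf (`|s|^-1 * x + (- m / `|s|)))%:E))%E.
  by apply: eq_integral => x _; rewrite -!EFinM e.
rewrite integralZl//; last exact: (integrable_affine (- m / `|s|) ia0 intf).
rewrite (integral_affine (- m / `|s|) ia0 intf) invrK muleA -EFinM.
by rewrite mulVf ?mul1e// gt_eqF.
Qed.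

End gauss_density.

(** * Joint densities of Gaussian families, through successive regressions *)

Section regression.
Context {R : realType} {V : lmodType R}.
Variable b : V -> V -> R.
Hypothesis bC : forall x y, b x y = b y x.
Hypothesis b_lin : forall z x y u, b (x + z *: y) u = b x u + z * b y u.
Hypothesis b_ge0 : forall x, 0 <= b x x.

(** The covariance that is left after observing the variables [xs], each one
    blurred by an independent standard normal error. *)
Fixpoint regress (xs : seq V) : V -> V -> R :=
  if xs is x :: xs' then
    let c := regress xs' in fun y u => c y u - c y x * c x u / (1 + c x x)
  else b.

(** The value at 0 of the joint density of the blurred variables [xs], up to
    a power of [2 * pi]. *)
Fixpoint density_at0 (xs : seq V) : R :=
  if xs is x :: xs' then density_at0 xs' / Num.sqrt (1 + regress xs' x x)
  else 1.

Lemma regressC xs x y : regress xs x y = regress xs y x.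
Proof.
elim: xs x y => [|v xs IH] x y //=.
by rewrite IH (IH x v) (IH v y) [_ v x * _]mulrC.
Qed.

Lemma regress_lin xs z x y u :
  regress xs (x + z *: y) u = regress xs x u + z * regress xs y u.
Proof.
elim: xs x y u => [|v xs IH] x y u //=.
by rewrite !IH !mulrDl; ring.
Qed.

Lemma regress_sqr xs x y z : regress xs (y + z *: x) (y + z *: x) =
  regress xs y y + 2 * regress xs y x * z + regress xs x x * z ^+ 2.
Proof.
rewrite regress_lin regressC regress_lin [regress xs x (_ + _)]regressC.
by rewrite regress_lin (regressC xs x y); ring.
Qed.

Lemma regress_cons_min x xs y : 0 <= regress xs x x ->
  let z := - regress xs y x / (1 + regress xs x x) in
  regress (x :: xs) y y = regress xs (y + z *: x) (y + z *: x) + z ^+ 2.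
Proof.
move=> r0 z; rewrite regress_sqr /z /= (regressC xs x y); field.
by rewrite gt_eqF// ltr_wpDr.
Qed.

(** Observing [xs] only subtracts multiples of the [xs] from a variable; a
    lower bound for the variance that holds on a set stable under these
    subtractions is inherited by the conditional variance. *)
Lemma regress_lb (S : V -> Prop) (xs : seq V) (m : R) : 0 <= m ->
  (forall y z x, S y -> x \in xs -> S (y + z *: x)) ->
  (forall y, S y -> m <= b y y) -> forall y, S y -> m <= regress xs y y.
Proof.
elim: xs S m => [|x xs IH] S m m0 Sxs Sm y Sy; first exact: Sm.
have rx : 0 <= regress xs x x by apply: (IH (fun _ => True)).
rewrite regress_cons_min//; set v := y + _ *: x.
apply: (@le_trans _ _ (regress xs v v)); last by rewrite lerDl sqr_ge0.
apply: (IH S) => //.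
  by move=> y' z x' Sy' x'xs; apply: Sxs; rewrite // inE x'xs orbT.
by apply: Sxs; rewrite // mem_head.
Qed.

Lemma regress_ge0 xs x : 0 <= regress xs x x.
Proof. exact: (@regress_lb (fun _ => True)). Qed.

Lemma density_at0_ge0 xs : 0 <= density_at0 xs.
Proof.
by elim: xs => [|x xs IH] /=; rewrite ?ler01// divr_ge0// sqrtr_ge0.
Qed.

End regression.

Section gaussian_family.
Context d (T : measurableType d) (R : realType) (P : probability T R).
Context (V : lmodType R) (xi : V -> T -> R) (b : V -> V -> R).
Local Notation mu := (@lebesgue_measure R).
Hypothesis bC : forall x y, b x y = b y x.
Hypothesis b_lin : forall z x y u, b (x + z *: y) u = b x u + z * b y u.
Hypothesis b_ge0 : forall x, 0 <= b x x.
Hypothesis xi_lin : forall z x y w, xi (x + z *: y) w = xi x w + z * xi y w.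
Hypothesis xi_meas : forall x, measurable_fun setT (xi x).
Hypothesis xi_cos : forall x,
  (\int[P]_w (cos (xi x w))%:E = (expR (- b x x / 2))%:E)%E.

Definition bump (xs : seq V) (w : T) : R := \prod_(x <- xs) expR (- xi x w ^+ 2 / 2).

Lemma bump_ge0 xs w : 0 <= bump xs w.
Proof. by apply: prodr_ge0 => x _; exact: expR_ge0. Qed.

Lemma bump_le1 xs w : bump xs w <= 1.
Proof.
rewrite /bump; elim: xs => [|x xs IH]; first by rewrite big_nil.
rewrite big_cons mulr_ile1 ?expR_ge0//; first by apply: prodr_ge0 => *; exact: expR_ge0.
by rewrite -expR0 ler_expR mulNr oppr_le0 divr_ge0 ?sqr_ge0.
Qed.

Lemma measurable_bump xs : measurable_fun setT (bump xs).
Proof.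
rewrite /bump; elim: xs => [|x xs IH].
  by under eq_fun do rewrite big_nil; exact: measurable_cst.
under eq_fun do rewrite big_cons.
apply: measurable_funM => //; apply: measurableT_comp => //.
apply: measurable_funM => //; apply: measurable_funN.
by apply: measurable_funX; exact: xi_meas.
Qed.

(** Each factor [expR (- xi x ^+ 2 / 2)] is the average of [cos (z * xi x)]
    over a standard normal [z].  Hence the expectation only involves the
    characteristic functions of single linear combinations, and the averages
    over the [z] are Gaussian integrals. *)
Lemma expectation_cos_bump xs y :
  (\int[P]_w (cos (xi y w) * bump xs w)%:E =
   (density_at0 b xs * expR (- regress b xs y y / 2))%:E)%E.
Proof.
elim: xs y => [|x xs IH] y.
  rewrite /= mul1r -xi_cos; apply: eq_integral => w _.
  by rewrite /bump big_nil mulr1.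
pose f (p : T * R) := (cos (xi y p.1 + xi x p.1 * p.2) * bump xs p.1 * gauss_pdf p.2)%:E.
have mf : measurable_fun setT f.
  apply/measurable_EFinP; apply: measurable_funM; last first.
    by apply: measurableT_comp; first exact: measurable_gauss_pdf.
  apply: measurable_funM; last first.
    by apply: measurableT_comp; first exact: measurable_bump.
  apply: measurableT_comp; first exact: measurable_cos.
  apply: measurable_funD; first by apply: measurableT_comp; first exact: xi_meas.
  by apply: measurable_funM => //; apply: measurableT_comp; first exact: xi_meas.
have mP : measurable_fun setT (fun p : T * R => (gauss_pdf p.2)%:E).
  apply/measurable_EFinP.
  by apply: measurableT_comp; first exact: measurable_gauss_pdf.
have imf : (P \x mu)%E.-integrable setT f.
  apply: (@le_integrable _ _ _ (P \x mu)%E setT measurableT _ (fun p => (gauss_pdf p.2)%:E)) => //.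
  - move=> p _; rewrite /f /= lee_fin normrM ler_piMl// normrM.
    by rewrite mulr_ile1// ?cos_max// ger0_norm ?bump_ge0 ?bump_le1.
  - apply/integrable12ltyP => //=.
  under eq_integral => w _.
    under eq_integral => z _ do rewrite ger0_norm ?gauss_pdf_ge0//.
    rewrite integral_normal_pdf.
  over.
  by rewrite integral_cst//= mul1e probability_setT ltry.
transitivity (\int[P]_w \int[mu]_z f (w, z))%E.
  apply: eq_integral => w _; rewrite /f /=.
  under eq_integral do rewrite (mulrC (cos _)) -mulrA EFinM.
  have ic : mu.-integrable setT (fun z => (cos (xi y w + xi x w * z) * gauss_pdf z)%:E).
    apply: (@integrable_gauss_growth _ 1) => //.
      apply: measurableT_comp; first exact: measurable_cos.
      by apply: measurable_funD => //; exact: measurable_funM.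
    move=> z; rewrite mul1r; apply: (le_trans (cos_max _)).
    by rewrite -addrA lerDl addr_ge0 ?sqr_ge0.
  rewrite integralZl// -(fineK (integral_fune_fin_num _ ic))//.
  rewrite [fine _]gauss_cos -EFinM /bump big_cons; congr EFin.
  by rewrite [RHS]mulrC mulrA.
rewrite (Fubini imf).
transitivity (\int[mu]_z ((density_at0 b xs)%:E *
   (expR (- (regress b xs y y + 2 * regress b xs y x * z + regress b xs x x * z ^+ 2) / 2)
     * gauss_pdf z)%:E))%E.
  apply: eq_integral => z _; rewrite /f /=.
  under eq_integral do rewrite mulrC EFinM.
  have mz : measurable_fun setT (fun w => cos (xi y w + xi x w * z) * bump xs w).
    apply: measurable_funM; last exact: measurable_bump.
    apply: measurableT_comp; first exact: measurable_cos.
    by apply: measurable_funD; [|apply: measurable_funM => //]; exact: xi_meas.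
  rewrite integralZl//; last first.
    apply: (@le_integrable _ _ _ _ _ measurableT _ (cst 1%E)).
    - exact/measurable_EFinP.
    - move=> w _; rewrite /= lee_fin normr1 normrM.
      by rewrite mulr_ile1// ?cos_max// ger0_norm ?bump_ge0 ?bump_le1.
    - apply/integrableP; split; first exact: measurable_cst.
      by rewrite /= normr1 integral_cst//= mul1e probability_setT ltry.
  under eq_integral do rewrite (mulrC (xi x _)) -xi_lin.
  rewrite IH (regress_sqr bC b_lin) -!EFinM; congr EFin; ring.
have r0 := regress_ge0 bC b_lin b_ge0 xs x.
rewrite ge0_integralZl//; last 3 first.
- apply/measurable_EFinP; apply: measurable_funM; last exact: measurable_gauss_pdf.
  apply: measurableT_comp => //; apply: measurable_funM => //; apply: measurable_funN.
  by apply: measurable_funD; [apply: measurable_funD => //|]; apply: measurable_funM.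
- by move=> z _; rewrite lee_fin mulr_ge0 ?expR_ge0 ?gauss_pdf_ge0.
- by rewrite lee_fin density_at0_ge0.
rewrite gauss_expquad; last by rewrite ltr_wpDr.
rewrite -EFinM /= (regressC bC xs x y) expr2; congr EFin.
by rewrite mulrA mulrAC.
Qed.

End gaussian_family.

(** * Null sets of Hausdorff measures *)

Section hausdorff_null.
Context {R : realType}.
Implicit Types (A X U : set R) (s d e : R).
Local Notation diam := (@diameter R).
Local Notation weight := (@hausdorff_weight R).

Lemma diameter_le A d : (forall x y, A x -> A y -> `|x - y| <= d) ->
  (diam A <= d%:E)%E.
Proof.
move=> Ad; apply: ge_ereal_sup => _ [x Ax [y Ay <-]].
by rewrite lee_fin; exact: Ad.
Qed.

Lemma hausdorff_weight_ge0 s A : (0 <= weight s A)%E.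
Proof. by rewrite /hausdorff_weight; case: ifP => // _; exact: poweR_ge0. Qed.

Lemma hausdorff_weight0 s : weight s set0 = 0%E.
Proof. by rewrite /hausdorff_weight eqxx. Qed.

Lemma diameter_ge0 A : A !=set0 -> (0 <= diam A)%E.
Proof.
move=> [x Ax]; apply: ereal_sup_ubound; exists x => //; exists x => //.
by rewrite subrr normr0.
Qed.

Lemma hausdorff_weight_le s A d : 0 <= s -> 0 <= d ->
  (forall x y, A x -> A y -> `|x - y| <= d) -> (weight s A <= (d `^ s)%:E)%E.
Proof.
move=> s0 d0 Ad; rewrite /hausdorff_weight; case: ifPn => [_|/set0P A0].
  by rewrite lee_fin powR_ge0.
rewrite -poweR_EFin; apply: gt0_ler_poweR => //; rewrite ?in_itv/= ?leey ?andbT//.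
- exact: diameter_ge0.
- exact: diameter_le.
Qed.

Lemma diameter_witness s A e : A !=set0 -> (diam A <= e%:E)%E ->
  exists d, [/\ 0 <= d, d <= e, forall x y, A x -> A y -> `|x - y| <= d &
    weight s A = (d `^ s)%:E].
Proof.
move=> A0 Ae; have Age0 := diameter_ge0 A0.
have fA : diam A \is a fin_num by rewrite ge0_fin_numE// (le_lt_trans Ae) ?ltry.
exists (fine (diam A)); split.
- exact: fine_ge0.
- by rewrite -lee_fin fineK.
- move=> x y Ax Ay; rewrite -lee_fin fineK//; apply: ereal_sup_ubound.
  by exists x => //; exists y.
- by rewrite /hausdorff_weight ifF ?fine_poweR; [rewrite -poweR_EFin fineK|apply/negbTE/set0P].
Qed.

(** For nullity the limit over the scales [d] and the infimum over the covers
    reduce to the existence of economical covers by small sets. *)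
Definition hausdorff_null (s : R) A := forall d e : R, 0 < d -> 0 < e ->
  exists U : nat -> set R, [/\ A `<=` \bigcup_i U i,
    forall i, (diam (U i) <= d%:E)%E &
    (\sum_(0 <= i <oo) weight s (U i) <= e%:E)%E].

Lemma hausdorff_premeasure_ge0 s d A : (0 <= hausdorff_premeasure s d A)%E.
Proof.
apply: le_ereal_inf_tmp => _ [U _ <-]; apply: nneseries_ge0 => n _ _.
exact: hausdorff_weight_ge0.
Qed.

Lemma hausdorff_nullP s A : hausdorff_measure s A = 0%E <-> hausdorff_null s A.
Proof.
split=> [H0 d e d0 e0|HN].
  have : (hausdorff_premeasure s d A < e%:E)%E.
    apply: (@le_lt_trans _ _ 0%E); last by rewrite lte_fin.
    by rewrite -H0; apply: ereal_sup_ubound; exists d.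
  rewrite /hausdorff_premeasure => /ereal_inf_lt[_ [U [AU Ud] <-] /ltW Ue].
  by exists U.
apply/eqP; rewrite eq_le; apply/andP; split; last first.
  apply: le_trans (hausdorff_premeasure_ge0 s 1 A) _.
  by apply: ereal_sup_ubound; exists 1 => //=; exact: ltr01.
apply: ge_ereal_sup => _ [d /= d0 <-].
apply/lee_addgt0Pr => e e0; rewrite add0e.
have [U [AU Ud Ue]] := HN d e d0 e0.
by apply: le_trans Ue; apply: ereal_inf_lbound; exists U.
Qed.

Lemma nneseries_le_bound (f : nat -> \bar R) (x : \bar R) :
  (forall i, (0 <= f i)%E) -> (forall n, (\sum_(0 <= i < n) f i <= x)%E) ->
  (\sum_(0 <= i <oo) f i <= x)%E.
Proof.
move=> f0 fx; apply: lime_le; first by apply: is_cvg_nneseries => n _ _; exact: f0.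
by apply: nearW => n; exact: fx.
Qed.

Lemma nneseries_pair (a : nat -> nat -> \bar R) (f : nat -> nat * nat) :
  set_bij [set: nat] [set: nat * nat] f -> (forall i j, (0 <= a i j)%E) ->
  (\sum_(0 <= i <oo) \sum_(0 <= j <oo) a i j =
   \sum_(0 <= k <oo) a (f k).1 (f k).2)%E.
Proof.
move=> bf a0; have aS i : (0 <= \sum_(0 <= j <oo) a i j)%E.
  by apply: nneseries_ge0 => *; exact: a0.
rewrite !nneseries_esumT//.
under eq_esum do rewrite nneseries_esumT//.
rewrite esum_esum// (reindex_esum [set: nat] _ f)//.
by rewrite (_ : _ `*`` _ = setT)//; apply/seteqP; split => -[].
Qed.

Lemma ex_nat_pair : exists f : nat -> nat * nat,
  set_bij [set: nat] [set: nat * nat] f.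
Proof. by apply/card_set_bijP; rewrite card_eq_sym; exact: card_nat2. Qed.

(** A bijection of [nat] with [nat * nat] merges the two indices; the weights
    are nonnegative, so their sum does not depend on the order. *)
Lemma hausdorff_null_double s A :
  (forall d e : R, 0 < d -> 0 < e -> exists U : nat -> nat -> set R,
    [/\ A `<=` \bigcup_i \bigcup_j U i j,
      forall i j, (diam (U i j) <= d%:E)%E &
      (\sum_(0 <= i <oo) \sum_(0 <= j <oo) weight s (U i j) <= e%:E)%E]) ->
  hausdorff_null s A.
Proof.
move=> H d e d0 e0; have [U [AU Ud Ue]] := H d e d0 e0.
have [f bf] := ex_nat_pair.
exists (fun k => U (f k).1 (f k).2); split.
- move=> x /AU[i _ [j _ Uij]]; have [_ _ fs] := bf.
  by have [k _ fk] := fs (i, j) I; exists k => //; rewrite fk.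
- by move=> k; exact: Ud.
- rewrite -(nneseries_pair (a := fun i j => weight s (U i j)) bf)//.
  by move=> i j; exact: hausdorff_weight_ge0.
Qed.

Lemma hausdorff_null_bigcup s (A : nat -> set R) :
  (forall i, hausdorff_null s (A i)) -> hausdorff_null s (\bigcup_i A i).
Proof.
move=> HA; apply: hausdorff_null_double => d e d0 e0.
have ei i : 0 < e / (2 ^ i.+1)%:R by rewrite divr_gt0// ltr0n expn_gt0.
have /choice[U HU] i := HA i d _ d0 (ei i).
exists U; split.
- move=> x [i _ Aix]; exists i => //; have [AU _ _] := HU i; exact: AU.
- by move=> i j; have [_ + _] := HU i; apply.
- apply: le_trans (epsilon_trick0 xpredT (ltW e0)).
  apply: lee_nneseries => [i _ _|i _].
    by apply: nneseries_ge0 => *; exact: hausdorff_weight_ge0.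
  by have [] := HU i.
Qed.

Lemma hausdorff_null_sub s A X : A `<=` X -> hausdorff_null s X ->
  hausdorff_null s A.
Proof.
move=> AX HX d e d0 e0; have [U [XU Ud Ue]] := HX d e d0 e0.
by exists U; split => // x /AX; exact: XU.
Qed.

Lemma hausdorff_null_le s s' A : s <= s' -> 0 <= s -> hausdorff_null s A ->
  hausdorff_null s' A.
Proof.
move=> ss' s0 HA d e d0 e0.
have [|U [AU Ud Ue]] := HA (Num.min d 1) e _ e0; first by rewrite lt_min d0 ltr01.
exists U; split => //.
- by move=> i; apply: (le_trans (Ud i)); rewrite lee_fin ge_min lexx.
apply: le_trans Ue; apply: lee_nneseries => [i _ _|i _].
  exact: hausdorff_weight_ge0.
have [->|/set0P U0] := eqVneq (U i) set0; first by rewrite !hausdorff_weight0.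
have [r [r0 rd Ur ->]] := diameter_witness s U0 (Ud i).
apply: (le_trans (hausdorff_weight_le (le_trans s0 ss') r0 Ur)).
rewrite lee_fin; move: rd; rewrite le_min => /andP[_ r1].
have [->|r_neq0] := eqVneq r 0.
  have [s'0|s'0] := eqVneq s' 0; last by rewrite powR0// powR_ge0.
  have -> : s = s' by apply/eqP; rewrite eq_le ss' s'0 s0.
  by [].
by apply: ger_powR => //; rewrite lt0r r_neq0 r0.
Qed.

Lemma hausdorff_dim_le s A : 0 <= s -> hausdorff_null s A ->
  (hausdorff_dim A <= s%:E)%E.
Proof.
move=> s0 /hausdorff_nullP H; apply: ereal_inf_lbound; exists s => //=.
Qed.

Lemma hausdorff_dim_ge0 A : (0 <= hausdorff_dim A)%E.
Proof. by apply: le_ereal_inf_tmp => _ [s [s0 _] <-]; rewrite lee_fin. Qed.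

Lemma hausdorff_dim_lt_null s A : (hausdorff_dim A < s%:E)%E ->
  hausdorff_null s A.
Proof.
move=> /ereal_inf_lt[_ [r [r0 /hausdorff_nullP Hr] <-]]; rewrite lte_fin => rs.
exact: hausdorff_null_le (ltW rs) r0 Hr.
Qed.

Lemma hausdorff_dim_leP (x : R) A : 0 <= x ->
  (forall s, x < s -> hausdorff_null s A) -> (hausdorff_dim A <= x%:E)%E.
Proof.
move=> x0 H; apply/lee_addgt0Pr => e e0; rewrite -EFinD.
have xe : x < x + e by rewrite ltrDl.
by apply: hausdorff_dim_le (H _ xe); exact: le_trans (ltW xe).
Qed.

(** A piece of diameter [r] has an image of diameter at most [K * r `^ g].  The
    pieces of a cover may be taken small, so a Hoelder bound for close points
    is enough. *)
Lemma hausdorff_null_hoelder s (g K d0 : R) (f : R -> R) A : 0 <= s ->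
  0 < g -> 0 < K -> 0 < d0 ->
  (forall x y, A x -> A y -> `|x - y| <= d0 -> `|f x - f y| <= K * `|x - y| `^ g) ->
  hausdorff_null s A -> hausdorff_null (s / g) (f @` A).
Proof.
move=> s0 g0 K0 d00 fK HA d e d_gt0 e0.
(* [d0] makes the Hoelder bound valid, the other term makes the images small. *)
pose d1 := Num.min d0 ((d / K) `^ g^-1).
have d1_gt0 : 0 < d1 by rewrite lt_min d00 powR_gt0// divr_gt0.
have e1 : 0 < e / K `^ (s / g) by rewrite divr_gt0// powR_gt0.
have [U [AU Ud Ue]] := HA d1 _ d1_gt0 e1.
have sg : 0 <= s / g by rewrite divr_ge0// ltW.
have key i : A `&` U i !=set0 -> exists r, [/\ 0 <= r, r <= d1,
    forall x y, (f @` (A `&` U i)) x -> (f @` (A `&` U i)) y -> `|x - y| <= K * r `^ g &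
    weight s (U i) = (r `^ s)%:E].
  move=> [a [Aa Ua]]; have U0 : U i !=set0 by exists a.
  have [r [r0 rd Ur ->]] := diameter_witness s U0 (Ud i).
  exists r; split => // _ _ [x [Ax Ux] <-] [y [Ay Uy] <-].
  have xy := Ur _ _ Ux Uy.
  apply: (le_trans (fK _ _ Ax Ay _)).
    by apply: (le_trans xy); apply: (le_trans rd); rewrite ge_min lexx.
  by rewrite ler_pM2l//; apply: ge0_ler_powR => //; rewrite ?nnegrE// ltW.
exists (fun i => f @` (A `&` U i)); split.
- by move=> _ [x Ax <-]; have [i _ Ui] := AU _ Ax; exists i => //; exists x.
- move=> i; apply: diameter_le => x y fx fy.
  have [r [r0 rd1 Hr _]] : exists r, [/\ 0 <= r, r <= d1,
    forall x y, (f @` (A `&` U i)) x -> (f @` (A `&` U i)) y -> `|x - y| <= K * r `^ g &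
    weight s (U i) = (r `^ s)%:E] by apply: key; case: fx => a Ha _; exists a.
  apply: (le_trans (Hr _ _ fx fy)); rewrite mulrC -ler_pdivlMr//.
  have -> : d / K = ((d / K) `^ g^-1) `^ g.
    by rewrite -powRrM mulVf ?gt_eqF// powRr1// divr_ge0// ltW.
  apply: ge0_ler_powR => //; rewrite ?nnegrE ?powR_ge0//; first exact: ltW.
  by apply: (le_trans rd1); rewrite ge_min lexx orbT.
apply: (@le_trans _ _ (\sum_(0 <= i <oo) (K `^ (s / g))%:E * weight s (U i))%E).
  apply: lee_nneseries => [i _ _|i _]; first exact: hausdorff_weight_ge0.
  have [->|/set0P AU0] := eqVneq (A `&` U i) set0.
    by rewrite image_set0 hausdorff_weight0 mule_ge0 ?hausdorff_weight_ge0// lee_fin powR_ge0.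
  have [r [r0 rd1 Hr ->]] := key _ AU0.
  have Kr : 0 <= K * r `^ g by rewrite mulr_ge0 ?powR_ge0// ltW.
  apply: (le_trans (hausdorff_weight_le sg Kr Hr)).
  rewrite -EFinM lee_fin powRM ?powR_ge0//; last exact: ltW.
  by rewrite -powRrM mulrCA divff ?mulr1// gt_eqF.
rewrite nneseriesZl//; last by move=> i _; exact: hausdorff_weight_ge0.
rewrite -lee_pdivlMl ?powR_gt0//.
by rewrite -EFinM mulrC.
Qed.

End hausdorff_null.

(** * Dyadic cells and balanced covers *)

Section dyadic.
Context {R : realType}.
Implicit Types (t s d e : R) (A : set R).

Definition dyad (n : nat) : R := 2^-1 ^+ n.

Definition cell (n : nat) (t : R) : nat := Num.truncn (t * 2 ^+ n).

Lemma dyad_gt0 n : 0 < dyad n.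
Proof. by rewrite exprn_gt0. Qed.

Lemma dyad_ge0 n : 0 <= dyad n.
Proof. exact: ltW (dyad_gt0 n). Qed.

Lemma dyadV n : dyad n = (2 ^+ n)^-1.
Proof. by rewrite /dyad exprVn. Qed.

Lemma dyadS n : dyad n = 2 * dyad n.+1.
Proof. by rewrite /dyad exprS mulrA divff ?mul1r. Qed.

Lemma le_dyad n m : (n <= m)%N -> dyad m <= dyad n.
Proof.
by move=> nm; rewrite /dyad ler_wiXn2l// ?invr_ge0// invf_le1// ler1n.
Qed.

Lemma dyad_small e : 0 < e -> exists n, dyad n <= e.
Proof.
move=> e0; exists (Num.truncn e^-1).+1; rewrite dyadV.
rewrite -[leRHS]invrK lef_pV2 ?posrE ?exprn_gt0 ?invr_gt0//.
have := truncnS_gt e^-1; move: (Num.truncn _).+1 => n h.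
apply: (le_trans (ltW h)); rewrite -natrX ler_nat.
by apply: ltnW; exact: ltn_expl.
Qed.

Lemma dyad_powR_small s e : 0 < s -> 0 < e -> exists n, dyad n `^ s <= e.
Proof.
move=> s0 e0; have [|n ne] := @dyad_small (e `^ s^-1); first exact: powR_gt0.
exists n; rewrite -[leRHS](powRr1 (ltW e0)) -(mulVf (lt0r_neq0 s0)) powRrM.
by apply: ge0_ler_powR; rewrite ?nnegrE ?dyad_ge0 ?powR_ge0// ltW.
Qed.

Lemma half_powR_lt1 s : 0 < s -> 2^-1 `^ s < 1 :> R.
Proof.
move=> s0; rewrite [ltRHS](_ : 1 = 1 `^ s); last by rewrite powR1.
by apply: gt0_ltr_powR; rewrite ?nnegrE// invf_lt1// ltr1n.
Qed.

Lemma cell_itv n t : 0 <= t ->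
  (cell n t)%:R * dyad n <= t < (cell n t).+1%:R * dyad n.
Proof.
move=> t0; have /andP[h1 h2] : (cell n t)%:R <= t * 2 ^+ n < (cell n t).+1%:R.
  by apply: truncn_itv; rewrite mulr_ge0 ?exprn_ge0.
by rewrite dyadV ler_pdivrMr ?exprn_gt0// ltr_pdivlMr ?exprn_gt0// h1.
Qed.

Lemma cell_le n t : 0 <= t <= 1 -> (cell n t <= 2 ^ n)%N.
Proof.
move=> /andP[t0 t1]; rewrite -(ler_nat R) natrX.
have /andP[h _] := cell_itv n t0.
by rewrite -ler_pdivlMr ?dyad_gt0// in h *; apply: (le_trans h); rewrite dyadV invrK ler_piMl ?exprn_ge0.
Qed.

Lemma cell_parent n m t : 0 <= t -> (m <= n)%N ->
  (cell n t %/ 2 ^ (n - m))%N = cell m t.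
Proof.
move=> t0 mn; have /andP[h1 h2] := cell_itv n t0.
have /andP[h3 h4] := cell_itv m t0.
have e : dyad m = (2 ^ (n - m))%:R * dyad n.
  rewrite natrX !dyadV -{2}(subnK mn) exprD invfM mulrA divff ?mul1r//.
have p0 : (0 < 2 ^ (n - m))%N by rewrite expn_gt0.
have D0 := dyad_gt0 n.
have l1 : (cell m t * 2 ^ (n - m) < (cell n t).+1)%N.
  rewrite -(ltr_nat R) natrM -(ltr_pM2r D0) -mulrA -e; exact: le_lt_trans h2.
have l2 : (cell n t < (cell m t).+1 * 2 ^ (n - m))%N.
  rewrite -(ltr_nat R) natrM -(ltr_pM2r D0) -mulrA -e; exact: le_lt_trans h4.
apply/eqP; rewrite eqn_leq; apply/andP; split.
  by rewrite -ltnS ltn_divLR.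
by rewrite leq_divRL.
Qed.

Lemma cell_close n t u : 0 <= t -> 0 <= u -> `|t - u| <= dyad n ->
  (cell n u <= (cell n t).+1)%N.
Proof.
move=> t0 u0; have /andP[h1 h2] := cell_itv n t0.
have /andP[h3 h4] := cell_itv n u0.
rewrite distrC ler_norml => /andP[_ h5].
rewrite -ltnS -(ltr_nat R) -(ltr_pM2r (dyad_gt0 n)).
by apply: (le_lt_trans h3); rewrite mulrSr mulrDl mul1r; lra.
Qed.

Lemma dyadic_approx s d e : 0 < s -> 0 <= d -> d <= 1 -> 0 < e ->
  exists n, d <= dyad n /\ dyad n `^ s <= 2 `^ s * d `^ s + e.
Proof.
move=> s0 d0 d1 e0; have [->|d_neq0] := eqVneq d 0.
  have [n ne] := dyad_powR_small s0 e0; exists n; split; first exact: dyad_ge0.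
  by rewrite powR0 ?gt_eqF// mulr0 add0r.
have {d_neq0}d0 : 0 < d by rewrite lt0r d_neq0.
have ex : exists n, dyad n < d.
  have [|n nd] := @dyad_small (d / 2); first by rewrite divr_gt0.
  by exists n; apply: le_lt_trans nd _; lra.
have := ex_minnP ex; move=> [[|n] nd nmin]; first by move: nd; rewrite /dyad expr0 ltNge d1.
exists n; have dn : d <= dyad n.
  by rewrite leNgt; apply/negP => /nmin; rewrite ltnn.
split => //; rewrite -powRM//; last exact: ltW.
apply: (@le_trans _ _ ((2 * d) `^ s)); last by rewrite lerDl ltW.
apply: ge0_ler_powR; rewrite ?nnegrE ?dyad_ge0 ?mulr_ge0//; try exact: ltW.
by rewrite dyadS ler_pM2l// ltW.
Qed.

(** A piece of a cover is contained in the union of three adjacent cells whose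
    common length is comparable with its diameter. *)
Lemma dyadic_cover s A : 0 < s -> A `<=` `[0, 1] -> hausdorff_null s A ->
  forall e, 0 < e -> exists (n c : nat -> nat),
   (forall t, A t -> exists i, cell (n i) t \in [:: (c i).-1; c i; (c i).+1]) /\
   (\sum_(0 <= i <oo) (dyad (n i) `^ s)%:E <= e%:E)%E.
Proof.
move=> s0 A01 HA e e0.
have p2 : 0 < (2 : R) `^ s by rewrite powR_gt0.
have e1 : 0 < e / 2 / 2 `^ s by rewrite !divr_gt0.
have e2 : 0 < e / 2 by rewrite divr_gt0.
have [U [AU Ud Ue]] := HA 1 _ ltr01 e1.
have ei i : 0 < e / 2 / (2 ^ i.+1)%:R by rewrite divr_gt0// ltr0n expn_gt0.
have H i : exists p : nat * nat,
    (forall t, A t -> U i t -> cell p.1 t \in [:: p.2.-1; p.2; p.2.+1]) /\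
    ((dyad p.1 `^ s)%:E <= (2 `^ s)%:E * hausdorff_weight s (U i) +
       (e / 2 / (2 ^ i.+1)%:R)%:E)%E.
  have [AU0|/set0P[a [Aa Ua]]] := eqVneq (A `&` U i) set0.
    have [n ne] := dyad_powR_small s0 (ei i); exists (n, 0%N); split => /=.
      by move=> t At Ut; have : (A `&` U i) t by []; rewrite AU0.
    rewrite -[leLHS]add0e; apply: leeD; last by rewrite lee_fin.
    by rewrite mule_ge0 ?hausdorff_weight_ge0// lee_fin ltW.
  have U0 : U i !=set0 by exists a.
  have [r [r0 r1 Ur ->]] := diameter_witness s U0 (Ud i).
  have [n [rn ne]] := dyadic_approx s0 r0 r1 (ei i).
  exists (n, cell n a); split => /=; last by rewrite -EFinM -EFinD lee_fin.
  move=> t At Ut; have := A01 _ At; have := A01 _ Aa; rewrite /= !in_itv/=.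
  move=> /andP[a0 _] /andP[t0 _].
  have h1 := @cell_close n a t a0 t0 (le_trans (Ur _ _ Ua Ut) rn).
  have h2 := @cell_close n t a t0 a0 (le_trans (Ur _ _ Ut Ua) rn).
  by move: (cell n t) (cell n a) h1 h2 => x y h1 h2; clear -h1 h2; rewrite !inE; lia.
have [p Hp] := choice H.
exists (fun i => (p i).1), (fun i => (p i).2); split.
  move=> t At; have [i _ Ui] := AU _ At; exists i; have [+ _] := Hp i; exact.
apply: (@le_trans _ _ (\sum_(0 <= i <oo) ((2 `^ s)%:E * hausdorff_weight s (U i) +
       (e / 2 / (2 ^ i.+1)%:R)%:E))%E).
  apply: lee_nneseries => [i _ _|i _]; first by rewrite lee_fin powR_ge0.
  by have [] := Hp i.
rewrite nneseriesD//; last 2 first.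
- by move=> i _ _; rewrite mule_ge0 ?hausdorff_weight_ge0// lee_fin ltW.
- by move=> i _ _; rewrite lee_fin ltW.
rewrite [leRHS](_ : _ = (e / 2)%:E + (e / 2)%:E)%E; last first.
  by rewrite -EFinD; congr EFin; lra.
apply: leeD; last exact: (epsilon_trick0 xpredT (ltW e2)).
rewrite nneseriesZl//; last by move=> i _; exact: hausdorff_weight_ge0.
by rewrite -lee_pdivlMl// -EFinM mulrC.
Qed.

(** Replacing the cells of an economical cover by the maximal cells in which
    the cover is at least as expensive as the cell itself yields a cover that
    is nowhere denser than dimension [s] allows: a strict ancestor of a chosen
    cell is cheap, so it contains few chosen cells of each level. *)
Lemma balanced_cover s A : 0 < s -> A `<=` `[0, 1] -> hausdorff_null s A ->
  forall K : nat, exists C : nat -> nat -> bool,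
  [/\ forall t, A t -> exists m, C m (cell m t),
      forall m k, C m k -> (K <= m)%N &
      forall n m j (S : seq nat), (m <= n)%N -> uniq S ->
        (forall k, k \in S -> C n k /\ (k %/ 2 ^ (n - m))%N = j) ->
        (size S)%:R <= (2 ^+ (n - m)) `^ s].
Proof.
move=> s0 A01 HA K.
have e0 : 0 < dyad K `^ s / 3 by rewrite divr_gt0// powR_gt0// dyad_gt0.
have [n [c [cov tot]]] := dyadic_cover s0 A01 HA e0.
pose ks i := [:: (c i).-1; c i; (c i).+1].
(* [cost m j i] is the number of cells of the [i]th triple that lie in the
   [j]th cell of level [m], and [W m j] is the price of the cover inside
   that cell. *)
pose cost (m j i : nat) : nat :=
  (\sum_(k <- ks i) ((m <= n i) && (k %/ 2 ^ (n i - m) == j)))%N.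
pose W m j := (\sum_(0 <= i <oo) ((cost m j i)%:R * dyad (n i) `^ s)%:E)%E.
have W0 m j i : (0 <= ((cost m j i)%:R * dyad (n i) `^ s)%:E)%E.
  by rewrite lee_fin mulr_ge0 ?powR_ge0.
pose heavy m j := `[< ((dyad m `^ s)%:E <= W m j)%E >].
pose C m j := heavy m j && [forall m' : 'I_m, ~~ heavy m' (j %/ 2 ^ (m - m'))%N].
have Wtot m j : (W m j <= (dyad K `^ s)%:E)%E.
  apply: (@le_trans _ _ (3%:E * (\sum_(0 <= i <oo) (dyad (n i) `^ s)%:E))%E).
    rewrite -nneseriesZl//; last by move=> i _; rewrite lee_fin powR_ge0.
    apply: lee_nneseries => [i _ _|i _]; first exact: W0.
    rewrite -EFinM lee_fin ler_wpM2r ?powR_ge0// ler_nat.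
    by rewrite /cost /ks !big_cons big_nil; do 3!case: (_ && _).
  by rewrite -lee_pdivlMl// -EFinM mulrC.
have own i k : k \in ks i -> heavy (n i) k.
  move=> kin; apply/asboolP.
  apply: (@le_trans _ _ (\sum_(0 <= j < i.+1) ((cost (n i) k j)%:R * dyad (n j) `^ s)%:E)%E).
    rewrite big_nat_recr//= -[leLHS]add0e; apply: leeD; first exact: sume_ge0.
    rewrite lee_fin ler_peMl ?powR_ge0// ler1n /cost.
    by rewrite (big_rem k kin)/= leqnn subnn expn0 divn1 eqxx.
  by apply: nneseries_lim_ge => *; exact: W0.
exists C; split.
- move=> t At; have [i ti] := cov t At.
  have t0 : 0 <= t by have := A01 _ At; rewrite /= in_itv/= => /andP[].
  have ex : exists m, heavy m (cell m t) by exists (n i); exact: own ti.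
  have [m hm mmin] := ex_minnP ex; exists m; rewrite /C hm /=.
  apply/forallP => -[m' m'm] /=; rewrite (cell_parent t0 (ltnW m'm)).
  by apply/negP => /mmin; rewrite leqNgt m'm.
- move=> m k /andP[/asboolP hm _]; have := le_trans hm (Wtot _ _).
  rewrite lee_fin leNgt; apply: contraNT; rewrite -ltnNge => mK.
  apply: gt0_ltr_powR; rewrite ?nnegrE ?dyad_ge0//.
  by rewrite /dyad ltr_iXn2l// ?invr_gt0// invf_lt1// ltr1n.
move=> l m j S ml uS HS.
have [->|Sne] := eqVneq S [::]; first by rewrite /= powR_ge0.
have [lm|lm] := eqVneq l m.
  have S1 : (size S <= 1)%N.
    have sub : {subset S <= [:: j]}.
      by move=> k /HS[_]; rewrite lm subnn expn0 divn1 inE => ->.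
    exact: uniq_leq_size uS sub.
  by rewrite lm subnn expr0 powR1 -[leRHS]/(1%:R) ler_nat.
have ml' : (m < l)%N by rewrite ltn_neqAle eq_sym lm ml.
have hm : ~~ heavy m j.
  case: S Sne uS HS => // k S _ _ /(_ k); rewrite mem_head => /(_ erefl)[/andP[_ /forallP]].
  by move=> /(_ (Ordinal ml'))/= + e; rewrite e.
have : (\sum_(k <- S) W l k <= W m j)%E.
  rewrite /W -nneseries_sum//.
  apply: lee_nneseries => [i _ _|i _]; first by apply: sume_ge0 => *; exact: W0.
  rewrite sumEFin lee_fin -mulr_suml ler_wpM2r ?powR_ge0// -natr_sum ler_nat.
  have key k : (\sum_(x <- S) ((l <= n i) && (k %/ 2 ^ (n i - l) == x)) <=
      ((m <= n i) && (k %/ 2 ^ (n i - m) == j)))%N.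
    have [ln|ln] := leqP l (n i); last by rewrite big1.
    rewrite (leq_trans ml ln) /=.
    have [kS|kS] := boolP ((k %/ 2 ^ (n i - l))%N \in S); last first.
      rewrite big_seq big1// => x xS; apply/eqP; rewrite eqb0; apply: contraNN kS => /eqP ->//.
    rewrite (bigD1_seq _ kS uS)/= eqxx big1 ?addn0; last by move=> x; rewrite eq_sym => /negbTE ->.
    have [_ <-] := HS _ kS.
    rewrite -divnMA -expnD (_ : _ + _ = n i - m)%N ?eqxx//; lia.
  by rewrite /cost exchange_big /=; apply: leq_sum => k _; exact: key.
move=> h; have : (\sum_(k <- S) (dyad l `^ s)%:E < (dyad m `^ s)%:E)%E.
  apply: (@le_lt_trans _ _ (\sum_(k <- S) W l k)%E).
    rewrite big_seq [leRHS]big_seq; apply: lee_sum => k /HS[/andP[/asboolP + _] _].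
    by [].
  by apply: (le_lt_trans h); rewrite ltNge; apply: contra hm => hm; apply/asboolP.
rewrite sumEFin lte_fin big_const_seq count_predT iter_addr_0 => /ltW h2.
have {}h2 : (size S)%:R * dyad l `^ s <= dyad m `^ s by rewrite mulr_natl.
rewrite -ler_pdivlMr ?powR_gt0 ?dyad_gt0// in h2; apply: (le_trans h2).
rewrite -powR_inv1 ?powR_ge0// powRAC -powRM ?powR_ge0 ?dyad_ge0//.
rewrite powR_inv1 ?dyad_ge0// !dyadV invrK.
rewrite le_eqVlt; apply/orP; left; apply/eqP; congr (_ `^ s).
by rewrite -{1}(subnK ml) exprD mulrCA mulVf ?mulr1// gt_eqF// exprn_gt0.
Qed.

Lemma card_le_sum (I J : finType) (X : {set I}) (S : J -> {set I}) :
  (forall k, k \in X -> exists K, k \in S K) ->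
  (#|X| <= \sum_K #|S K|)%N.
Proof.
move=> XS.
rewrite -sum1_card big_mkcond/=; under [leqRHS]eq_bigr do rewrite -sum1_card big_mkcond/=.
rewrite exchange_big/=; apply: leq_sum => k _; case: ifPn => // /XS[K kK].
by rewrite (bigD1 K)//= kK.
Qed.

(** Level [n] collects the cells of that level from the balanced covers with
    parameters [K <= n].  Their number accounts for the factor [n.+1]; covers
    with arbitrarily large [K] catch each point at arbitrarily high levels. *)
Lemma balanced_family s A : 0 < s -> A `<=` `[0, 1] -> hausdorff_null s A ->
  exists C : forall n, {set 'I_(2 ^ n).+1},
  (forall t, A t -> forall n0 : nat, exists2 n : nat, (n0 <= n)%N &
     exists2 k, k \in C n & k = cell n t :> nat) /\
  (forall n m j, (m <= n)%N ->
     #|[set k in C n | (k %/ 2 ^ (n - m) == j)%N]%SET|%:R <=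
       n.+1%:R * (2 ^+ (n - m)) `^ s).
Proof.
move=> s0 A01 HA.
have /choice[C HC] := balanced_cover s0 A01 HA.
exists (fun n => [set k : 'I_(2 ^ n).+1 | [exists K : 'I_n.+1, C K n k]]%SET); split.
  move=> t At n0; have [/(_ t At)[m Cm] lev _] := HC n0.
  have t01 : 0 <= t <= 1 by have := A01 _ At; rewrite /= in_itv.
  have cm : (cell m t < (2 ^ m).+1)%N by rewrite ltnS; exact: cell_le.
  have n0m := lev _ _ Cm; exists m => //.
  exists (Ordinal cm) => //; rewrite inE; apply/existsP.
  have n0m' : (n0 < m.+1)%N by rewrite ltnS.
  by exists (Ordinal n0m').
move=> n m j mn.
pose S (K : 'I_n.+1) := [set k : 'I_(2 ^ n).+1 | C K n k & (k %/ 2 ^ (n - m) == j)%N]%SET.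
have SK K : #|S K|%:R <= (2 ^+ (n - m)) `^ s :> R.
  have [_ _ /(_ n m j [seq val k | k <- enum (S K)] mn)] := HC K.
  rewrite size_map -cardE; apply.
    by rewrite map_inj_uniq ?enum_uniq//; exact: val_inj.
  by move=> _ /mapP[k + ->]; rewrite mem_enum inE => /andP[Ck /eqP].
have : (#|[set k in [set k : 'I_(2 ^ n).+1 | [exists K : 'I_n.+1, C K n k]] |
    (k %/ 2 ^ (n - m) == j)%N]%SET| <= \sum_(K < n.+1) #|S K|)%N.
  apply: card_le_sum => k; rewrite !inE => /andP[/existsP[K CK] kj].
  by exists K; rewrite inE CK kj.
rewrite -(ler_nat R) natr_sum => /le_trans; apply.
apply: (@le_trans _ _ (\sum_(K < n.+1) (2 ^+ (n - m)) `^ s)); first by apply: ler_sum => K _.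
by rewrite sumr_const card_ord mulr_natl.
Qed.

End dyadic.

(** * Preimages of sets of small Minkowski dimension *)

Section minkowski.
Context {R : realType}.
Implicit Types (u v r t : R) (D E F : set R).

Lemma minkowski_cover F u : (upper_minkowski_dim F < u%:E)%E ->
  exists2 r0 : R, 0 < r0 & forall r, 0 < r -> r < r0 ->
    exists n (c : 'I_n.+1 -> R), F `<=` \bigcup_i closed_ball (c i) r /\
      n.+1%:R <= r `^ (- u).
Proof.
rewrite /upper_minkowski_dim limf_esupE => /ereal_inf_lt[_ [V V0 <-] supV].
have [e /= e0 eV] : exists2 e : R, 0 < e & forall r, 0 < r -> r < e -> V r.
  case: V0 => e /= e0 He; exists e => // r r0 re.
  by apply: He => //=; rewrite sub0r normrN gtr0_norm.
exists (Num.min e 1); first by rewrite lt_min e0 ltr01.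
move=> r r0; rewrite lt_min => /andP[re r1].
have l0 : 0 < ln r^-1 by rewrite ln_gt0// invf_gt1.
have : (lne (covering_number F r) / (ln r^-1)%:E < u%:E)%E.
  by apply: le_lt_trans supV; apply: ereal_sup_ubound; exists r => //; exact: eV.
rewrite inver gt_eqF// lte_pdivrMr//.
have N1 : (1 <= covering_number F r)%E.
  by apply: le_ereal_inf_tmp => _ [n _ <-]; rewrite lee_fin ler1n.
case N : (covering_number F r) N1 => [x| |]//; rewrite lee_fin => x1.
  have x0 : 0 < x by exact: lt_le_trans x1.
  rewrite lne_EFin// -EFinM lte_fin => hx.
  have : (covering_number F r < (r `^ (- u))%:E)%E.
    rewrite N lte_fin -[x]lnK ?posrE// /powR gt_eqF// ltr_expR.
    by move: hx; rewrite lnV ?posrE// mulrN mulNr.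
  move=> /ereal_inf_lt[_ [n [c Fc] <-]]; rewrite lte_fin => /ltW h.
  by exists n, c.
Qed.

Lemma packing_dim_lt E u : (packing_dim E < u%:E)%E ->
  exists2 U : nat -> set R, E = \bigcup_i U i &
    forall i, (upper_minkowski_dim (U i) < u%:E)%E.
Proof.
move=> /ereal_inf_lt[_ [U EU <-] Uu]; exists U => // i.
by apply: le_lt_trans Uu; apply: ereal_sup_ubound; exists i.
Qed.

Lemma packing_dim_set1 (y : R) : (packing_dim [set y] <= 0)%E.
Proof.
apply: (@le_trans _ _ (ereal_sup (range (fun _ : nat => upper_minkowski_dim [set y])))).
  apply: ereal_inf_lbound; exists (fun _ => [set y]) => //=.
  by rewrite bigcup_const//; exists 0%N.
apply: ge_ereal_sup => _ [_ _ <-].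
rewrite /upper_minkowski_dim limf_esupE.
pose V : set R := `]0, 1[%classic.
apply: (@le_trans _ _ (ereal_sup
  [set lne (covering_number [set y] r) / (ln r^-1)%:E | r in V])%E).
  apply: ereal_inf_lbound; exists V => //.
  near=> r; rewrite /V /= in_itv/=; apply/andP; split => //.
apply: ge_ereal_sup => _ [r + <-]; rewrite /V /= in_itv/= => /andP[r0 r1].
have -> : covering_number [set y] r = 1%E.
  apply/eqP; rewrite eq_le; apply/andP; split; last first.
    by apply: le_ereal_inf_tmp => _ [n _ <-]; rewrite lee_fin ler1n.
  apply: ereal_inf_lbound; exists 0%N => //; exists (fun=> y) => _ ->.
  by exists ord0 => //; exact: closed_ballxx.
by rewrite lne1 mul0e.
Unshelve. all: by end_near. Qed.

Lemma geometric_tail (x : R) (n0 n : nat) : 0 <= x -> x < 1 ->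
  \sum_(0 <= i < n) (if (n0 <= i)%N then x ^+ i else 0) <= x ^+ n0 / (1 - x).
Proof.
move=> x0 x1; have y0 : 0 < 1 - x by rewrite subr_gt0.
rewrite ler_pdivlMr//.
have : (\sum_(0 <= i < n) (if (n0 <= i)%N then x ^+ i else 0)) * (1 - x) =
    if (n0 <= n)%N then x ^+ n0 - x ^+ n else 0.
  elim: n => [|n IH].
    by rewrite big_nil mul0r leqn0; case: eqP => // ->; rewrite subrr.
  rewrite big_nat_recr//= mulrDl IH.
  have [n0n|nn0] := leqP n0 n; first by rewrite leqW// exprS; ring.
  rewrite mul0r addr0; have [->|n0n] := eqVneq n0 n.+1; first by rewrite leqnn subrr.
  by rewrite leqNgt ltn_neqAle eq_sym n0n nn0.
move=> ->; case: ifP => _; last by rewrite exprn_ge0.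
by rewrite gerBl exprn_ge0.
Qed.

End minkowski.

Section path_dimension.
Context {R : realType} (f : R -> R) (D : set R).
Hypothesis D01 : D `<=` `[0, 1].
Variable C : forall n, {set 'I_(2 ^ n).+1}.
Hypothesis CD : forall t, D t -> forall n0 : nat,
  exists2 n : nat, (n0 <= n)%N & exists2 k, k \in C n & k = cell n t :> nat.
Variables (a e L : R).
Hypothesis a0 : 0 < a.
Hypothesis L0 : 0 <= L.
Local Notation r n := (dyad n `^ a : R).
Local Notation grid n k := (k%:R * dyad n : R).
Hypothesis f_regular : exists n1 : nat, forall n t, (n1 <= n)%N -> 0 <= t <= 1 ->
  `|f t - f (grid n (cell n t))| <= r n.
Hypothesis f_spread : exists n2 : nat, forall n (k1 : 'I_(2 ^ n).+1), (n2 <= n)%N ->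
  k1 \in C n ->
  #|[set k in C n | `|f (grid n k) - f (grid n k1)| <= 4 * r n]%SET|%:R <=
    L * dyad n `^ (- e).

(** Few cells of level [n] are mapped near any single ball of radius [r n],
    so a set covered by [N] such balls has a preimage covered by about [N]
    cells. *)
Lemma preimage_null (F : set R) (u v : R) : 0 <= u ->
  (upper_minkowski_dim F < u%:E)%E -> a * u + e < v -> 0 <= v ->
  hausdorff_null v (D `&` f @^-1` F).
Proof.
move=> u0 Fu uv v0; have [r0 r0_gt0 Fr] := minkowski_cover Fu.
have [n1 Hn1] := f_regular; have [n2 Hn2] := f_spread.
pose p := v - (a * u + e); have p0 : 0 < p by rewrite subr_gt0.
pose x : R := 2^-1 `^ p.
have x0 : 0 < x by rewrite powR_gt0.
have x1 : x < 1 by exact: half_powR_lt1.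
have xE n : dyad n `^ p = x ^+ n.
  have h2 : (0 : R) <= 2^-1 by rewrite invr_ge0.
  by rewrite /dyad -(powR_mulrn n h2) -(powR_mulrn n (ltW x0)) /x powRAC.
apply: hausdorff_null_double => d eta d_gt0 eta0.
have [n3 Hn3] := dyad_small d_gt0.
have [n4 Hn4] : exists n4, forall n, (n4 <= n)%N -> r n < r0.
  have [n4 h] := dyad_powR_small a0 (divr_gt0 r0_gt0 (ltr0Sn R 1)).
  exists n4 => n n4n; apply: (@le_lt_trans _ _ (r0 / 2)); last by lra.
  apply: le_trans h; apply: ge0_ler_powR; rewrite ?nnegrE ?dyad_ge0//.
    exact: ltW.
  exact: le_dyad.
have [n5 Hn5] : exists n5, L * (x ^+ n5 / (1 - x)) <= eta.
  have y0 : 0 < 1 - x by rewrite subr_gt0.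
  have L1 : 0 < L + 1 by rewrite ltr_wpDl.
  have [|n5 h] := @dyad_powR_small R p (eta * (1 - x) / (L + 1)) p0.
    by rewrite !mulr_gt0// invr_gt0.
  exists n5; rewrite -xE mulrA ler_pdivrMr//.
  move: h; rewrite ler_pdivlMr//; apply: le_trans.
  by rewrite mulrC ler_wpM2l ?powR_ge0// lerDl.
pose n0 := maxn n1 (maxn n2 (maxn n3 (maxn n4 n5))).
(* The chosen cells of level at least [n0] that meet the preimage. *)
pose hit n (k : nat) := [/\ (n0 <= n)%N, exists2 k', k' \in C n & k' = k :> nat &
  exists t, [/\ D t, F (f t) & cell n t = k]].
pose U n k : set R := if `[< hit n k >] then [set t | 0 <= t /\ cell n t = k] else set0.
have Udiam n k : forall s t, U n k s -> U n k t -> `|s - t| <= dyad n.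
  rewrite /U; case: ifP => // _ s t [s0 sk] [t0 tk].
  have := cell_itv n s0; have := cell_itv n t0; rewrite sk tk mulrSr mulrDl mul1r.
  by move=> /andP[h1 h2] /andP[h3 h4]; rewrite ler_norml; lra.
have U0 n k : (n < n0)%N -> U n k = set0.
  move=> nn; rewrite /U; case: ifP => // /asboolP[]; by rewrite leqNgt nn.
have level n : (n0 <= n)%N ->
   (\sum_(0 <= k <oo) hausdorff_weight v (U n k) <= (L * x ^+ n)%:E)%E.
  move=> nn0; rewrite /n0 !geq_max in nn0.
  have /and5P[nn1 nn2 nn3 nn4 nn5] := nn0.
  have dn0 : dyad n != 0 :> R by rewrite gt_eqF ?dyad_gt0.
  pose H : {set 'I_(2 ^ n).+1} := [set k : 'I_(2 ^ n).+1 | `[< hit n k >]]%SET.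
  have cardH : #|H|%:R <= L * dyad n `^ (- (a * u + e)).
    have rn0 : 0 < r n by rewrite powR_gt0// dyad_gt0.
    have [m [c [Fc mc]]] := Fr _ rn0 (Hn4 _ nn4).
    pose S (i : 'I_m.+1) := [set k in C n | `|f (grid n k) - c i| <= 2 * r n]%SET.
    have HS k : k \in H -> exists i, k \in S i.
      rewrite inE => /asboolP[_ [k' k'C /val_inj k'k] [t [Dt Ft tk]]].
      have t01 : 0 <= t <= 1 by have := D01 Dt; rewrite /= in_itv.
      have [i _] := Fc _ Ft; rewrite closed_ballE// /closed_ball_/= => hi.
      exists i; rewrite inE -k'k k'C/=; have := Hn1 n t nn1 t01.
      rewrite tk -k'k => h; rewrite distrC.
      have := ler_distD (f t) (c i) (f (grid n k')); lra.
    have Si i : #|S i|%:R <= L * dyad n `^ (- e).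
      have [->|/set0Pn[k1]] := eqVneq (S i) finset.set0.
        by rewrite cards0 mulr_ge0 ?powR_ge0.
      rewrite inE => /andP[k1C k1i]; apply: le_trans (Hn2 n k1 nn2 k1C).
      rewrite ler_nat; apply: subset_leq_card; apply/fintype.subsetP => k.
      rewrite !inE => /andP[-> ki] /=.
      have := ler_distD (c i) (f (grid n k)) (f (grid n k1)).
      by rewrite [`|c i - _|]distrC; lra.
    apply: (@le_trans _ _ (m.+1%:R * (L * dyad n `^ (- e)))).
      apply: (@le_trans _ _ (\sum_(i < m.+1) #|S i|%:R)).
        by rewrite -natr_sum ler_nat; exact: card_le_sum.
      apply: (@le_trans _ _ (\sum_(i < m.+1) (L * dyad n `^ (- e)))).
        by apply: ler_sum => i _; exact: Si.
      by rewrite sumr_const card_ord mulr_natl.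
    apply: (@le_trans _ _ (r n `^ (- u) * (L * dyad n `^ (- e)))).
      by apply: ler_wpM2r => //; rewrite mulr_ge0// powR_ge0.
    rewrite mulrCA -powRrM -powRD; last by rewrite dn0 implybT.
    by rewrite mulrN -opprD.
  apply: (@le_trans _ _ (#|H|%:R * dyad n `^ v)%:E); last first.
    rewrite lee_fin -xE /p powRD; last by rewrite dn0 implybT.
    rewrite [dyad n `^ v * _]mulrC mulrA; apply: ler_wpM2r => //.
    exact: powR_ge0.
  apply: nneseries_le_bound => [k|N]; first exact: hausdorff_weight_ge0.
  apply: (@le_trans _ _ (\sum_(0 <= k < N)
      (if (k \in [seq val k | k <- enum H]) then dyad n `^ v else 0)%:E)%E).
    apply: lee_sum => k _; rewrite {1}/U; case: asboolP => [hk|_]; last first.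
      by rewrite hausdorff_weight0 lee_fin; case: ifP => // _; exact: powR_ge0.
    rewrite ifT; last first.
      have [_ [k' k'C k'k] _] := hk; apply/mapP; exists k' => //.
      by rewrite mem_enum inE; apply/asboolP; rewrite k'k.
    apply: hausdorff_weight_le => //; first exact: dyad_ge0.
    move=> s t hs ht; apply: (Udiam n k); rewrite /U; case: asboolP => //.
  rewrite sumEFin lee_fin -big_mkcond/= big_const_seq iter_addr_0 -[leLHS]mulr_natl.
  apply: ler_wpM2r; first exact: powR_ge0.
  rewrite ler_nat cardE -(size_map val) -size_filter.
  apply: uniq_leq_size; first by rewrite filter_uniq// iota_uniq.
  by move=> k; rewrite mem_filter => /andP[].
exists U; split.
- move=> t [Dt Ft]; have [n nn0 [k kC kt]] := CD Dt n0.
  exists n => //; exists (cell n t) => //; rewrite /U.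
  have t0 : 0 <= t by have := D01 Dt; rewrite /= in_itv/= => /andP[].
  case: asboolP => // H; exfalso; apply: H; split => //; first by exists k.
  by exists t.
- move=> n k; have [nn0|nn0] := ltnP n n0.
    by rewrite U0// /diameter; apply: ge_ereal_sup => _ [? []].
  apply: diameter_le => s t hs ht; apply: (le_trans (Udiam _ _ _ _ hs ht)).
  apply: le_trans Hn3; apply: le_dyad; apply: leq_trans nn0.
  by rewrite /n0 !leq_max leqnn !orbT.
- apply: (@le_trans _ _ (L * (x ^+ n0 / (1 - x)))%:E); last first.
    rewrite lee_fin; apply: le_trans Hn5; rewrite ler_wpM2l// ler_wpM2r//.
      by rewrite invr_ge0 subr_ge0 ltW.
    by rewrite ler_wiXn2l// ?ltW// /n0 !leq_max leqnn !orbT.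
  apply: nneseries_le_bound => [n|N].
    by apply: nneseries_ge0 => *; exact: hausdorff_weight_ge0.
  apply: (@le_trans _ _ (\sum_(0 <= n < N) (L * (if (n0 <= n)%N then x ^+ n else 0))%:E)%E).
    apply: lee_sum => n _; case: ifPn => [|nn0]; first exact: level.
    rewrite mulr0 eseries0// => k _ _; rewrite U0 ?hausdorff_weight0//.
    by rewrite ltnNge.
  by rewrite sumEFin lee_fin -mulr_sumr ler_wpM2l// geometric_tail// ltW.
Qed.

End path_dimension.

(** * Hoelder continuity from dyadic increments *)

Section chaining.
Context {R : realType} (f : R -> R) (g : R) (n0 : nat).
Local Notation grid n k := (k%:R * dyad n : R).
Hypothesis g0 : 0 < g.
Hypothesis f_cont : {within `[0, 1], continuous f}.
Hypothesis f_incr : forall n k, (n0 <= n)%N -> (k < 2 ^ n)%N ->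
  `|f (grid n k.+1) - f (grid n k)| <= dyad n `^ g.
Let rho : R := 2^-1 `^ g.

Let rho_gt0 : 0 < rho. Proof. by rewrite powR_gt0. Qed.

Let rho_lt1 : rho < 1. Proof. exact: half_powR_lt1. Qed.

Let dyad_powRS n : dyad n.+1 `^ g = rho * dyad n `^ g.
Proof. by rewrite /dyad exprS powRM ?exprn_ge0. Qed.

Let grid_cell01 n (t : R) : 0 <= t <= 1 -> 0 <= grid n (cell n t) <= 1.
Proof.
move=> /andP[t0 t1]; have /andP[h _] := cell_itv n t0.
by rewrite mulr_ge0 ?dyad_ge0//= (le_trans h).
Qed.

Let chain_step n (t : R) : (n0 <= n)%N -> 0 <= t <= 1 ->
  `|f (grid n.+1 (cell n.+1 t)) - f (grid n (cell n t))| <= dyad n.+1 `^ g.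
Proof.
move=> nn0 t01; have [t0 t1] := andP t01.
have := cell_parent t0 (leqnSn n); rewrite subSnn expn1 => hc.
have hcn := cell_le n.+1 t01.
have -> : grid n (cell n t) = grid n.+1 (cell n t).*2.
  by rewrite dyadS mulrA -muln2 natrM.
have [->|e] : cell n.+1 t = (cell n t).*2 \/ cell n.+1 t = (cell n t).*2.+1 by lia.
  by rewrite subrr normr0 powR_ge0.
by rewrite e; apply: f_incr; [exact: leqW|rewrite -e].
Qed.

(** By continuity [f t] is the limit of the values at the left ends of the cells
    of [t], and the differences of these values are dominated by a geometric
    series of ratio [rho]. *)
Lemma chaining_bound n (t : R) : (n0 <= n)%N -> 0 <= t <= 1 ->
  `|f t - f (grid n (cell n t))| <= dyad n `^ g / (1 - rho).
Proof.
move=> nn0 t01; have r1 : 0 < 1 - rho by rewrite subr_gt0.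
have chain m : `|f (grid (n + m) (cell (n + m) t)) - f (grid n (cell n t))| <=
    (dyad n `^ g - dyad (n + m) `^ g) / (1 - rho).
  elim: m => [|m IH]; first by rewrite addn0 !subrr normr0 mul0r.
  rewrite addnS; apply: (le_trans (ler_distD (f (grid (n + m) (cell (n + m) t))) _ _)).
  have := chain_step (leq_trans nn0 (leq_addr m n)) t01; rewrite dyad_powRS.
  move: IH; rewrite !ler_pdivlMr// => IH /(ler_wpM2r (ltW r1)) step.
  have := mulr_ge0 (powR_ge0 (dyad (n + m) : R) g) (sqr_ge0 (1 - rho)).
  rewrite expr2; lra.
apply/ler_addgt0Pr => e e0.
have /subspace_continuousP/(_ t) := f_cont; rewrite /= in_itv/= => /(_ t01).
move=> /cvgrPdist_le/(_ _ e0) [d /= d0 Hd].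
have [m dm] : exists m, dyad m <= d / 2 by apply: dyad_small; rewrite divr_gt0.
have h : `|f t - f (grid (n + m) (cell (n + m) t))| <= e.
  apply: Hd; last by rewrite /= in_itv/=; exact: grid_cell01.
  have [t0 _] := andP t01; have /andP[h1 h2] := cell_itv (n + m) t0.
  have h3 := @le_dyad R _ _ (leq_addl n m).
  rewrite /= ger0_norm ?subr_ge0//; move: h2; rewrite mulrSr mulrDl mul1r; lra.
have := ler_distD (f (grid (n + m) (cell (n + m) t))) (f t) (f (grid n (cell n t))).
have := chain m; have h4 : (dyad n `^ g - dyad (n + m) `^ g) / (1 - rho) <=
    dyad n `^ g / (1 - rho).
  by rewrite ler_pM2r ?invr_gt0// gerBl powR_ge0.
lra.
Qed.

(** At the level [n] with [dyad n.+1 < `|t - u| <= dyad n] the two times lie in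
    the same cell or in adjacent ones. *)
Lemma chaining_hoelder : exists2 K, 0 < K & forall t u : R, 0 <= t <= 1 -> 0 <= u <= 1 ->
  `|t - u| <= dyad n0 -> `|f t - f u| <= K * `|t - u| `^ g.
Proof.
have r1 : 0 < 1 - rho by rewrite subr_gt0.
have c0 : 0 < (1 - rho)^-1 by rewrite invr_gt0.
exists ((2 / (1 - rho) + 1) * 2 `^ g).
  by rewrite mulr_gt0 ?powR_gt0// addr_gt0// divr_gt0.
have wlog_lt (t u : R) : t < u -> 0 <= t <= 1 -> 0 <= u <= 1 -> `|t - u| <= dyad n0 ->
    `|f t - f u| <= (2 / (1 - rho) + 1) * 2 `^ g * `|t - u| `^ g.
  move=> tu t01 u01 tun0.
  have d0 : 0 < `|t - u| by rewrite normr_gt0 subr_eq0 lt_eqF.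
  have ex : exists n, dyad n < `|t - u|.
    have [|n nd] := @dyad_small R (`|t - u| / 2); first by rewrite divr_gt0.
    by exists n; apply: le_lt_trans nd _; lra.
  have [n nd nmin] := ex_minnP ex.
  have n0n : (n0 < n)%N.
    rewrite ltnNge; apply/negP => /(@le_dyad R _ _) h.
    by have := lt_le_trans nd tun0; rewrite ltNge h.
  case: n n0n nd nmin => // n; rewrite ltnS => n0n nd nmin.
  have dn : `|t - u| <= dyad n.
    by rewrite leNgt; apply/negP => /nmin; rewrite ltnn.
  have [[t0 _] [u0 _]] := (andP t01, andP u01).
  have hc := cell_close t0 u0 dn.
  have hc2 : (cell n t <= cell n u)%N.
    by apply: le_truncn; rewrite ler_wpM2r ?exprn_ge0// ltW.
  have mid : `|f (grid n (cell n t)) - f (grid n (cell n u))| <= dyad n `^ g.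
    have [->|e] : cell n u = cell n t \/ cell n u = (cell n t).+1.
      by clear -hc hc2; lia.
      by rewrite subrr normr0 powR_ge0.
    by rewrite e distrC; apply: f_incr => //; rewrite -e; exact: cell_le.
  have b1 := chaining_bound n0n t01; have b2 := chaining_bound n0n u01.
  apply: (@le_trans _ _ ((2 / (1 - rho) + 1) * dyad n `^ g)).
    have := ler_distD (f (grid n (cell n t))) (f t) (f u).
    have := ler_distD (f (grid n (cell n u))) (f (grid n (cell n t))) (f u).
    rewrite [`|f (grid n (cell n u)) - f u|]distrC.
    move: mid b1 b2; rewrite ![_ / (1 - rho)]mulrC; nra.
  rewrite -mulrA -powRM//; apply: ler_wpM2l; first by rewrite addr_ge0// divr_ge0// ltW.
  apply: ge0_ler_powR; rewrite ?nnegrE ?dyad_ge0 ?mulr_ge0//; first exact: ltW.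
  by rewrite dyadS ler_pM2l// ltW.
move=> t u t01 u01 tu; have [h|h|->] := ltgtP t u; first exact: wlog_lt.
  by rewrite distrC [`|t - u|]distrC; apply: wlog_lt => //; rewrite distrC.
by rewrite !subrr normr0 powR0 ?mulr0// gt_eqF.
Qed.

End chaining.

(** * Gaussian random variables *)

Section gaussian_law.
Context d (T : measurableType d) (R : realType) (P : probability T R).
Local Notation mu := (@lebesgue_measure R).
Implicit Types (X : T -> R) (f : R -> R) (m s q : R).

Lemma normal_law_integral X m s f : s != 0 -> measurable_fun setT X ->
  (forall A : set R, measurable A -> pushforward P X A = normal_prob m s A) ->
  measurable_fun setT f ->
  mu.-integrable setT (fun z => (f (`|s| * z + m) * gauss_pdf z)%:E) ->
  P.-integrable setT (EFin \o (f \o X)) /\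
  (\int[P]_w (f (X w))%:E = \int[mu]_z (f (`|s| * z + m)%R * gauss_pdf z)%:E)%E.
Proof.
move=> s0 mX law mf intf.
have [iN eN] := integral_normal_standard s0 mf intf.
have mEf : measurable_fun setT (EFin \o f) by exact/measurable_EFinP.
have lawI (h : R -> \bar R) :
    (\int[@pushforward _ _ T (measurableTypeR R) R P X]_x h x =
     \int[normal_prob m s]_x h x)%E.
  by apply: eq_measure_integral => A mA _; exact: law.
have iP : P.-integrable setT (EFin \o (f \o X)).
  apply/integrableP; split; first by apply/measurable_EFinP; exact: measurableT_comp.
  have := @ge0_integral_pushforward _ _ T (measurableTypeR R) R X mX P setT (fun x => `|(f x)%:E|%E)
    measurableT.
  rewrite preimage_setT /comp => <-; last 2 first.
  - exact: measurableT_comp.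
  - by [].
  by rewrite lawI; have /integrableP[] := iN.
split => //; rewrite -eN -lawI.
have := @integral_pushforward _ _ T (measurableTypeR R) R X mX P setT (EFin \o f) mEf.
by rewrite preimage_setT => ->.
Qed.

Lemma dirac_law_integral X m f : measurable_fun setT X ->
  (forall A : set R, measurable A -> pushforward P X A = \d_m A) ->
  measurable_fun setT f -> P.-integrable setT (EFin \o (f \o X)) /\
  (\int[P]_w (f (X w))%:E = (f m)%:E)%E.
Proof.
move=> mX law mf.
have mEf : measurable_fun setT (EFin \o f) by exact/measurable_EFinP.
have lawI (h : R -> \bar R) :
    (\int[pushforward P X]_x h x = \int[\d_m]_x h x)%E.
  by apply: eq_measure_integral => A mA _; exact: law.
have iP : P.-integrable setT (EFin \o (f \o X)).
  apply/integrableP; split; first by apply/measurable_EFinP; exact: measurableT_comp.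
  have := @ge0_integral_pushforward _ _ T R R X mX P setT (fun x => `|(f x)%:E|%E)
    measurableT.
  rewrite preimage_setT /comp => <-; last 2 first.
  - exact: measurableT_comp.
  - by [].
  rewrite lawI integral_dirac//; last exact: measurableT_comp.
  by rewrite diracT mul1e ltry.
split => //.
have := @integral_pushforward _ _ T R R X mX P setT (EFin \o f) mEf.
rewrite preimage_setT => <- //; rewrite lawI integral_dirac//.
by rewrite diracT mul1e.
Qed.

Lemma gauss_growth_affine (C a m : R) f : 0 <= C -> measurable_fun setT f ->
  (forall z, `|f z| <= C * (1 + `|z| + `|z| ^+ 2)) ->
  mu.-integrable setT (fun z => (f (a * z + m) * gauss_pdf z)%:E).
Proof.
move=> C0 mf fC.
have D0 : 0 <= C * (1 + `|a| + `|a| ^+ 2 + `|m| + `|m| ^+ 2) * 3.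
  by rewrite !mulr_ge0// !addr_ge0 ?sqr_ge0.
apply: (integrable_gauss_growth D0).
  by apply: measurableT_comp => //; exact: measurable_affine.
move=> z; apply: (le_trans (fC _)); rewrite -!mulrA; apply: ler_wpM2l => //.
have h := ler_normD (a * z) m; rewrite normrM in h.
have := normr_ge0 (a * z + m); have := normr_ge0 a; have := normr_ge0 z; have := normr_ge0 m.
move: h; set A := `|a|; set Z := `|z|; set M := `|m|; set Y := `|_ + _|.
move=> h M0 Z0 A0 Y0.
have h2 : Y ^+ 2 <= 2 * (A * Z) ^+ 2 + 2 * M ^+ 2.
  have := sqr_ge0 (A * Z - M); have : Y ^+ 2 <= (A * Z + M) ^+ 2.
    by rewrite ler_pXn2r ?nnegrE// addr_ge0// mulr_ge0.
  rewrite !expr2; nra.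
apply: (@le_trans _ _ (1 + (A * Z + M) + (2 * (A * Z) ^+ 2 + 2 * M ^+ 2))); first lra.
have : 0 <= A * Z ^+ 2 by rewrite mulr_ge0 ?sqr_ge0.
have : 0 <= M * Z by rewrite mulr_ge0.
have : 0 <= M * Z ^+ 2 by rewrite mulr_ge0 ?sqr_ge0.
have : 0 <= M ^+ 2 * Z by rewrite mulr_ge0 ?sqr_ge0.
have : 0 <= M ^+ 2 * Z ^+ 2 by rewrite mulr_ge0 ?sqr_ge0.
have : 0 <= A ^+ 2 * Z by rewrite mulr_ge0 ?sqr_ge0.
have : 0 <= A * Z by rewrite mulr_ge0.
have : 0 <= A ^+ 2 * Z ^+ 2 by rewrite mulr_ge0 ?sqr_ge0.
have := sqr_ge0 A; have := sqr_ge0 Z; have := sqr_ge0 M.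
rewrite exprMn; lra.
Qed.

(** The two moments determine the parameters of the law; the second alternative
    is the degenerate law. *)
Lemma gaussian_centered X q : measurable_fun setT X -> gaussian_variable P X ->
  (\int[P]_w (X w)%:E = 0)%E -> (\int[P]_w (X w ^+ 2)%:E = q%:E)%E ->
  (exists2 s : R, s != 0 & s ^+ 2 = q /\ forall f, measurable_fun setT f ->
     mu.-integrable setT (fun z => (f (`|s| * z) * gauss_pdf z)%:E) ->
     (\int[P]_w (f (X w))%:E = \int[mu]_z (f (`|s| * z)%R * gauss_pdf z)%:E)%E) \/
  (q = 0 /\ forall f, measurable_fun setT f -> (\int[P]_w (f (X w))%:E = (f 0)%:E)%E).
Proof.
move=> mX [[m [s [s0 law]]]|[m law]] EX EX2; [left|right].
- have i1 : mu.-integrable setT (fun z => (z * gauss_pdf z)%:E).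
    apply: (@integrable_gauss_growth _ 1) => // z; rewrite mul1r.
    by have := sqr_ge0 `|z|; lra.
  have i2 : mu.-integrable setT (fun z => (z ^+ 2 * gauss_pdf z)%:E).
    apply: (@integrable_gauss_growth _ 1) => //.
    by move=> z; rewrite mul1r normrX lerDr addr_ge0.
  have i0 := @integrable_gauss_pdf R.
  have e1 : (\int[mu]_z (z * gauss_pdf z)%:E = 0)%E.
    by rewrite -(fineK (integral_fune_fin_num _ i1))//; congr EFin; exact: gauss_mean.
  have e2 : (\int[mu]_z (z ^+ 2 * gauss_pdf z)%:E = 1)%E.
    by rewrite -(fineK (integral_fune_fin_num _ i2))//; congr EFin; exact: gauss_second_moment.
  have e0 : (\int[mu]_z (gauss_pdf z)%:E = 1)%E by exact: integral_normal_pdf.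
  have m0 : m = 0.
    have [|_] := @normal_law_integral X m s id s0 mX law (@measurable_id _ _ _).
      apply: (@gauss_growth_affine 1 _ _ id) => // z; rewrite mul1r.
      by have := sqr_ge0 `|z|; lra.
    rewrite EX.
    under eq_integral do rewrite mulrDl -mulrA EFinD !EFinM.
    rewrite integralD//; last 2 first.
    + by under eq_fun do rewrite -EFinM; exact: integrableZl.
    + exact: integrableZl.
    under eq_integral do rewrite -EFinM.
    by rewrite !integralZl// e1 e0 mule0 add0e mule1 => -[].
  have sq : s ^+ 2 = q.
    have [|_] := normal_law_integral s0 mX law
        (measurable_funX 2 (@measurable_id _ _ setT)).
      apply: (@gauss_growth_affine 1 _ _ (fun x => x ^+ 2)) => //.
      by move=> z; rewrite mul1r normrX lerDr addr_ge0.
    rewrite EX2 m0; under eq_integral do rewrite addr0 exprMn -mulrA EFinM.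
    by rewrite integralZl// e2 mule1 real_normK ?num_real// => -[].
  exists s => //; split => // f mf intf.
  have [|_ ->] := @normal_law_integral X m s f s0 mX law mf.
    by rewrite m0; under eq_fun do rewrite addr0.
  by rewrite m0; apply: eq_integral => z _; rewrite addr0.
- have [_ h1] := @dirac_law_integral X m id mX law (@measurable_id _ _ _).
  have m0 : m = 0 by have := h1; rewrite EX => -[].
  have [_ h2] := @dirac_law_integral X m (fun x => x ^+ 2) mX law
    (measurable_funX 2 (@measurable_id _ _ _)).
  split; first by have := h2; rewrite EX2 m0 expr0n /= => -[].
  by move=> f mf; have [_ ->] := dirac_law_integral mX law mf; rewrite m0.
Qed.

Lemma gaussian_cos X q : measurable_fun setT X -> gaussian_variable P X ->
  (\int[P]_w (X w)%:E = 0)%E -> (\int[P]_w (X w ^+ 2)%:E = q%:E)%E ->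
  (\int[P]_w (cos (X w))%:E = (expR (- q / 2))%:E)%E.
Proof.
move=> mX gX EX EX2; have mc := @measurable_cos R.
have [[s s0 [sq H]]|[-> H]] := gaussian_centered mX gX EX EX2; last first.
  by rewrite H// cos0 oppr0 mul0r expR0.
have ic : mu.-integrable setT (fun z => (cos (`|s| * z) * gauss_pdf z)%:E).
  apply: (@integrable_gauss_growth _ 1) => //.
    by apply: measurableT_comp => //; exact: measurable_funM.
  move=> z; rewrite mul1r; apply: (le_trans (cos_max _)).
  by rewrite -addrA lerDl addr_ge0 ?sqr_ge0.
rewrite H// -(fineK (integral_fune_fin_num _ ic))//; congr EFin.
have := gauss_cos 0 `|s|; rewrite cos0 mul1r real_normK ?num_real// sq => <-.
by congr fine; apply: eq_integral => z _; rewrite add0r.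
Qed.

(** Markov's inequality for [expR (X ^+ 2 / (4 * q))], whose expectation is the
    square root of 2. *)
Lemma gaussian_tail X q (x : R) : measurable_fun setT X -> gaussian_variable P X ->
  (\int[P]_w (X w)%:E = 0)%E -> (\int[P]_w (X w ^+ 2)%:E = q%:E)%E -> 0 < q -> 0 <= x ->
  (P [set w | (x < `|X w|)%R] <= (2 * expR (- x ^+ 2 / (4 * q)))%:E)%E.
Proof.
move=> mX gX EX EX2 q0 x0.
have [[s s0 [sq H]]|[qz _]] := gaussian_centered mX gX EX EX2; last first.
  by move: q0; rewrite qz ltxx.
pose f y := expR (y ^+ 2 / (4 * q)).
have mf : measurable_fun setT f.
  by apply: measurableT_comp => //; apply: measurable_funM => //; exact: measurable_funX.
have fE z : f (`|s| * z) = expR (- (0 + 2 * 0 * z + (- 2^-1) * z ^+ 2) / 2).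
  rewrite /f exprMn real_normK ?num_real// sq; congr expR; field.
  by rewrite gt_eqF.
have c0 : 0 < 1 + - 2^-1 :> R by lra.
have eI := gauss_expquad 0 0 c0.
have intf : mu.-integrable setT (fun z => (f (`|s| * z) * gauss_pdf z)%:E).
  apply/integrableP; split.
    apply/measurable_EFinP; apply: measurable_funM; last exact: measurable_gauss_pdf.
    by apply: measurableT_comp => //; exact: measurable_funM.
  under eq_integral do rewrite /= ger0_norm ?mulr_ge0 ?expR_ge0 ?gauss_pdf_ge0// fE.
  by rewrite eI ltry.
have EfX : (\int[P]_w (f (X w))%:E <= 2%:E)%E.
  rewrite H//; under eq_integral do rewrite fE.
  rewrite eI lee_fin expr0n mul0r subr0 oppr0 mul0r expR0 mul1r.
  rewrite -[leRHS]invrK lef_pV2 ?posrE ?invr_gt0 ?sqrtr_gt0//.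
  rewrite [leLHS](_ : 2^-1 = Num.sqrt (2^-1 ^+ 2)); last first.
    by rewrite sqrtr_sqr ger0_norm ?invr_ge0.
  by apply: ler_wsqrtr; lra.
have mA : measurable [set w | x < `|X w|].
  rewrite -[X in measurable X]setTI.
  apply: (@measurable_fun_ltr _ _ _ _ (cst x) (fun w => `|X w|)) => //.
  exact: measurableT_comp.
rewrite -[X in P X]setIT -integral_indic//.
apply: (@le_trans _ _ (\int[P]_w ((expR (- x ^+ 2 / (4 * q)))%:E * (f (X w))%:E))%E).
  apply: ge0_le_integral => //.
  - by apply/measurable_EFinP; exact: measurable_indic.
  - apply: emeasurable_funM => //; apply/measurable_EFinP; exact: measurableT_comp.
  move=> w _; rewrite -EFinM lee_fin indicE.
  case: (boolP (w \in _)) => [|_]; last by rewrite mulr_ge0 ?expR_ge0.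
  rewrite inE /= => xX; rewrite -expRD -[leLHS]expR0 ler_expR -mulrDl divr_ge0//.
    rewrite -(real_normK (num_real (X w))) addrC subr_ge0 ler_pXn2r ?nnegrE//.
    exact: ltW.
  by rewrite mulr_ge0// ltW.
rewrite ge0_integralZl//.
- by rewrite [(2 * _)%R]mulrC EFinM lee_wpmul2l// lee_fin expR_ge0.
- by apply/measurable_EFinP; exact: measurableT_comp.
- by move=> w _; rewrite lee_fin expR_ge0.
Qed.

End gaussian_law.

(** * Moments of fractional Brownian motion *)

Section fbm_moments.
Context d (T : measurableType d) (R : realType) (P : probability T R).
Context (alpha : R) (B : R -> {RV P >-> R}).
Hypothesis alpha01 : 0 < alpha < 1.
Hypothesis fbm : fractional_brownian_motion alpha B.
Local Notation mu := (@lebesgue_measure R).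
Implicit Types (s t : R).

Definition fbm_cov (s t : R) : R :=
  2^-1 * (`|s| `^ (2 * alpha) + `|t| `^ (2 * alpha) - `|s - t| `^ (2 * alpha)).

Let alpha2 : 2 * alpha != 0.
Proof. by apply: lt0r_neq0; have [] := andP alpha01; lra. Qed.

Lemma fbm_covC s t : fbm_cov s t = fbm_cov t s.
Proof. by rewrite /fbm_cov distrC [`|s| `^ _ + _]addrC. Qed.

Lemma measurable_fbm t : measurable_fun setT (B t : T -> R).
Proof. exact: measurable_funP. Qed.

Lemma fbm_integral_mul s t : 0 <= s <= 1 -> 0 <= t <= 1 ->
  (\int[P]_w (B s w * B t w)%:E = (fbm_cov s t)%:E)%E.
Proof.
move=> s01 t01; have := fbm_covariance fbm t01 s01.
by rewrite unlock => ->.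
Qed.

Lemma fbm_integrable_mul s t : 0 <= s <= 1 -> 0 <= t <= 1 ->
  P.-integrable setT (fun w => (B s w * B t w)%:E).
Proof.
move=> s01 t01.
have i2 u : 0 <= u <= 1 -> P.-integrable setT (fun w => (B u w * B u w)%:E).
  move=> u01; apply/integrableP; split.
    by apply/measurable_EFinP; apply: measurable_funM; exact: measurable_fbm.
  under eq_integral do rewrite /= ger0_norm -?expr2 ?sqr_ge0// expr2.
  by rewrite fbm_integral_mul// ltry.
apply: (@le_integrable _ _ _ P setT measurableT _
  (fun w => (B s w * B s w)%:E + (B t w * B t w)%:E)%E).
- by apply/measurable_EFinP; apply: measurable_funM; exact: measurable_fbm.
- move=> w _; rewrite /= lee_fin -!expr2 [leRHS]ger0_norm ?addr_ge0 ?sqr_ge0//.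
  rewrite normrM -(real_normK (num_real (B s w))) -(real_normK (num_real (B t w))).
  have := sqr_ge0 (`|B s w| - `|B t w|); have := sqr_ge0 `|B s w|.
  by have := sqr_ge0 `|B t w|; rewrite !expr2; lra.
- by apply: integrableD => //; exact: i2.
Qed.

Lemma fbm_integrable t : 0 <= t <= 1 -> P.-integrable setT (fun w => (B t w)%:E).
Proof.
move=> t01; apply: (@le_integrable _ _ _ P setT measurableT _
  (fun w => cst 1%:E w + (B t w * B t w)%:E)%E).
- by apply/measurable_EFinP; exact: measurable_fbm.
- move=> w _; rewrite /= lee_fin -!expr2 [leRHS]ger0_norm ?addr_ge0 ?sqr_ge0//.
  rewrite -(real_normK (num_real (B t w))).
  by have := sqr_ge0 (`|B t w| - 1); have := normr_ge0 (B t w); rewrite !expr2; lra.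
- apply: integrableD => //; last exact: fbm_integrable_mul.
  apply/integrableP; split; first exact: measurable_cst.
  by rewrite /= normr1 integral_cst//= mul1e probability_setT ltry.
Qed.

Lemma fbm_mean t : 0 <= t <= 1 -> (\int[P]_w (B t w)%:E = 0)%E.
Proof.
move=> t01; have [t0 t1] := andP t01.
have [t_eq0|t_neq0] := eqVneq t 0.
  rewrite t_eq0 -[RHS](@integral0 _ _ _ P setT).
  apply: ae_eq_integral => //.
    by apply/measurable_EFinP; exact: measurable_fbm.
  by apply: filterS (fbm_start fbm) => w /= h _; rewrite h.
have {t0}t0 : 0 < t by rewrite lt0r t_neq0.
have law : forall A : set R, measurable A ->
    pushforward P (fun w => t `^ (- alpha) * B t w) A = normal_prob 0 1 A.
  by apply: (fbm_scaling fbm); rewrite t0.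
have mX : measurable_fun setT (fun w => t `^ (- alpha) * B t w).
  by apply: measurable_funM => //; exact: measurable_fbm.
have iG : mu.-integrable setT (fun z => ((`|1| * z + 0) * gauss_pdf z)%:E).
  apply: (@gauss_growth_affine _ 1 _ _ id) => // z; rewrite mul1r.
  by have := sqr_ge0 `|z|; lra.
have [_] := normal_law_integral (oner_neq0 R) mX law (@measurable_id _ _ _) iG.
rewrite -[RHS](fineK (integral_fune_fin_num _ iG))//.
have -> : fine (\int[mu]_z ((`|1| * z + 0) * gauss_pdf z)%:E) = 0.
  rewrite -[RHS](@gauss_mean R); congr fine; apply: eq_integral => z _.
  by rewrite normr1 mul1r addr0.
under eq_integral do rewrite EFinM.
rewrite integralZl//; last exact: fbm_integrable.
move=> /eqP; rewrite mule_eq0 eqe gt_eqF ?powR_gt0//= => /eqP.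
by [].
Qed.

Lemma fbm_comb_mean n (c t : 'I_n -> R) : (forall i, 0 <= t i <= 1) ->
  (\int[P]_w (\sum_(i < n) c i * B (t i) w)%:E = 0)%E.
Proof.
move=> t01; under eq_integral do rewrite -sumEFin.
rewrite integral_sum//; last first.
  by move=> i; under eq_fun do rewrite EFinM; apply: integrableZl => //; exact: fbm_integrable.
apply: big1 => i _; under eq_integral do rewrite EFinM.
by rewrite integralZl ?fbm_mean ?mule0//; exact: fbm_integrable.
Qed.

Lemma fbm_comb_second_moment n (c t : 'I_n -> R) : (forall i, 0 <= t i <= 1) ->
  (\int[P]_w ((\sum_(i < n) c i * B (t i) w) ^+ 2)%:E =
   (\sum_i \sum_j c i * c j * fbm_cov (t i) (t j))%:E)%E.
Proof.
move=> t01.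
have e w : (((\sum_(i < n) c i * B (t i) w) ^+ 2)%:E =
    \sum_i \sum_j (c i * c j)%:E * (B (t i) w * B (t j) w)%:E)%E.
  rewrite expr2 mulr_suml -sumEFin; apply: eq_bigr => i _.
  rewrite mulr_sumr -sumEFin; apply: eq_bigr => j _.
  by rewrite -EFinM; congr EFin; ring.
under eq_integral do rewrite e.
have ii i j : P.-integrable setT
    (fun w => (c i * c j)%:E * (B (t i) w * B (t j) w)%:E)%E.
  by apply: integrableZl => //; exact: fbm_integrable_mul.
rewrite integral_sum//; last by move=> i; exact: integrable_sum.
rewrite -sumEFin; apply: eq_bigr => i _; rewrite integral_sum// -sumEFin.
apply: eq_bigr => j _; rewrite integralZl//; last exact: fbm_integrable_mul.
by rewrite fbm_integral_mul.
Qed.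

Lemma measurable_fbm_comb n (c t : 'I_n -> R) :
  measurable_fun setT (fun w => \sum_(i < n) c i * B (t i) w).
Proof.
by apply: measurable_sum => i; apply: measurable_funM.
Qed.

Lemma fbm_comb_gaussian n (c t : 'I_n -> R) : (forall i, 0 <= t i <= 1) ->
  gaussian_variable P (fun w => \sum_(i < n) c i * B (t i) w).
Proof.
move=> t01; apply: (fbm_gaussian fbm) => i.
by have := t01 i; rewrite /= in_itv.
Qed.

Lemma fbm_comb_cos n (c t : 'I_n -> R) : (forall i, 0 <= t i <= 1) ->
  (\int[P]_w (cos (\sum_(i < n) c i * B (t i) w))%:E =
   (expR (- (\sum_i \sum_j c i * c j * fbm_cov (t i) (t j)) / 2))%:E)%E.
Proof.
move=> t01; apply: gaussian_cos.
- exact: measurable_fbm_comb.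
- exact: fbm_comb_gaussian.
- exact: fbm_comb_mean.
- exact: fbm_comb_second_moment.
Qed.

(** The terms that depend on one index only are annihilated by the zero sum. *)
Lemma fbm_cov_zero_sum (I : finType) (c t : I -> R) : \sum_i c i = 0 ->
  \sum_i \sum_j c i * c j * fbm_cov (t i) (t j) =
  - 2^-1 * \sum_i \sum_j c i * c j * `|t i - t j| `^ (2 * alpha).
Proof.
move=> c0.
have e i j : c i * c j * fbm_cov (t i) (t j) =
    2^-1 * (c i * `|t i| `^ (2 * alpha)) * c j
    + 2^-1 * c i * (c j * `|t j| `^ (2 * alpha))
    - 2^-1 * (c i * c j * `|t i - t j| `^ (2 * alpha)).
  by rewrite /fbm_cov; ring.
under eq_bigr do under eq_bigr do rewrite e.
under eq_bigr do rewrite sumrB big_split/= -!mulr_sumr c0 mulr0 add0r.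
rewrite sumrB -mulr_suml -mulr_sumr c0 mulr0 mul0r sub0r -mulr_sumr mulNr.
by congr (- (_ * _)).
Qed.

Lemma fbm_increment_tail s t (x : R) : 0 <= s <= 1 -> 0 <= t <= 1 -> s != t ->
  0 <= x -> (P [set w | (x < `|B t w - B s w|)%R] <=
    (2 * expR (- x ^+ 2 / (4 * `|t - s| `^ (2 * alpha))))%:E)%E.
Proof.
move=> s01 t01 st x0.
pose tt (i : 'I_2) := if i == ord0 then t else s.
pose c (i : 'I_2) : R := if i == ord0 then 1 else - 1.
have tt01 i : 0 <= tt i <= 1 by rewrite /tt; case: ifP.
have eX w : B t w - B s w = \sum_(i < 2) c i * B (tt i) w.
  by rewrite big_ord_recl big_ord1 /c /tt /= mul1r mulN1r.
have c0 : \sum_i c i = 0 by rewrite big_ord_recl big_ord1 /c /= subrr.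
have q : \sum_i \sum_j c i * c j * fbm_cov (tt i) (tt j) = `|t - s| `^ (2 * alpha).
  rewrite fbm_cov_zero_sum// !big_ord_recl !big_ord0 /c /tt /= !subrr !normr0.
  by rewrite powR0// [`|s - t|]distrC; lra.
under eq_set do rewrite eX.
apply: gaussian_tail => //.
- exact: measurable_fbm_comb.
- exact: fbm_comb_gaussian.
- exact: fbm_comb_mean.
- by rewrite fbm_comb_second_moment// q.
- by rewrite powR_gt0// normr_gt0 subr_eq0 eq_sym.
Qed.

End fbm_moments.

(** * Energy of balanced sets *)

Section energy.
Context {R : realType}.

(** A balanced set has few points at distance about [2 ^ l] from [j]: they lie
    in five blocks of length [2 ^ l].  Summing over [l] bounds its discrete
    Riesz energy. *)
Lemma balanced_energy (n : nat) (s alpha : R) (C : {set 'I_(2 ^ n).+1})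
    (j : 'I_(2 ^ n).+1) : 0 <= alpha -> alpha <= s ->
  (forall m i, (m <= n)%N ->
    #|[set k in C | (k %/ 2 ^ (n - m) == i)%N]%SET|%:R <=
    n.+1%:R * (2 ^+ (n - m)) `^ s :> R) ->
  \sum_(k in C | k != j) `|k%:R - j%:R| `^ (- alpha) <=
  5 * n.+1%:R ^+ 2 * (2 ^+ n) `^ (s - alpha) :> R.
Proof.
move=> a0 as_ balanced.
(* [k] lies in a block of length [2 ^ l] whose distance to that of [j] is at
   most 2 blocks. *)
pose near l (i : 'I_5) k := (k %/ 2 ^ l + 2 == j %/ 2 ^ l + i)%N.
have two0 l : 0 < 2 ^+ l :> R by rewrite exprn_gt0.
apply: (@le_trans _ _ (\sum_(k in C) \sum_(l < n.+1) \sum_(i < 5)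
    (if near l i k then (2 ^+ l) `^ (- alpha) else 0))).
  rewrite big_mkcondr/=; apply: ler_sum => k kC.
  have term0 l i : 0 <= (if near l i k then (2 ^+ l) `^ (- alpha) else 0) :> R.
    by case: ifP => // _; exact: powR_ge0.
  have [kj|kj] /= := eqVneq k j.
    by apply: sumr_ge0 => l _; apply: sumr_ge0 => i _.
  have knat : (k : nat) != j by [].
  pose D := ((k - j) + (j - k))%N.
  have D0 : (0 < D)%N by rewrite /D; move/eqP: knat; lia.
  have Dn : (D <= 2 ^ n)%N.
    by have := ltn_ord k; have := ltn_ord j; rewrite /D; lia.
  have eD : `|k%:R - j%:R| = D%:R :> R.
    rewrite /D; have [h|h] := leqP j k.
      by rewrite (_ : (j - k = 0)%N) ?addn0 ?natrB ?ger0_norm ?subr_ge0 ?ler_nat//; apply/eqP.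
    rewrite distrC (_ : (k - j = 0)%N); last by apply/eqP; exact: ltnW.
    by rewrite add0n natrB ?ger0_norm ?subr_ge0 ?ler_nat// ltnW.
  have [lD Dl] : (2 ^ trunc_log 2 D <= D)%N /\ (D < 2 ^ (trunc_log 2 D).+1)%N.
    by have := trunc_log_bounds (isT : (1 < 2)%N) D0; move/andP.
  have ln : (trunc_log 2 D < n.+1)%N.
    by rewrite ltnS -(@leq_exp2l 2)// (leq_trans lD).
  set l := trunc_log 2 D in lD Dl ln.
  have [i ni] : exists i, near l i k.
    have p0 : (0 < 2 ^ l)%N by rewrite expn_gt0.
    have h : (j %/ 2 ^ l <= k %/ 2 ^ l + 2)%N /\ (k %/ 2 ^ l + 2 - j %/ 2 ^ l < 5)%N.
      have e1 := divn_eq k (2 ^ l); have e2 := divn_eq j (2 ^ l).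
      have r1 := ltn_pmod k p0; have r2 := ltn_pmod j p0.
      move: Dl; rewrite expnS /D.
      move: e1 e2 r1 r2; move: (k %/ 2 ^ l)%N (j %/ 2 ^ l)%N (k %% 2 ^ l)%N (j %% 2 ^ l)%N.
      move: (2 ^ l)%N p0 (nat_of_ord k) (nat_of_ord j); clear.
      move=> p p0 k j a b c d -> -> cp dp h; split; nia.
    by exists (Ordinal h.2); rewrite /near /= subnKC// h.1.
  rewrite (bigD1 (Ordinal ln))//= (bigD1 i)//= ni -addrA.
  apply: (@le_trans _ _ ((2 ^+ l) `^ (- alpha))); last first.
    rewrite lerDl addr_ge0 ?sumr_ge0// => l' _; exact: sumr_ge0.
  rewrite eD !powRN lef_pV2 ?posrE ?powR_gt0 ?ltr0n//.
  by rewrite ge0_ler_powR ?nnegrE ?ler0n ?exprn_ge0// -natrX ler_nat.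
rewrite exchange_big/=.
have -> : 5 * n.+1%:R ^+ 2 * (2 ^+ n) `^ (s - alpha) =
    \sum_(l < n.+1) \sum_(i < 5) n.+1%:R * (2 ^+ n) `^ (s - alpha) :> R.
  rewrite !sumr_const !card_ord -mulrnA -[RHS]mulr_natl natrM; ring.
apply: ler_sum => l _; rewrite exchange_big/=; apply: ler_sum => i _.
rewrite -big_mkcondr/= sumr_const -[leLHS]mulr_natl.
have ln : (l <= n)%N by rewrite -ltnS.
have card_near : #|[pred k in C | near l i k]|%:R <= n.+1%:R * (2 ^+ l) `^ s :> R.
  have := balanced (n - l)%N (j %/ 2 ^ l + i - 2)%N (leq_subr _ _).
  rewrite subKn//; apply: le_trans; rewrite ler_nat; apply: subset_leq_card.
  apply/fintype.subsetP => k; rewrite !inE => /andP[-> /eqP h] /=; apply/eqP.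
  by rewrite -h addnK.
apply: (@le_trans _ _ (n.+1%:R * (2 ^+ l) `^ s * (2 ^+ l) `^ (- alpha))).
  by rewrite ler_wpM2r ?powR_ge0//.
rewrite -mulrA -powRD; last by rewrite (gt_eqF (two0 _)) ?implybT.
rewrite ler_wpM2l ?ler0n// ge0_ler_powR ?subr_ge0 ?nnegrE ?exprn_ge0//.
by rewrite -!natrX ler_nat leq_exp2l.
Qed.

End energy.

(** * Moments of the number of times with nearby values *)

Section cluster_moments.
Context d (T : measurableType d) (R : realType) (P : probability T R).
Context (alpha : R) (B : R -> {RV P >-> R}).
Hypothesis alpha01 : 0 < alpha < 1.
Hypothesis fbm : fractional_brownian_motion alpha B.
Variables (n : nat) (t : 'I_n -> R) (k1 : 'I_n) (C : {set 'I_n}) (r kappa M : R).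
Hypothesis t01 : forall k, 0 <= t k <= 1.
Hypothesis t_inj : injective t.
Hypothesis r0 : 0 < r.
Hypothesis kappa0 : 0 < kappa.
Hypothesis nondeterminism : nondeterminism_constant alpha kappa.
Hypothesis energy : forall j, \sum_(k in C)
  (if k == j then 1 else r / (Num.sqrt kappa * `|t k - t j| `^ alpha)) <= M.
Local Notation V := 'rV[R]_n.

Definition fbm_row (c : V) (w : T) : R := \sum_k c 0 k * B (t k) w.

Definition fbm_form (c e : V) : R :=
  \sum_i \sum_j c 0 i * e 0 j * fbm_cov alpha (t i) (t j).

Definition rel_increment (k : 'I_n) : V :=
  r^-1 *: (delta_mx 0 k - delta_mx 0 k1).

(** Up to a constant, a majorant of the number of the [k] in [C] for which the
    increment is at most [4 * r] ([card_cluster_le]); the Gaussian shape makes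
    its moments explicit. *)
Definition cluster_size (w : T) : R :=
  \sum_(k <- enum C) expR (- fbm_row (rel_increment k) w ^+ 2 / 2).

Lemma fbm_formC x y : fbm_form x y = fbm_form y x.
Proof.
rewrite /fbm_form exchange_big; apply: eq_bigr => i _; apply: eq_bigr => j _.
by rewrite fbm_covC [x _ _ * _]mulrC.
Qed.

Lemma fbm_form_lin z x y u : fbm_form (x + z *: y) u = fbm_form x u + z * fbm_form y u.
Proof.
rewrite /fbm_form mulr_sumr -big_split/=; apply: eq_bigr => i _.
rewrite mulr_sumr -big_split/=; apply: eq_bigr => j _.
by rewrite !mxE; ring.
Qed.

Lemma fbm_row_lin z x y w : fbm_row (x + z *: y) w = fbm_row x w + z * fbm_row y w.
Proof.
rewrite /fbm_row mulr_sumr -big_split/=; apply: eq_bigr => i _.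
by rewrite !mxE; ring.
Qed.

Lemma fbm_form_ge0 x : 0 <= fbm_form x x.
Proof.
rewrite -lee_fin /fbm_form -(fbm_comb_second_moment fbm (x 0) t01).
by apply: integral_ge0 => w _; rewrite lee_fin sqr_ge0.
Qed.

Lemma measurable_fbm_row x : measurable_fun setT (fbm_row x).
Proof. exact: measurable_fbm_comb. Qed.

Lemma fbm_form_cos x :
  (\int[P]_w (cos (fbm_row x w))%:E = (expR (- fbm_form x x / 2))%:E)%E.
Proof. exact: fbm_comb_cos. Qed.

Lemma sum_rel_increment k : \sum_j rel_increment k 0 j = 0.
Proof.
under eq_bigr do rewrite !mxE.
rewrite -mulr_sumr sumrB; have e j : \sum_i ((0 == 0 :> 'I_1) && (i == j))%:R = 1 :> R.
  by rewrite (bigD1 j)//= eqxx big1 ?addr0// => i /negbTE ->.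
by rewrite !e subrr mulr0.
Qed.

Lemma fbm_row_rel_increment k w :
  fbm_row (rel_increment k) w = (B (t k) w - B (t k1) w) / r.
Proof.
rewrite /fbm_row; under eq_bigr do rewrite !mxE -mulrA.
rewrite -mulr_sumr mulrC; congr (_ / _).
under eq_bigr do rewrite mulrBl.
rewrite sumrB.
have e j : \sum_i ((0 == 0 :> 'I_1) && (i == j))%:R * B (t i) w = B (t j) w.
  by rewrite (bigD1 j)//= eqxx mul1r big1 ?addr0// => i /negbTE ->; rewrite mul0r.
by rewrite !e.
Qed.

Local Notation x_ := rel_increment.
Local Notation w_ k j :=
  (if k == j then 1 else r / (Num.sqrt kappa * `|t k - t j| `^ alpha)).

(** Conditioning subtracts combinations of the increments observed: the sum of
    the coefficients stays 0, the coefficient of [t k] stays [r^-1], and no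
    time closer to [t k] than [t j0] comes in. *)
Lemma regress_rel_increment (js : seq 'I_n) k j0 :
  (forall j, j \in k1 :: js -> `|t k - t j0| <= `|t k - t j|) ->
  k \notin k1 :: js -> k != j0 ->
  kappa * (`|t k - t j0| `^ alpha / r) ^+ 2 <=
    regress fbm_form (map x_ js) (x_ k) (x_ k).
Proof.
move=> near kjs kj0.
have rho0 : 0 < `|t k - t j0|.
  by rewrite normr_gt0 subr_eq0; apply: contra_neq kj0 => /t_inj.
pose S (y : V) := [/\ y 0 k = r^-1, \sum_j y 0 j = 0 &
   forall j, j != k -> y 0 j != 0 -> j \in k1 :: js].
have kk1 : (k == k1) = false.
  by apply/negbTE; apply: contra kjs => /eqP ->; rewrite mem_head.
apply: (regress_lb fbm_formC fbm_form_lin fbm_form_ge0 (S := S)).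
- by rewrite mulr_ge0 ?sqr_ge0// ltW.
- move=> y z x [yk y0 ysupp] /mapP[j jjs ->]; split.
  + have kj : (k == j) = false.
      by apply/negbTE; apply: contra kjs => /eqP ->; rewrite inE jjs orbT.
    by rewrite !mxE kj kk1 andbF subrr !mulr0 addr0.
  + have e i : (y + z *: x_ j) 0 i = y 0 i + z * x_ j 0 i by rewrite mxE [X in _ + X]mxE.
    by under eq_bigr do rewrite e; rewrite big_split/= y0 -mulr_sumr sum_rel_increment mulr0 addr0.
  + move=> i ik; rewrite !mxE inE.
    have [->|ik1] := eqVneq i k1; first by [].
    have [->|ij] := eqVneq i j; first by rewrite jjs orbT.
    rewrite andbF subrr !mulr0 addr0 => /ysupp.
    by rewrite inE (negbTE ik1); exact.
- move=> y [yk y0 ysupp].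
  have := @nondeterminism _ (fun i => y 0 i) t k _ rho0 y0.
  have hh j : j != k -> y 0 j != 0 -> `|t k - t j0| <= `|t k - t j|.
    by move=> jk yj; apply: near; exact: ysupp.
  move=> /(_ hh); rewrite -fbm_cov_zero_sum//; apply: le_trans.
  rewrite yk expr_div_n exprVn mulrA.
  suff -> : (`|t k - t j0| `^ alpha) ^+ 2 = `|t k - t j0| `^ (2 * alpha) by [].
  by rewrite [2 * _]mulrC powRrM powR_mulrn// powR_ge0.
- split.
  + by rewrite !mxE kk1 !eqxx /= subr0 mulr1.
  + exact: sum_rel_increment.
  + move=> j jk; rewrite !mxE (negbTE jk) andbF sub0r inE.
    by have [//|jk1] := eqVneq j k1; rewrite andbF oppr0 mulr0 eqxx.
Qed.

(** The weight of the nearest time is what matters, but that time depends on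
    [k]; bounding its weight by the sum of all of them makes it possible to
    sum over [k] for each [j] separately. *)
Lemma rel_increment_weight (js : seq 'I_n) k :
  (Num.sqrt (1 + regress fbm_form (map x_ js) (x_ k) (x_ k)))^-1 <=
    \sum_(j <- k1 :: js) w_ k j.
Proof.
have q0 := regress_ge0 fbm_formC fbm_form_lin fbm_form_ge0 (map x_ js) (x_ k).
have w0 j : 0 <= w_ k j.
  by case: ifP => // _; rewrite divr_ge0 ?mulr_ge0 ?powR_ge0 ?sqrtr_ge0// ltW.
have ex j : j \in k1 :: js -> w_ k j <= \sum_(j <- k1 :: js) w_ k j.
  by move=> jin; rewrite (big_rem j)//= lerDl sumr_ge0.
have [kjs|kjs] := boolP (k \in k1 :: js).
  apply: le_trans (ex _ kjs); rewrite eqxx invf_le1 ?sqrtr_gt0 ?ltr_wpDr//.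
  by rewrite -[leLHS]sqrtr1 ler_wsqrtr// lerDl.
pose j0 := [arg min_(j < k1 | j \in k1 :: js) `|t k - t j|]%O.
have [j0js near] : j0 \in k1 :: js /\
    forall j, j \in k1 :: js -> `|t k - t j0| <= `|t k - t j|.
  by rewrite /j0; case: arg_minP; [exact: mem_head|].
have kj0 : k != j0 by apply: contra kjs => /eqP ->.
apply: le_trans (ex _ j0js); rewrite (negbTE kj0).
have rho0 : 0 < `|t k - t j0| `^ alpha.
  by rewrite powR_gt0// normr_gt0 subr_eq0; apply: contra_neq kj0 => /t_inj.
have lb := regress_rel_increment near kjs kj0.
rewrite -[r / _]invrK lef_pV2 ?posrE ?invr_gt0 ?divr_gt0 ?mulr_gt0 ?sqrtr_gt0//.
  rewrite invf_div -mulrA -[_ / r]gtr0_norm ?divr_gt0// -sqrtr_sqr -sqrtrM; last exact: ltW.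
  by apply: ler_wsqrtr; apply: (le_trans lb); rewrite lerDr.
by rewrite ltr_wpDr.
Qed.

Lemma sum_density_le (js : seq 'I_n) :
  \sum_(k in C) density_at0 fbm_form (map x_ (k :: js)) <=
    M * (size js).+1%:R * density_at0 fbm_form (map x_ js).
Proof.
have d0 := density_at0_ge0 fbm_form (map x_ js).
rewrite /= -mulr_sumr [leRHS]mulrC ler_wpM2l//.
apply: (@le_trans _ _ (\sum_(k in C) \sum_(j <- k1 :: js) w_ k j)).
  by apply: ler_sum => k _; exact: rel_increment_weight.
rewrite exchange_big/= -[(size js).+1]/(size (k1 :: js)).
rewrite -[in leRHS]sum1_size natr_sum mulr_sumr.
by apply: ler_sum => j _; rewrite mulr1.
Qed.

Lemma cluster_size_ge0 w : 0 <= cluster_size w.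
Proof. by apply: sumr_ge0 => k _; exact: expR_ge0. Qed.

Lemma measurable_cluster_size : measurable_fun setT cluster_size.
Proof.
apply: measurable_sum => k; apply: measurableT_comp => //.
apply: measurable_funM => //; apply: measurable_funN.
by apply: measurable_funX; exact: measurable_fbm_row.
Qed.

Lemma energy_ge0 : 0 <= M.
Proof.
apply: le_trans (energy k1); apply: sumr_ge0 => k _; case: ifP => // _.
by rewrite divr_ge0 ?mulr_ge0 ?powR_ge0 ?sqrtr_ge0// ltW.
Qed.

(** Expanding the power turns a moment into a sum of joint densities; adding the
    indices one at a time costs a factor [M] for [k1] and for each index
    already present. *)
Lemma cluster_bump_moment p (js : seq 'I_n) :
  (\int[P]_w (bump fbm_row (map x_ js) w * cluster_size w ^+ p)%:E <=
   ((M * (size js + p)%:R) ^+ p * density_at0 fbm_form (map x_ js))%:E)%E.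
Proof.
have M0 := energy_ge0.
elim: p js => [|p IH] js.
  have := expectation_cos_bump fbm_formC fbm_form_lin fbm_form_ge0
    fbm_row_lin measurable_fbm_row fbm_form_cos (map x_ js) 0.
  have z : fbm_form 0 0 = 0.
    by rewrite /fbm_form big1// => i _; rewrite big1// => j _; rewrite !mxE !mul0r.
  have zr : regress fbm_form (map x_ js) 0 0 = 0.
    by have := regress_lin fbm_form_lin (map x_ js) (-1) 0 0 0; rewrite scaler0 addr0; lra.
  have zx w : fbm_row 0 w = 0 by rewrite /fbm_row big1// => i _; rewrite mxE mul0r.
  rewrite zr oppr0 mul0r expR0 mulr1 expr0 mul1r => <-.
  by under [leRHS]eq_integral do rewrite zx cos0 mul1r -[bump _ _ _]mulr1.
have e w : (bump fbm_row (map x_ js) w * cluster_size w ^+ p.+1)%:E =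
    (\sum_(k <- enum C) (bump fbm_row (map x_ (k :: js)) w * cluster_size w ^+ p)%:E)%E.
  rewrite sumEFin exprS mulrCA mulrC {2}/cluster_size mulr_sumr; congr EFin.
  by apply: eq_bigr => k _; rewrite /bump /= big_cons; ring.
under eq_integral do rewrite e.
rewrite ge0_integral_sum//; last 2 first.
- move=> k; apply/measurable_EFinP; apply: measurable_funM.
    exact: (measurable_bump measurable_fbm_row).
  by apply: measurable_funX; exact: measurable_cluster_size.
- move=> k w _; rewrite lee_fin mulr_ge0 ?exprn_ge0 ?bump_ge0//; exact: cluster_size_ge0.
have step k : (\int[P]_w (bump fbm_row (map x_ (k :: js)) w * cluster_size w ^+ p)%:E <=
   ((M * (size js + p.+1)%:R) ^+ p * density_at0 fbm_form (map x_ (k :: js)))%:E)%E.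
  by rewrite addnS -addSn; exact: (IH (k :: js)).
apply: (le_trans (lee_sum _ (fun k _ => step k))).
rewrite sumEFin lee_fin -mulr_sumr exprSr -mulrA ler_wpM2l ?exprn_ge0 ?mulr_ge0//.
rewrite big_enum; apply: (le_trans (sum_density_le js)).
rewrite ler_wpM2r ?density_at0_ge0// ler_wpM2l// ler_nat; lia.
Qed.

Lemma cluster_moment p :
  (\int[P]_w (cluster_size w ^+ p)%:E <= ((M * p%:R) ^+ p)%:E)%E.
Proof.
have := cluster_bump_moment p [::]; rewrite /= mulr1 add0n; apply: le_trans.
by under [leLHS]eq_integral do rewrite -[_ ^+ p]mul1r; rewrite /bump;
   under [leRHS]eq_integral do rewrite big_nil.
Qed.

Lemma cluster_markov p (lam : R) : 0 < lam ->
  (P [set w | (lam <= cluster_size w)%R] <= ((M * p%:R / lam) ^+ p)%:E)%E.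
Proof.
move=> lam0; set A := [set _ | _].
have mA : measurable A.
  rewrite /A -[X in measurable X]setTI.
  have -> : [set w | lam <= cluster_size w] = cluster_size @^-1` `[lam, +oo[%classic.
    by apply/seteqP; split=> w /=; rewrite in_itv/= andbT.
  by apply: measurable_cluster_size.
have lp0 : 0 < lam ^+ p by rewrite exprn_gt0.
rewrite expr_div_n EFinM -lee_pdivrMr ?invr_gt0// invrK muleC.
apply: le_trans (cluster_moment p).
rewrite -integral_cst// integral_mkcond.
apply: ge0_le_integral => //.
- by move=> w _; rewrite patchE; case: ifP => // _; rewrite lee_fin ltW.
- by apply/measurable_restrict => //; exact: measurable_cst.
- by apply/measurable_EFinP; apply: measurable_funX; exact: measurable_cluster_size.
- move=> w _; rewrite patchE; case: ifPn => [|_].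
    by rewrite inE => h; rewrite lee_fin lerXn2r ?nnegrE ?(ltW lam0)//; exact: cluster_size_ge0.
  by rewrite lee_fin exprn_ge0//; exact: cluster_size_ge0.
Qed.

(** The constant comes from [4 ^ 2 / 2 = 8]. *)
Lemma card_cluster_le w : #|[set k in C | `|B (t k) w - B (t k1) w| <= 4 * r]%SET|%:R
  <= expR 8 * cluster_size w.
Proof.
rewrite -sum1_card natr_sum mulr_sumr big_enum.
under eq_bigl do rewrite inE.
rewrite big_mkcondr/=; apply: ler_sum => k _; case: ifPn => [h|_]; last first.
  by rewrite mulr_ge0 ?expR_ge0.
rewrite fbm_row_rel_increment -expRD -[leLHS]expR0 ler_expR.
rewrite -(real_normK (num_real (_ / r))) normrM normfV (gtr0_norm r0).
have : `|B (t k) w - B (t k1) w| / r <= 4 by rewrite ler_pdivrMr.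
have : 0 <= `|B (t k) w - B (t k1) w| / r by rewrite divr_ge0// ltW.
by rewrite expr2; nra.
Qed.

End cluster_moments.

(** * Almost sure estimates along the dyadic times *)

Section dyadic_growth.
Context {R : realType}.
Local Notation dyad := (@dyad R).

Lemma dyadE n : dyad n = (2 ^+ n) `^ (-1).
Proof. by rewrite dyadV powR_inv1// exprn_ge0. Qed.

Lemma dyad_powR n (x : R) : dyad n `^ x = (2 ^+ n) `^ (- x).
Proof. by rewrite dyadE -powRrM mulN1r. Qed.

Lemma pow2_ge1 n : 1 <= 2 ^+ n :> R.
Proof. by rewrite exprn_ege1// ler1n. Qed.

Lemma grid01 n k : (k <= 2 ^ n)%N -> 0 <= k%:R * dyad n <= 1.
Proof.
move=> kn; rewrite mulr_ge0 ?dyad_ge0//= dyadV ler_pdivrMr ?exprn_gt0// mul1r.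
by rewrite -natrX ler_nat.
Qed.

Lemma powR_exprn (x e : R) p : (x `^ e) ^+ p = x `^ (e * p%:R).
Proof. by rewrite powRrM powR_mulrn ?powR_ge0. Qed.

Lemma poly_le_pow2 (e : R) : 0 < e ->
  exists2 K, 0 < K & forall n, n.+1%:R ^+ 2 <= K * (2 ^+ n) `^ e :> R.
Proof.
move=> e0; have l2 : 0 < ln (2 : R) by rewrite ln_gt0// ltr1n.
set c := e / 2 * ln 2; have c0 : 0 < c by rewrite mulr_gt0// divr_gt0.
exists ((1 + c^-1) ^+ 2); first by rewrite exprn_gt0// ltr_wpDr// invr_ge0 ltW.
move=> n; have -> : (2 ^+ n) `^ e = ((2 ^+ n) `^ (e / 2)) ^+ 2 :> R.
  by rewrite powR_exprn divfK.
rewrite -exprMn lerXn2r ?nnegrE ?ler0n ?mulr_ge0 ?powR_ge0 ?addr_ge0 ?invr_ge0 ?(ltW c0)//.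
have h : 1 + c * n%:R <= (2 ^+ n) `^ (e / 2).
  have -> : (2 ^+ n) `^ (e / 2) = expR (c * n%:R).
    by rewrite /powR gt_eqF ?exprn_gt0// lnXn// /c -mulr_natl; congr expR; ring.
  exact: expR_ge1Dx.
apply: (@le_trans _ _ ((1 + c^-1) * (1 + c * n%:R))).
  rewrite mulrDl mul1r mulrDr mulr1 mulrA mulVf ?gt_eqF// mul1r -natr1.
  have cn : 0 <= c * n%:R by rewrite mulr_ge0// ltW.
  have cV : 0 <= c^-1 by rewrite invr_ge0 ltW.
  by lra.
by rewrite ler_wpM2l// addr_ge0// invr_ge0 ltW.
Qed.

Lemma pow2_power (e : R) p n : 2 <= e * p%:R ->
  ((2 ^+ n) `^ (- e)) ^+ p <= dyad n ^+ 2.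
Proof.
move=> ep; rewrite dyadE !powR_exprn !mulNr mul1r.
by apply: ler_powR; rewrite ?pow2_ge1// lerN2.
Qed.

Lemma exp_decay (c : R) p : 0 < c -> (0 < p)%N -> exists2 K, 0 < K &
  forall y, 0 < y -> expR (- (c * y)) <= K * y^-1 ^+ p.
Proof.
move=> c0 p0; have q0 : 0 < p%:R / c by rewrite divr_gt0 ?ltr0n.
exists ((p%:R / c) ^+ p); first by rewrite exprn_gt0.
move=> y y0; rewrite -exprMn expRN -[_ / c]invrK -invfM exprVn.
rewrite lef_pV2 ?posrE ?expR_gt0 ?exprn_gt0 ?mulr_gt0 ?invr_gt0//.
(* The bound [x <= expR x] is used for [x = c * y / p], to the power [p]. *)
have -> : c * y = p%:R * ((p%:R / c)^-1 * y).
  by field; rewrite gt_eqF//= gt_eqF// ltr0n.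
rewrite expRM_natl lerXn2r ?nnegrE ?expR_ge0 ?mulr_ge0 ?invr_ge0 ?(ltW q0) ?(ltW y0)//.
by apply: le_trans (expR_ge1Dx _); rewrite lerDr.
Qed.

End dyadic_growth.

Section grid_borel_cantelli.
Context d (T : measurableType d) (R : realType) (P : probability T R).

(** Borel-Cantelli lemma: the probabilities of level [n] add up to order
    [dyad n], since there are at most [2 ^ n + 1] of them. *)
Lemma ae_grid_eventually (N : nat -> nat) (A : nat -> nat -> set T) (K : R) :
  0 <= K -> (forall n, (N n <= (2 ^ n).+1)%N) ->
  (forall n i, (i < N n)%N -> measurable (A n i)) ->
  (forall n i, (i < N n)%N -> (P (A n i) <= (K * dyad n ^+ 2)%:E)%E) ->
  {ae P, forall w, exists n0, forall n i, (n0 <= n)%N -> (i < N n)%N -> ~ A n i w}.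
Proof.
move=> K0 Nn mA PA.
pose F n := \big[setU/set0]_(i < N n) A n i.
have mF n : measurable (F n).
  by apply: bigsetU_measurable => i _; exact: mA.
have PF n : (P (F n) <= (2 * K * dyad n)%:E)%E.
  apply: (le_trans (le_mu_bigsetU _ _)) => [i iN|]; first exact: mA.
  apply: (@le_trans _ _ (\sum_(i < N n) (K * dyad n ^+ 2)%:E)%E).
    by apply: lee_sum => i _; exact: PA.
  rewrite sumEFin lee_fin sumr_const card_ord -[leLHS]mulr_natl.
  have h : (N n)%:R <= 2 * (2 ^+ n) :> R.
    rewrite -natrX -natrM ler_nat (leq_trans (Nn n))//.
    by have := expn_gt0 2 n; rewrite mulSn mul1n; lia.
  apply: (@le_trans _ _ (2 * 2 ^+ n * (K * dyad n ^+ 2))).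
    by rewrite ler_wpM2r// mulr_ge0// sqr_ge0.
  rewrite dyadV expr2 le_eqVlt; apply/orP; left; apply/eqP; field.
  by rewrite expf_neq0.
have sF : (\sum_(0 <= n <oo) P (F n) < +oo)%E.
  apply: (@le_lt_trans _ _ (4 * K)%:E); last exact: ltry.
  apply: nneseries_le_bound => // n.
  apply: (@le_trans _ _ (\sum_(0 <= i < n) (2 * K * dyad i)%:E)%E).
    by apply: lee_sum => i _; exact: PF.
  rewrite sumEFin lee_fin -mulr_sumr.
  have : \sum_(0 <= i < n) dyad i <= 2 :> R.
    have := @geometric_tail R 2^-1 0 n; rewrite expr0 => h.
    rewrite /dyad; apply: le_trans (h _ _) _; rewrite ?invr_ge0// ?invf_lt1// ?ltr1n//.
    by rewrite (_ : 1 - 2^-1 = 2^-1) ?div1r ?invrK//; lra.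
  by have := K0; nra.
exists (lim_sup_set F); split.
- apply: bigcap_measurable => // n _; apply: bigcup_measurable => m _; exact: mF.
- exact: lim_sup_set_cvg0.
move=> w /= nw n _; apply: contrapT => nF; apply: nw; exists n => m i nm iN Aw.
apply: nF; exists m => //; rewrite /F -bigcup_mkord; by exists i.
Qed.

End grid_borel_cantelli.

Section fbm_paths.
Context d (T : measurableType d) (R : realType) (P : probability T R).
Context (alpha : R) (B : R -> {RV P >-> R}).
Hypothesis alpha01 : 0 < alpha < 1.
Hypothesis fbm : fractional_brownian_motion alpha B.

(** The threshold exceeds the standard deviation by a factor that is a positive
    power of [2 ^ n], so the Gaussian tail beats every power of [dyad n]. *)
Lemma fbm_dyadic_increments (g : R) : 0 < g -> g < alpha ->
  {ae P, forall w, exists n0, forall n k, (n0 <= n)%N -> (k < 2 ^ n)%N ->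
    `|B (k.+1%:R * dyad n) w - B (k%:R * dyad n) w| <= dyad n `^ g}.
Proof.
move=> g0 ga; pose A n k : set T :=
  [set w | dyad n `^ g < `|B (k.+1%:R * dyad n) w - B (k%:R * dyad n) w|].
set e := 2 * (alpha - g); have e0 : 0 < e by rewrite mulr_gt0// subr_gt0.
pose p := (Num.truncn (2 / e)).+1.
have ep : 2 <= e * p%:R.
  by rewrite mulrC -ler_pdivrMr// ltW// truncnS_gt.
have quarter : 0 < 4^-1 :> R by rewrite invr_gt0.
have [K K0 Kexp] := exp_decay quarter (ltn0Sn _ : (0 < p)%N).
have h : {ae P, forall w, exists n0, forall n i, (n0 <= n)%N -> (i < 2 ^ n)%N -> ~ A n i w}.
  apply: (@ae_grid_eventually _ _ _ _ (fun n => 2 ^ n)%N _ (2 * K)).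
  - by rewrite mulr_ge0// ltW.
  - by move=> n; exact: leqnSn.
  - move=> n k kn; rewrite /A -[X in measurable X]setTI.
    have mX : measurable_fun setT
        (fun w => `|B (k.+1%:R * dyad n) w - B (k%:R * dyad n) w|).
      by apply: measurableT_comp => //; apply: measurable_funB; exact: measurable_fbm.
    have := mX measurableT `]dyad n `^ g, +oo[%classic (measurable_itv _).
    congr measurable; apply/seteqP; split=> w /=; rewrite in_itv/= andbT; by [move=> []|].
  - move=> n k kn.
    have st : k%:R * dyad n != k.+1%:R * dyad n :> R.
      by rewrite (inj_eq (mulIf (lt0r_neq0 (dyad_gt0 n)))) eqr_nat neq_ltn ltnSn.
    apply: le_trans (fbm_increment_tail alpha01 fbm _ _ st (powR_ge0 _ _)) _.
    + exact/grid01/ltnW.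
    + exact/grid01.
    rewrite lee_fin -mulrA ler_pM2l// -mulrBl -natrB ?leqnSn// subSnn mul1r.
    rewrite ger0_norm ?dyad_ge0//.
    have -> : - (dyad n `^ g) ^+ 2 / (4 * dyad n `^ (2 * alpha)) =
        - (4^-1 * (2 ^+ n) `^ e) :> R.
      rewrite powR_exprn !dyad_powR.
      rewrite [in RHS](_ : e = - (g * 2%:R) + 2 * alpha); last by rewrite /e; ring.
      rewrite powRD; last by rewrite (gt_eqF (exprn_gt0 _ _)) ?implybT.
      rewrite !powRN; field.
      by rewrite !gt_eqF ?powR_gt0 ?exprn_gt0.
    apply: (le_trans (Kexp _ _)); first by rewrite powR_gt0 ?exprn_gt0.
    by rewrite ler_wpM2l ?(ltW K0)// -powRN; exact: pow2_power.
apply: filterS h => w [n0 hw]; exists n0 => n k nn kn.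
by rewrite leNgt; apply/negP; exact: hw.
Qed.

(** The energy bound of level [n] is of order [2 ^ (3 * n * e)] by balance, so
    the cluster size exceeds [2 ^ (4 * n * e)] with a probability of order
    [2 ^ (- n * e * p)] for every [p]; any [p] with [2 <= e * p] will do. *)
Lemma fbm_spread (s a e : R) (C : forall n, {set 'I_(2 ^ n).+1}) :
  0 < e -> s = alpha + e -> a = alpha - e ->
  (forall n m j, (m <= n)%N ->
    #|[set k in C n | (k %/ 2 ^ (n - m) == j)%N]%SET|%:R <=
      n.+1%:R * (2 ^+ (n - m)) `^ s :> R) ->
  {ae P, forall w, exists n2, forall n k1, (n2 <= n)%N -> k1 \in C n ->
    #|[set k in C n | `|B (k%:R * dyad n) w - B (k1%:R * dyad n) w|
        <= 4 * dyad n `^ a]%SET|%:R <= expR 8 * dyad n `^ (- (4 * e))}.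
Proof.
move=> e0 sE aE balanced.
have [kappa kappa0 lnd] := strong_local_nondeterminism alpha01.
have [Kp Kp0 poly] := poly_le_pow2 e0.
have sq0 : 0 < Num.sqrt kappa by rewrite sqrtr_gt0.
have a_ge0 : 0 <= alpha by have [] := andP alpha01; lra.
pose t n (k : 'I_(2 ^ n).+1) : R := k%:R * dyad n.
have t01 n k : 0 <= t n k <= 1 by apply: grid01; rewrite -ltnS.
have t_inj n : injective (@t n).
  move=> k l /(mulIf (lt0r_neq0 (dyad_gt0 n))) /eqP; rewrite eqr_nat => /eqP.
  exact: val_inj.
pose r n : R := dyad n `^ a.
have r0 n : 0 < r n by rewrite powR_gt0 ?dyad_gt0.
(* The summand 1 is the diagonal term of the energy. *)
pose Q : R := 1 + 5 * Kp / Num.sqrt kappa.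
have Q0 : 0 < Q by rewrite ltr_wpDr// divr_ge0 ?mulr_ge0 ?ltW.
pose M n : R := Q * (2 ^+ n) `^ (3 * e).
have two0 n : 0 < 2 ^+ n :> R by rewrite exprn_gt0.
have energy n j : \sum_(k in C n) (if k == j then 1 else
    r n / (Num.sqrt kappa * `|t n k - t n j| `^ alpha)) <= M n.
  apply: (@le_trans _ _ (1 + \sum_(k in C n | k != j)
      (2 ^+ n) `^ e / Num.sqrt kappa * `|k%:R - j%:R| `^ (- alpha))).
    apply: (@le_trans _ _ (\sum_(k in C n) ((if k == j then 1 else 0) +
       if k != j then (2 ^+ n) `^ e / Num.sqrt kappa * `|k%:R - j%:R| `^ (- alpha) else 0))).
      apply: ler_sum => k _; have [//|kj] /= := eqVneq k j; first by rewrite addr0.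
      rewrite add0r /t -mulrBl normrM (ger0_norm (dyad_ge0 n)) powRM ?dyad_ge0//.
      rewrite /r !dyad_powR powRN [in leRHS](_ : e = - a + alpha); last by rewrite aE; ring.
      rewrite powRD ?(gt_eqF (two0 n)) ?implybT// !powRN.
      have kj0 : 0 < `|k%:R - j%:R| :> R by rewrite normr_gt0 subr_eq0 eqr_nat.
      rewrite le_eqVlt; apply/orP; left; apply/eqP; field.
      by rewrite !gt_eqF ?powR_gt0.
    rewrite big_split/= [in leRHS]big_mkcondr lerD2r -big_mkcondr/= big_mkcond/=.
    rewrite (bigD1 j)//= big1 => [|k /negbTE ->]; last by rewrite andbF.
    by rewrite addr0; case: ifP.
  rewrite -mulr_sumr.
  have alpha_s : alpha <= s by rewrite sE lerDl ltW.
  have h := balanced_energy j a_ge0 alpha_s (balanced n).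
  rewrite /M /Q mulrDl mul1r lerD//.
    by rewrite -[leLHS](powRr0 (2 ^+ n)) ler_powR ?pow2_ge1// mulr_ge0// ltW.
  apply: (@le_trans _ _ ((2 ^+ n) `^ e / Num.sqrt kappa *
      (5 * n.+1%:R ^+ 2 * (2 ^+ n) `^ (s - alpha)))).
    rewrite ler_wpM2l ?divr_ge0 ?powR_ge0 ?(ltW sq0)//; exact: h.
  have -> : s - alpha = e by rewrite sE addrAC subrr add0r.
  have -> : 3 * e = e + e + e by ring.
  rewrite !powRD ?(gt_eqF (two0 n)) ?implybT//.
  have := poly n; set x := (2 ^+ n) `^ e => hx.
  have x0 : 0 <= x by exact: powR_ge0.
  have -> : 5 * Kp / Num.sqrt kappa * (x * x * x) =
      x / Num.sqrt kappa * (5 * (Kp * x) * x) by ring.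
  by rewrite ler_wpM2l ?divr_ge0 ?(ltW sq0)// ler_wpM2r// ler_wpM2l.
pose lam n : R := dyad n `^ (- (4 * e)).
have lam0 n : 0 < lam n by rewrite powR_gt0 ?dyad_gt0.
pose p := (Num.truncn (2 / e)).+1.
have ep : 2 <= e * p%:R by rewrite mulrC -ler_pdivrMr// ltW// truncnS_gt.
pose G n (i : nat) := cluster_size B (@t n) (inord i) (C n) (r n).
pose A n (i : nat) : set T := [set w | lam n <= G n i w].
have h : {ae P, forall w, exists n0, forall n i, (n0 <= n)%N -> (i < (2 ^ n).+1)%N -> ~ A n i w}.
  apply: (@ae_grid_eventually _ _ _ _ (fun n => (2 ^ n).+1) _ ((Q * p%:R) ^+ p)).
  - by rewrite exprn_ge0// mulr_ge0// ltW.
  - by [].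
  - move=> n i _; rewrite /A -[X in measurable X]setTI.
    have mX := measurable_cluster_size B (@t n) (inord i) (C n) (r n).
    have := mX measurableT `[lam n, +oo[%classic (measurable_itv _).
    congr measurable; apply/seteqP; split=> w /=; rewrite in_itv/= andbT; by [move=> []|].
  - move=> n i _.
    apply: (@le_trans _ _ ((M n * p%:R / lam n) ^+ p)%:E).
      exact: (cluster_markov alpha01 fbm _ (@t01 n) (@t_inj n) (r0 n) kappa0 lnd
        (energy n) p (lam0 n)).
    have -> : M n * p%:R / lam n = Q * p%:R * (2 ^+ n) `^ (- e).
      rewrite /M /lam dyad_powR opprK (_ : - e = 3 * e + - (4 * e)); last by ring.
      by rewrite powRD ?(gt_eqF (two0 n)) ?implybT// powRN; ring.
    by rewrite lee_fin exprMn ler_wpM2l ?pow2_power// exprn_ge0// mulr_ge0// ltW.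
apply: filterS h => w [n0 hw]; exists n0 => n k1 nn k1C.
apply: (le_trans (card_cluster_le B (@t n) k1 (C n) (r0 n) w)).
rewrite ler_wpM2l ?expR_ge0// ltW// ltNge; apply/negP => hG.
by apply: (hw n k1 nn (ltn_ord k1)); rewrite /A /G /= inord_val.
Qed.

End fbm_paths.

(** * Dimensions of images and preimages *)

Section dimension_identity.
Context {R : realType} (f : R -> R) (alpha : R).
Hypothesis alpha0 : 0 < alpha.

Lemma hausdorff_dim_preimage_le (D : set R) (x : R) (E : set R) : 0 <= x ->
  (forall u v F, 0 <= u -> (upper_minkowski_dim F < u%:E)%E -> alpha * u < v ->
    hausdorff_null v (D `&` f @^-1` F)) ->
  (packing_dim E <= x%:E)%E ->
  (hausdorff_dim (D `&` f @^-1` E) <= (alpha * x)%:E)%E.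
Proof.
move=> x0 null_pre Ex; apply: hausdorff_dim_leP => [|v xv].
  by rewrite mulr_ge0// ltW.
pose u := (x + v / alpha) / 2.
have xv' : x < v / alpha by rewrite ltr_pdivlMr// mulrC.
have xu : x < u by rewrite /u; lra.
have uv : alpha * u < v by rewrite mulrC -ltr_pdivlMr// /u; lra.
have /packing_dim_lt[U EU Uu] : (packing_dim E < u%:E)%E.
  by rewrite (le_lt_trans Ex)// lte_fin.
have h : hausdorff_null v (\bigcup_i (D `&` f @^-1` U i)).
  apply: hausdorff_null_bigcup => i; apply: (null_pre u) => //.
  exact: le_trans (ltW xu).
apply: hausdorff_null_sub h => t [Dt]; rewrite /= EU => -[i _ Ui].
by exists i.
Qed.

(** A local Hoelder bound of exponent above [g] yields [g * dim (f @` A) <= dim A];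
    then [g] tends to [alpha].  If [f @` A] had infinite dimension, so
    would [A]. *)
Lemma hausdorff_dim_image_le (A : set R) :
  (forall g, g < alpha -> exists g' K d0 : R, [/\ g < g', 0 < g', 0 < K, 0 < d0 &
    forall t u, 0 <= t <= 1 -> 0 <= u <= 1 -> `|t - u| <= d0 ->
      `|f t - f u| <= K * `|t - u| `^ g']) ->
  A `<=` `[0, 1] ->
  (alpha%:E * hausdorff_dim (f @` A) <= hausdorff_dim A)%E.
Proof.
move=> hoelder A01.
have A0 := hausdorff_dim_ge0 A; have E0 := hausdorff_dim_ge0 (f @` A).
case Az : (hausdorff_dim A) A0 => [z| |] //= z0; last by rewrite leey.
rewrite lee_fin in z0.
have bound s g : z < s -> 0 < g -> g < alpha ->
    exists2 y, 0 <= y /\ g * y <= s & hausdorff_dim (f @` A) = y%:E.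
  move=> zs g0 ga; have s0 : 0 <= s by exact: le_trans (ltW zs).
  have [g' [K [d0 [gg' g'0 K0 d00 hK]]]] := hoelder g ga.
  have HA : hausdorff_null s A by apply: hausdorff_dim_lt_null; rewrite Az lte_fin.
  have HE : hausdorff_null (s / g') (f @` A).
    apply: hausdorff_null_hoelder (g'0) K0 d00 _ HA => // x y Ax Ay.
    by apply: hK; [have := A01 _ Ax|have := A01 _ Ay]; rewrite /= in_itv.
  have sg : 0 <= s / g' by rewrite divr_ge0// ltW.
  have := hausdorff_dim_le sg HE; move: E0.
  case: (hausdorff_dim _) => [y| |] //; rewrite !lee_fin => y0 ys.
  exists y => //; split => //; move: ys; rewrite ler_pdivlMr// => ys.
  by apply: le_trans ys; rewrite mulrC ler_wpM2l// ltW.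
have half : alpha / 2 < alpha by rewrite ltr_pdivrMr// ltr_pMr// ltr1n.
have half0 : 0 < alpha / 2 by rewrite divr_gt0.
have [|y [y0 _] Ey] := bound (z + 1) (alpha / 2) _ half0 half.
  by rewrite ltrDl.
rewrite Ey -EFinM lee_fin; apply/ler_addgt0Pr => e e0.
pose g := Num.max (alpha / 2) (alpha - e / (2 * (y + 1))).
have q0 : 0 < e / (2 * (y + 1)) by rewrite divr_gt0// mulr_gt0// ltr_wpDl.
have g0 : 0 < g by rewrite lt_max half0.
have ga : g < alpha by rewrite gt_max half ltrBlDr ltrDl.
have ze : z < z + e / 2 by rewrite ltrDl divr_gt0.
have [y' [_ gy] Ey'] := bound _ _ ze g0 ga.
have yy' : y = y' by apply/eqP; rewrite -eqe -Ey -Ey'.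
rewrite -yy' in gy.
have : (alpha - g) * y <= e / 2.
  apply: (@le_trans _ _ (e / (2 * (y + 1)) * y)).
    rewrite ler_wpM2r// lerBlDl -lerBlDr le_max lexx orbT//.
  rewrite invfM mulrA -mulrA ler_piMr ?divr_ge0 ?(ltW e0)//.
  by rewrite mulrC ler_pdivrMr ?ltr_wpDl// mul1r lerDl.
by move: gy; rewrite mulrBl; lra.
Qed.

End dimension_identity.

(** * Dimensions along the paths *)

Section fbm_preimages.
Context d (T : measurableType d) (R : realType) (P : probability T R).
Context (alpha : R) (B : R -> {RV P >-> R}).
Hypothesis alpha01 : 0 < alpha < 1.
Hypothesis fbm : fractional_brownian_motion alpha B.

Let alpha0 : 0 < alpha. Proof. by case/andP: alpha01. Qed.

(* Countably many parameters that tend to 0, so that the exceptional events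
   can be united. *)
Let eps (j : nat) : R := alpha / j.+2%:R.

Let eps0 j : 0 < eps j. Proof. by rewrite divr_gt0. Qed.

Let eps_lt j : eps j < alpha.
Proof. by rewrite ltr_pdivrMr// ltr_pMr// ltr1n. Qed.

Let eps_small x : 0 < x -> exists j, eps j < x.
Proof.
move=> x0; exists (Num.truncn (alpha / x)); rewrite ltr_pdivrMr// mulrC -ltr_pdivrMr//.
by rewrite (lt_trans (truncnS_gt _))// ltr_nat.
Qed.

Lemma fbm_increments_eventually : {ae P, forall w, forall j, exists n0, forall n k,
  (n0 <= n)%N -> (k < 2 ^ n)%N ->
  `|B (k.+1%:R * dyad n) w - B (k%:R * dyad n) w| <= dyad n `^ (alpha - eps j / 2)}.
Proof.
apply/ae_foralln => j; apply: (fbm_dyadic_increments alpha01 fbm).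
  by have := eps0 j; have := eps_lt j; lra.
by rewrite ltrBlDr ltrDl divr_gt0.
Qed.

Lemma fbm_hoelder : {ae P, forall w, forall g, g < alpha ->
  exists g' K d0 : R, [/\ g < g', 0 < g', 0 < K, 0 < d0 &
    forall t u, 0 <= t <= 1 -> 0 <= u <= 1 -> `|t - u| <= d0 ->
      `|B t w - B u w| <= K * `|t - u| `^ g']}.
Proof.
have cont := fbm_continuous fbm; have incr := fbm_increments_eventually.
apply: filterS2 cont incr => w cont incr g ga.
have [|j ej] := @eps_small (alpha - g); first by rewrite subr_gt0.
have [n0 h] := incr j; have := eps0 j; have := eps_lt j => ea e0.
have g0 : 0 < alpha - eps j / 2 by lra.
have [K K0 hK] := @chaining_hoelder R (fun t => B t w) (alpha - eps j / 2) n0 g0 cont h.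
by exists (alpha - eps j / 2), K, (dyad n0); split => //; [lra|exact: dyad_gt0].
Qed.

Variable D : set R.
Hypothesis D01 : D `<=` `[0, 1].
Hypothesis dimD : (hausdorff_dim D <= alpha%:E)%E.

Lemma fbm_preimage_null : {ae P, forall w, forall u v F, 0 <= u ->
  (upper_minkowski_dim F < u%:E)%E -> alpha * u < v ->
  hausdorff_null v (D `&` (fun t => B t w) @^-1` F)}.
Proof.
have nullD j : hausdorff_null (alpha + eps j) D.
  by apply: hausdorff_dim_lt_null; rewrite (le_lt_trans dimD)// lte_fin ltrDl.
have /choice[C HC] j := balanced_family (addr_gt0 alpha0 (eps0 j)) D01 (nullD j).
have spread := ae_foralln (fun j => fbm_spread alpha01 fbm (eps0 j) erefl erefl (HC j).2).
have cont := fbm_continuous fbm; have incr := fbm_increments_eventually.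
apply: filterS3 cont incr spread => w cont incr spread u v F u0 Fu uv.
have [|j ej] := @eps_small ((v - alpha * u) / 4); first by rewrite divr_gt0// subr_gt0.
have := eps0 j; have := eps_lt j => ea e0.
have a0 : 0 < alpha - eps j by rewrite subr_gt0.
apply: (preimage_null D01 (HC j).1 a0 (expR_ge0 8) _ (spread j) u0 Fu).
- have [n0 h] := incr j; have g0 : 0 < alpha - eps j / 2 by lra.
  have rho1 : 0 < 1 - 2^-1 `^ (alpha - eps j / 2) :> R by rewrite subr_gt0 half_powR_lt1.
  have [n1 small] := dyad_powR_small (divr_gt0 e0 (ltr0n R 2)) rho1.
  exists (maxn n0 n1) => n t; rewrite geq_max => /andP[nn0 nn1] t01.
  apply: le_trans (chaining_bound g0 cont h nn0 t01) _.
  rewrite ler_pdivrMr// [in leLHS](_ : alpha - eps j / 2 = alpha - eps j + eps j / 2); last by lra.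
  rewrite powRD; last by rewrite (gt_eqF (dyad_gt0 n)) implybT.
  rewrite ler_wpM2l ?powR_ge0// (le_trans _ small)//.
  by rewrite ge0_ler_powR ?nnegrE ?dyad_ge0 ?le_dyad// divr_ge0// ltW.
- have : 0 <= eps j * u by rewrite mulr_ge0// ltW.
  by rewrite mulrBl; lra.
- by apply: le_trans (ltW uv); rewrite mulr_ge0// ltW.
Qed.

End fbm_preimages.

Theorem corollary1p10 (d : measure_display) (T : measurableType d)
  (R : realType) (P : probability T R) (alpha : R) (B : R -> {RV P >-> R})
  (D : set R) :
  0 < alpha < 1 ->
  fractional_brownian_motion alpha B ->
  D `<=` `[0, 1] ->
  (hausdorff_dim D <= alpha%:E)%E ->
  {ae P, forall w, forall E : set R,
    E `<=` [set B t w | t in D] ->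
    hausdorff_dim E = packing_dim E ->
    hausdorff_dim ([set t | 0 <= t <= 1 /\ E (B t w)] `&` D) =
      (alpha%:E * hausdorff_dim E)%E} /\
  {ae P, forall w, forall y : R,
    [set B t w | t in D] y ->
    hausdorff_dim [set t | D t /\ B t w = y] = 0%E}.
Proof.
move=> alpha01 fbm D01 dimD; have [alpha0 _] := andP alpha01.
have null := fbm_preimage_null alpha01 fbm D01 dimD.
have hoelder := fbm_hoelder alpha01 fbm.
split; last first.
  apply: filterS null => w null y _.
  have -> : [set t | D t /\ B t w = y] = D `&` (fun t => B t w) @^-1` [set y] by [].
  apply/eqP; rewrite eq_le hausdorff_dim_ge0 andbT.
  have := hausdorff_dim_preimage_le alpha0 (lexx 0) null (packing_dim_set1 y).
  by rewrite mulr0.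
apply: filterS2 null hoelder => w null hoelder E EB dimE.
have -> : [set t | 0 <= t <= 1 /\ E (B t w)] `&` D = D `&` (fun t => B t w) @^-1` E.
  apply/seteqP; split=> t /=; first by case=> [[_ Et] Dt].
  by case=> Dt Et; split => //; split => //; have := D01 _ Dt; rewrite /= in_itv.
have lower : (alpha%:E * hausdorff_dim E <=
    hausdorff_dim (D `&` (fun t => B t w) @^-1` E))%E.
  have {1}-> : E = (fun t => B t w) @` (D `&` (fun t => B t w) @^-1` E).
    apply/seteqP; split=> [y Ey|y [t [Dt Et] <-]//].
    by have [t Dt By] := EB y Ey; exists t => //; split => //=; rewrite By.
  by apply: hausdorff_dim_image_le => // t [/D01].
apply/eqP; rewrite eq_le lower andbT.
have E0 := hausdorff_dim_ge0 E.
case Ex : (hausdorff_dim E) E0 => [x| |] // x0.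
  rewrite -EFinM; apply: hausdorff_dim_preimage_le => //.
  by rewrite -dimE Ex.
by rewrite gt0_muley ?lte_fin// leey.
Qed.
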